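(* Let $d\ge1$, $T>0$, $H\in(1/4,1)$, and let $X$ be a $d$-dimensional fractional Brownian motion with Hurst index $H$. Set $\alpha_H=\frac d2-1+\frac1{2H}$. Let $0<\alpha<\alpha_H$ be such that $\int_0^T\int_0^T K_\alpha(X_t-X_s)\,dt\,ds<\infty$ $P$-a.s. Then $$\liminf_{\varepsilon\to0}E\left[Z_{\alpha,\varepsilon}\right]=+\infty,\qquad Z_{\alpha,\varepsilon}:=\int_0^T\int_0^T K_\alpha(X_t-X_s)\langle D^0_\varepsilon X_t,D^0_\varepsilon X_s\rangle\,ds\,dt .$$
   Context: A real fractional Brownian motion with Hurst index $H\in(0,1)$ is a mean-zero continuous Gaussian process $(B_t)_{t\ge0}$ with $\mathrm{Cov}(B_s,B_t)=\frac12(|s|^{2H}+|t|^{2H}-|s-t|^{2H})$; a $d$-dimensional one has independent components which are real fractional Brownian motions with index $H$. $D^0_\varepsilon X_t=\frac{X_{t+\varepsilon}-X_{t-\varepsilon}}{2\varepsilon}$, with $X_{t-\varepsilon}=0$ for $t<\varepsilon$. For $\alpha>0$, $K_\alpha(x)=\frac{1}{\Gamma(\alpha)(4\pi)^{d/2}}\int_0^\infty t^{\alpha-\frac d2}e^{-\frac{|x|^2}{4t}-t}\frac{dt}{t}$, $x\in\mathbb{R}^d$, the convolution kernel of $(1-\Delta)^{-\alpha}$. Under the stated integrability, $Z_{\alpha,\varepsilon}$ is a well-defined nonnegative random variable, so its expectation is defined in $[0,+\infty]$. *)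

(* Defs.v *)
From HB Require Import structures.
From mathcomp Require Import all_boot all_order all_algebra.
From mathcomp Require Import all_classical all_reals all_analysis.

Set Implicit Arguments.
Unset Strict Implicit.
Unset Printing Implicit Defensive.

Import Order.TTheory GRing.Theory Num.Theory.
Import numFieldNormedType.Exports.

Local Open Scope classical_set_scope.
Local Open Scope ring_scope.

Section fractional_Brownian_motion.
Context {R : realType} {disp : measure_display} {Omega : measurableType disp}.
Variable P : probability Omega R.

(* The library's [normal_prob m s] is not a point mass for [s = 0], so the
   degenerate Gaussian laws are added here; [s] is the standard deviation. *)
Definition gaussian_law (m s : R) : set R -> \bar R :=
  if s == 0 then \d_m else normal_prob m s.

Definition gaussian_rv (Y : Omega -> R) : Prop :=
  exists m s : R, 0 <= s /\
    forall A : set R, measurable A -> pushforward P Y A = gaussian_law m s A.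

(* Processes are indexed by [0, +oo[: values at negative times are never
   constrained. *)
Definition gaussian_process (B : R -> Omega -> R) : Prop :=
  (forall t, 0 <= t -> measurable_fun setT (B t)) /\
  (forall (n : nat) (t c : 'I_n -> R), (forall i, 0 <= t i) ->
     gaussian_rv (fun w => \sum_(i < n) c i * B (t i) w)).

Definition real_fBm (H : R) (B : R -> Omega -> R) : Prop :=
  [/\ gaussian_process B,
      forall w, {within `[0, +oo[, continuous (B ^~ w)},
      forall t, 0 <= t -> ('E_P[B t] = 0)%E
    & forall s t, 0 <= s -> 0 <= t ->
        covariance P (B s) (B t) =
        (2^-1 * (`|s| `^ (2 * H) + `|t| `^ (2 * H)
                 - `|s - t| `^ (2 * H)))%:E].

Definition sigma_process (B : R -> Omega -> R) : set_system Omega :=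
  <<s \bigcup_(t in `[0, +oo[) preimage_set_system setT (B t) measurable >>.

Definition independent_systems (I : finType) (G : I -> set_system Omega) :
    Prop :=
  forall (J : {set I}) (E : I -> set Omega),
    (forall i, i \in J -> G i (E i)) ->
    P (\bigcap_(i in [set` J]) E i) = (\prod_(i in J) P (E i))%E.

Definition fBm (d : nat) (H : R) (X : R -> Omega -> 'rV[R]_d) : Prop :=
  let coord (i : 'I_d) := fun t w => X t w ord0 i in
  (forall i, real_fBm H (coord i)) /\
  independent_systems (fun i => sigma_process (coord i)).

End fractional_Brownian_motion.

Section energy.
Context {R : realType}.

Local Notation mu := (@lebesgue_measure R).

Definition Gamma (a : R) : R :=
  \int[mu]_(t in `]0, +oo[) (t `^ (a - 1) * expR (- t)).

Section euclidean.
Variable d : nat.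

Definition dotv (x y : 'rV[R]_d) : R := \sum_(i < d) x ord0 i * y ord0 i.

(* |x|^2 is [dotv x x]: the library norm on ['rV[R]_d] is the sup norm.
   For [0 < alpha] the values lie in [0, +oo]; +oo is reached, if at all, only
   at [x = 0]. *)
Definition bessel_kernel (alpha : R) (x : 'rV[R]_d) : \bar R :=
  (((Gamma alpha * (4 * pi) `^ (d%:R / 2))^-1)%:E *
   \int[mu]_(t in `]0%R, +oo[)
     (t `^ (alpha - d%:R / 2) * expR (- (dotv x x / (4 * t)) - t) / t)%:E)%E.

Definition D0 (eps : R) (x : R -> 'rV[R]_d) (t : R) : 'rV[R]_d :=
  (2 * eps)^-1 *: (x (t + eps) - (if t < eps then 0 else x (t - eps))).

(* A double integral of a signed, \bar R-valued function.  If the kernel alone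
   is integrable on [0, T]^2 and [x] is continuous on [0, +oo[, the integrand is
   integrable, so neither the order of integration nor the convention
   [0 * +oo = 0] matters. *)
Definition Zfun (T alpha eps : R) (x : R -> 'rV[R]_d) : \bar R :=
  (\int[mu]_(t in `[0%R, T]) \int[mu]_(s in `[0%R, T])
     (bessel_kernel alpha (x t - x s)%R *
      (dotv (D0 eps x t) (D0 eps x s))%:E))%E.

End euclidean.

Definition alpha_crit (d : nat) (H : R) : R := d%:R / 2 - 1 + (2 * H)^-1.

End energy.

(* Main.v *)
From HB Require Import structures.
Require Import Defs.
From mathcomp Require Import all_boot all_order all_algebra.
From mathcomp Require Import all_classical all_reals all_analysis.
From mathcomp Require Import measurable_realfun lebesgue_integral_under.
From mathcomp Require Import ring lra.
Set Implicit Arguments.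
Unset Strict Implicit.
Unset Printing Implicit Defensive.
Import Order.TTheory GRing.Theory Num.Theory.
Import numFieldNormedType.Exports.
Local Open Scope classical_set_scope.
Local Open Scope ring_scope.

(** Write p = 2 H and let D be the symmetric difference quotient of X.

    The Bessel kernel is a mixture over u > 0 of the Gaussian kernels
    exp (- |x|^2 / (4 u)), with weights proportional to u^(alpha - d/2 - 1) exp (- u)
    ([bessel_kernelE]; the constant is positive by [Gamma_gt0]).  For fixed u and a
    fixed coordinate i, the double integral of exp (- |X_t - X_s|^2 / (4 u)) D^i_t D^i_s
    is nonnegative, since Gaussian kernels are positive semi-definite
    ([psd_gauss_weight]).  One may therefore keep a single coordinate, and only the
    scales u between u1 and 2 u1, with u1 = d (q eps)^p for a small constant q
    ([kernel_energy_ge], [expected_Zfun_ge]).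

    For such a scale, the Gaussian kernel of the chosen coordinate is again a mixture,
    over a standard Gaussian xi, of cosines cos (eta (X_t - X_s)) with
    eta = xi / sqrt (2 u) ([gaussian_mixture]).  Each cosine has a nonnegative energy, so
    xi may be restricted to a bounded interval ([cos_energy_ge0]).  The coordinates are
    independent and X is Gaussian, so for a single coordinate the expectation of
    cos (eta (X_t - X_s)) D_t D_s is explicit ([independent_mul], [cos_incr_slope]):

      (E [D_t D_s] - eta^2 E [(X_t - X_s) D_t] E [(X_t - X_s) D_s])
        * exp (- eta^2 |t - s|^p / 2).

    Within distance q eps of the diagonal it is at least a constant times eps^(p - 2);
    elsewhere its negative part is small with q and decays fast enough to be integrable
    across the diagonal ([cos_moment_ge], [cos_moment_le]).  Integrating over the square
    gives at least c eps^(p - 1) at each scale ([energy_integral_ge], [expected_energy_ge]).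

    The scales between u1 and 2 u1 have total weight of order u1^(alpha - d/2)
    ([kernel_mass_ge]).  Hence E Z is at least of order
    eps^(p (alpha - d/2) + p - 1), whose exponent is negative exactly when
    alpha < alpha_crit d H. *)

(** * Integrals against the standard Gaussian law *)

Section gaussian_integrals.
Context {R : realType}.
Local Notation mu := (@lebesgue_measure R).
Local Notation gam := (normal_prob (0 : R) 1).

Lemma ge0_integral_normal_prob (m s : R) (f : R -> \bar R) :
  measurable_fun setT f -> (forall x, 0 <= f x)%E ->
  (\int[normal_prob m s]_x f x = \int[mu]_x (f x * (normal_pdf m s x)%:E))%E.
Proof.
move=> mf f0.
have dom := @normal_prob_dominates R m s.
rewrite -(Radon_Nikodym_SigmaFinite.change_of_variables dom)//.
have intf := Radon_Nikodym_SigmaFinite.f_integrable dom.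
apply: ge0_ae_eq_integral => //.
- by apply: emeasurable_funM => //; exact: measurable_int intf.
- apply: emeasurable_funM => //; apply/measurable_EFinP.
  exact: measurable_normal_pdf.
- by move=> x _; rewrite mule_ge0//; exact: Radon_Nikodym_SigmaFinite.f_ge0.
- by move=> x _; rewrite mule_ge0// lee_fin normal_pdf_ge0.
apply: ae_eqe_mul2l; apply: integral_ae_eq => //.
- by apply/measurable_EFinP; exact: measurable_normal_pdf.
- by move=> E _ mE; rewrite -Radon_Nikodym_SigmaFinite.f_integral.
Qed.

Lemma integrable_le_EFin d (T : measurableType d) (nu : {measure set T -> \bar R})
    (D : set T) (f g : T -> R) : measurable D ->
  measurable_fun D f -> (forall x, D x -> `|f x| <= g x) ->
  nu.-integrable D (EFin \o g) -> nu.-integrable D (EFin \o f).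
Proof.
move=> mD mf fg; apply: le_integrable => //; first exact/measurable_EFinP.
move=> x Dx /=; rewrite lee_fin (le_trans (fg x Dx))// ler_norm//.
Qed.

Lemma integrable_bounded d (T : measurableType d)
    (nu : {finite_measure set T -> \bar R}) (f : T -> R) (C : R) :
  measurable_fun setT f -> (forall x, `|f x| <= C) ->
  nu.-integrable setT (EFin \o f).
Proof.
move=> mf fC; apply: (@integrable_le_EFin _ _ _ _ _ (cst C)) => //.
by apply: finite_measure_integrable_cst.
Qed.

Lemma EFin_Rintegral d (T : measurableType d) (nu : {measure set T -> \bar R})
    (D : set T) (f : T -> R) : measurable D -> nu.-integrable D (EFin \o f) ->
  (\int[nu]_(x in D) (f x)%:E)%E = (\int[nu]_(x in D) f x)%:E.
Proof. by move=> mD fi; rewrite fineK//; exact: integrable_fin_num. Qed.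

Let stdE (y : R) : normal_pdf 0 1 y = (Num.sqrt (pi *+ 2))^-1 * expR (- y ^+ 2 / 2).
Proof.
rewrite normal_pdfE ?oner_neq0// /normal_peak /normal_fun.
by rewrite subr0 expr1n mul1r.
Qed.

(** The dominating function is a multiple of the density of variance 2, since
    1 + y^2 <= 4 exp (y^2 / 4). *)
Lemma integrable_gauss_poly (f : R -> R) (C : R) : measurable_fun setT f ->
  (forall y, `|f y| <= C * (1 + y ^+ 2)) ->
  mu.-integrable setT (fun y => (f y * expR (- y ^+ 2 / 2))%:E).
Proof.
move=> mf fC.
have s20 : Num.sqrt 2 != 0 :> R by rewrite gt_eqF// sqrtr_gt0.
have C0 : 0 <= C by have := fC 0; rewrite expr0n/= addr0 mulr1; exact: le_trans.
apply: (@integrable_le_EFin _ _ mu setT (fun y => f y * expR (- y ^+ 2 / 2))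
  (fun y => (C * 4 * (normal_peak (Num.sqrt 2))^-1) * normal_pdf 0 (Num.sqrt 2) y)) => //.
- apply: measurable_funM => //; apply: measurableT_comp => //.
  by apply: measurable_funM => //; apply: measurableT_comp => //; exact: measurable_funX.
- move=> y _; rewrite normrM (ger0_norm (expR_ge0 _)) normal_pdfE//.
  rewrite -mulrA mulKf ?gt_eqF ?normal_peak_gt0// /normal_fun subr0 sqr_sqrtr//.
  have -> : - y ^+ 2 / 2 = - y ^+ 2 / (2 *+ 2) - y ^+ 2 / 4 by field.
  rewrite expRD mulrCA [leRHS]mulrC ler_pM2l ?expR_gt0//.
  rewrite (le_trans (ler_wpM2r (expR_ge0 _) (fC y)))// -mulrA ler_wpM2l//.
  rewrite expRN ler_pdivrMr ?expR_gt0//.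
  have := expR_ge1Dx (y ^+ 2 / 4); have := sqr_ge0 y; lra.
- rewrite /comp; under eq_fun do rewrite EFinM.
  by apply: integrableZl => //; exact: integrable_normal_pdf.
Qed.

(** Fundamental theorem of calculus on [-n, n], letting n grow. *)
Lemma integral_derivative_vanish (f F : R -> R) : continuous f ->
  (forall x, is_derive x (1 : R) F (f x)) ->
  mu.-integrable setT (EFin \o f) ->
  (F n%:R @[n --> \oo] --> 0) -> (F (- n%:R) @[n --> \oo] --> 0) ->
  (\int[mu]_x (f x)%:E = 0)%E.
Proof.
move=> cf dF fi F1 F2.
pose f_ n := (fun x => (f x)%:E) \_ (`[- n%:R, n%:R] : set R).
have mf : measurable_fun setT (EFin \o f) := measurable_int _ fi.
have /(@dominated_cvg _ _ _ mu _ measurableT) : forall n, measurable_fun setT (f_ n).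
  move=> n; apply/(measurable_restrictT _ _).1 => //.
  exact: measurable_funTS.
move=> /(_ (EFin \o f) (fun x => `|(f x)%:E|%E)).
have cvgf x : f_ n x @[n --> \oo] --> (EFin \o f) x.
  apply: cvg_near_cst; near=> n.
  rewrite /f_ patchE mem_set//= in_itv/= -ler_norml.
  by near: n; exact: nbhs_infty_ger.
move=> /(_ (fun x _ => cvgf x)) /=.
move=> /(_ (fun _ _ => erefl)) /(_ (integrable_abse fi)).
have dom n x : setT x -> (`|f_ n x| <= `|(f x)%:E|)%E.
  by move=> _; rewrite /f_ patchE; case: ifPn => // _; rewrite abse0.
move=> /(_ dom) L.
have E n : (0 < n)%N -> (\int[mu]_x f_ n x)%E = (F n%:R - F (- n%:R))%:E.
  move=> n0; rewrite /f_ -integral_mkcond (@continuous_FTC2 _ _ F)//.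
  - by rewrite ltrNl (@lt_trans _ _ 0)// ?ltr0n// oppr_lt0 ltr0n.
  - exact: continuous_subspaceT.
  - have cF : continuous F.
      by move=> x; apply/differentiable_continuous/derivable1_diffP; have [] := dF x.
    split.
    + by move=> x _; have [] := dF x.
    + by apply: cvg_at_right_filter; exact: cF.
    + by apply: cvg_at_left_filter; exact: cF.
  - by move=> x _; rewrite derive1E; have [_ ->] := dF x.
have L0 : (F n%:R - F (- n%:R))%:E @[n --> \oo] --> (0 - 0 : R)%:E.
  by apply/cvg_EFin; [exact: nearW|apply: cvgB].
rewrite subr0 in L0.
apply: (cvg_unique (@ereal_hausdorff R) L).
apply: cvg_trans L0; apply: near_eq_cvg; exists 1%N => // n /= n0.
by rewrite E.
Unshelve. all: end_near. Qed.

(** Integrals against the Gaussian law, reduced to Lebesgue measure, for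
    functions of at most quadratic growth *)
Lemma integral_normal_pdfE (f : R -> R) (C : R) : measurable_fun setT f ->
  (forall y, `|f y| <= C * (1 + y ^+ 2)) ->
  gam.-integrable setT (EFin \o f) /\
  (\int[gam]_y (f y)%:E = (Num.sqrt (pi *+ 2))^-1%:E *
    \int[mu]_y (f y * expR (- y ^+ 2 / 2))%:E)%E.
Proof.
move=> mf fC.
have imu : mu.-integrable setT (fun y => (f y * normal_pdf 0 1 y)%:E).
  under eq_fun do rewrite stdE mulrCA EFinM.
  by apply: integrableZl => //; exact: (integrable_gauss_poly mf fC).
have igam : gam.-integrable setT (EFin \o f).
  apply/integrableP; split; first exact/measurable_EFinP.
  rewrite ge0_integral_normal_prob//; last first.
    by apply: measurableT_comp => //; exact/measurable_EFinP.
  case/integrableP : imu => _; congr (_ < _)%E; apply: eq_integral => y _ /=.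
  by rewrite normrM EFinM (ger0_norm (normal_pdf_ge0 _ _ _)).
split => //.
transitivity (\int[mu]_y (f y * normal_pdf 0 1 y)%:E)%E; last first.
  rewrite -integralZl//; last exact: (integrable_gauss_poly mf fC).
  by apply: eq_integral => y _; rewrite stdE mulrCA EFinM.
rewrite integralE [RHS]integralE; congr (_ - _)%E.
  rewrite ge0_integral_normal_prob//; last first.
    by apply: measurable_funepos; exact/measurable_EFinP.
  apply: eq_integral => y _; rewrite !funeposE EFinM maxe_pMl ?mul0e//.
  by rewrite lee_fin normal_pdf_ge0.
rewrite ge0_integral_normal_prob//; last first.
  by apply: measurable_funeneg; exact/measurable_EFinP.
apply: eq_integral => y _; rewrite !funenegE EFinM -mulNe maxe_pMl ?mul0e//.
by rewrite lee_fin normal_pdf_ge0.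
Qed.

(** Gaussian integration by parts: p' - y p is, up to the Gaussian factor, the
    derivative of p exp (- y^2 / 2). *)
Lemma stein_identity (p p' : R -> R) (C : R) :
  (forall y, is_derive y (1 : R) p (p' y)) -> continuous p' ->
  (forall y, `|p y| <= C * (1 + `|y|)) -> (forall y, `|p' y| <= C) ->
  (\int[gam]_y (p' y - y * p y)%:E = 0)%E.
Proof.
move=> dp cp' pC p'C.
have C0 : 0 <= C by rewrite (le_trans _ (p'C 0)).
have cp : continuous p.
  by move=> x; apply/differentiable_continuous/derivable1_diffP; have [] := dp x.
have bnd (y : R) : `|y| * (1 + `|y|) <= 2 * (1 + y ^+ 2).
  by rewrite -(real_normK (num_real y)); have := normr_ge0 y; set z := `|y| => z0; nra.
have cf : continuous (fun y => p' y - y * p y).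
  by move=> y; apply: cvgB; [exact: cp'|apply: cvgM; [exact: cvg_id|exact: cp]].
have fC y : `|p' y - y * p y| <= (3 * C) * (1 + y ^+ 2).
  rewrite (le_trans (ler_normB _ _))// normrM.
  have h1 := p'C y; have h2 := ler_wpM2l (normr_ge0 y) (pC y).
  have h3 := ler_wpM2l C0 (bnd y); have h4 := mulr_ge0 C0 (sqr_ge0 y).
  lra.
have mf : measurable_fun setT (fun y => p' y - y * p y).
  exact: continuous_measurable_fun.
have [_ ->] := integral_normal_pdfE mf fC.
pose F y := p y * expR (- y ^+ 2 / 2).
have Fb (n : nat) (y : R) : `|y| = n%:R -> `|F y| <= (4 * C) * n.+1%:R^-1.
  move=> yn; rewrite /F normrM (ger0_norm (expR_ge0 _)) mulNr expRN.
  rewrite ler_pdivrMr ?expR_gt0// mulrAC ler_pdivlMr ?ltr0Sn//.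
  rewrite -(real_normK (num_real y)) yn.
  have := pC y; rewrite yn => h.
  have n0 : 0 <= n%:R :> R by [].
  have e1 := expR_ge1Dx (n%:R ^+ 2 / 2 : R).
  have := ler_wpM2l C0 e1; move: h n0; rewrite -(natr1 n).
  set N : R := n%:R; set E := expR _; set q := `|p y| => h N0 h3.
  have N1 : 0 <= N + 1 by lra.
  have := ler_wpM2r N1 h; have := mulr_ge0 C0 (sqr_ge0 (N - 1)).
  nra.
have F0 (u : nat -> R) : (forall n, `|u n| = n%:R) -> F (u n) @[n --> \oo] --> 0.
  move=> un; apply: norm_cvg0.
  apply: (@squeeze_cvgr _ _ _ _ (cst 0) (fun n => (4 * C) * n.+1%:R^-1)).
  - by apply: nearW => n /=; rewrite normr_ge0/=; exact: Fb.
  - exact: cvg_cst.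
  - rewrite -[X in _ --> X](mulr0 (4 * C)); apply: cvgM; first exact: cvg_cst.
    exact: cvg_harmonic.
have fi := integrable_gauss_poly mf fC.
rewrite [X in (_ * X)%E](_ : _ = 0%E) ?mule0//.
apply: (@integral_derivative_vanish (fun y => (p' y - y * p y) * expR (- y ^+ 2 / 2)) F) => //.
- move=> y; apply: cvgM; first exact: cf.
  apply: continuous_comp; last exact: continuous_expR.
  by apply: cvgMr_tmp; apply: cvgN; exact: exprn_continuous.
- move=> y; have ? := dp y; apply: is_derive_eq.
  by rewrite /GRing.scale/=; field.
- by apply: F0 => n; rewrite ger0_norm.
- by apply: F0 => n; rewrite normrN ger0_norm.
Qed.

Lemma integral_prob_cst d (T : measurableType d) (P : probability T R) (r : R) :
  (\int[P]_x r%:E = r%:E)%E.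
Proof.
by rewrite -/(\int[P]_x (cst r%:E) x)%E integral_cst//= probability_setT mule1.
Qed.

Lemma integral_gauss_id : (\int[gam]_y y%:E = 0)%E.
Proof.
have := @stein_identity (cst (-1)) (cst 0) 1.
under eq_integral do rewrite /= mulrN1 opprK add0r.
apply.
- by move=> y; exact: cvg_cst.
- by move=> y; rewrite /= normrN1 mul1r lerDl.
- by move=> y; rewrite /= normr0.
Qed.

Lemma integral_gauss_sqr : (\int[gam]_y (y ^+ 2)%:E = 1)%E.
Proof.
have b (y : R) : `|y ^+ 2| <= 1 * (1 + y ^+ 2).
  by rewrite mul1r ger0_norm ?sqr_ge0// lerDr.
have [i _] := @integral_normal_pdfE (fun y => y ^+ 2) 1
  (@measurable_funX _ _ _ _ _ 2 (@measurable_id _ _ _)) b.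
have : (\int[gam]_y (1 - y * y)%:E = 0)%E.
  apply: (@stein_identity id (cst 1) 1) => //.
  - by move=> y; exact: cvg_cst.
  - by move=> y; rewrite mul1r /= lerDr.
  - by move=> y; rewrite /= normr1.
under eq_integral do rewrite -expr2 EFinB.
rewrite integralB//; last exact: finite_measure_integrable_cst.
rewrite integral_prob_cst => /eqP.
have fn := integrable_fin_num measurableT i.
by rewrite sube_eq ?fin_num_adde_defl// ?add0e ?adde0 => /eqP <-.
Qed.

(** The characteristic function F solves F' = - z F, by differentiation under the
    integral and Stein's identity. *)
Lemma char_normal_prob (x : R) : \int[gam]_y cos (x * y) = expR (- x ^+ 2 / 2).
Proof.
pose f (x y : R) := cos (x * y).
have mc (g : R -> R) (z : R) : continuous g -> measurable_fun setT (fun y => g (z * y)).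
  move=> cg; apply: continuous_measurable_fun => y.
  by apply: continuous_comp; [exact: cvgMl_tmp|exact: cg].
have If z : gam.-integrable setT (EFin \o f z).
  apply: (@integrable_bounded _ _ gam _ 1); first exact: mc (@continuous_cos R).
  by move=> y; rewrite ler_norml cos_geN1 cos_le1.
have df z y : is_derive z (1 : R) (f ^~ y) (- (y * sin (z * y))).
  apply: is_derive_eq; rewrite /GRing.scale/=; ring.
have d1f z y : partial1of2 f z y = - (y * sin (z * y)).
  by rewrite partial1of2E; have [_ ->] := df z y.
have nI : gam.-integrable setT (EFin \o (@Num.norm R R)).
  apply: (@integral_normal_pdfE _ 1 _ _).1; first exact: normr_measurable.
  move=> y; rewrite normr_id mul1r -(real_normK (num_real y)).
  by have := sqr_ge0 (`|y| - 1); nra.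
have dom z y : `|partial1of2 f z y| <= `|y|.
  rewrite d1f normrN normrM ler_piMr// ler_norml sin_geN1 sin_le1//.
pose F z := \int[gam]_y f z y.
have dF z : is_derive z (1 : R) F (- z * F z).
  have zI : `](z - 1), (z + 1)[%classic z by rewrite /= in_itv/= ltrBlDr !ltrDl ltr01.
  have der : derivable F z 1.
    apply: (@derivable_under_integral _ _ _ gam f setT measurableT z (z - 1) (z + 1) zI _ _ (@Num.norm R R)) => //.
  have := @differentiation_under_integral _ _ _ gam f setT measurableT z (z - 1) (z + 1) zI
     (fun x _ => If x) (fun z' y _ _ => @ex_derive _ _ _ _ _ _ _ (df z' y)) (@Num.norm R R) (@normr_ge0 R R) nI
     (fun x y _ _ => dom x y).
  rewrite -/F => E; apply: DeriveDef => //; rewrite -derive1E E.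
  under eq_Rintegral do rewrite d1f.
  have ms : measurable_fun setT (fun y : R => y * sin (z * y)).
    by apply: measurable_funM => //; exact: mc (@continuous_sin R).
  have Is : gam.-integrable setT (EFin \o (fun y : R => y * sin (z * y))).
    apply: (@integral_normal_pdfE _ 1 ms _).1 => y.
    rewrite -[leLHS]normrN -d1f (le_trans (dom z y))// mul1r.
    by rewrite -(real_normK (num_real y)); have := sqr_ge0 (`|y| - 1); nra.
  have : (\int[gam]_y (z * cos (z * y) - y * sin (z * y))%:E = 0)%E.
    apply: (@stein_identity (fun y => sin (z * y)) (fun y => z * cos (z * y)) (1 + `|z|)).
    - move=> y; apply: is_derive_eq; rewrite /GRing.scale/=; ring.
    - move=> y; apply: cvgMl_tmp; apply: continuous_comp; first exact: cvgMl_tmp.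
      exact: continuous_cos.
    - move=> y; rewrite (@le_trans _ _ 1)//; first by rewrite ler_norml sin_geN1 sin_le1.
      by rewrite -[leLHS]mulr1 ler_pM// lerDl.
    - move=> y; rewrite normrM (@le_trans _ _ `|z|) ?lerDr//.
      by rewrite ler_piMr// ler_norml cos_geN1 cos_le1.
  have Iz : gam.-integrable setT (EFin \o (fun y => z * cos (z * y))).
    by rewrite /comp; under eq_fun do rewrite EFinM; apply: integrableZl => //; exact: If.
  rewrite EFin_Rintegral//; last first.
    by rewrite /comp; under eq_fun do rewrite EFinB; apply: integrableB.
  rewrite RintegralB// RintegralZl//; last exact: If.
  move=> [] /eqP; rewrite subr_eq0 => /eqP h.
  rewrite mulNr /F h; under eq_Rintegral do rewrite -mulN1r.
  by rewrite RintegralZl// mulN1r.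
pose G z := F z * expR (z ^+ 2 / 2).
have dG z : is_derive z (1 : R) G 0.
  have ? := dF z; apply: is_derive_eq; by rewrite /GRing.scale/=; field.
have := is_derive_0_is_cst x 0 dG.
rewrite /G expr0n/= mul0r expR0 mulr1 => h.
apply: (mulIf (x := expR (x ^+ 2 / 2))); first by rewrite gt_eqF ?expR_gt0.
rewrite -expRD mulNr addNr expR0.
rewrite [LHS]h /F /f; under eq_Rintegral do rewrite mul0r cos0.
by rewrite /Rintegral integral_prob_cst.
Qed.

End gaussian_integrals.

Section gaussian_laws.
Context {R : realType}.
Local Notation mu := (@lebesgue_measure R).
Local Notation gam := (normal_prob (0 : R) 1).

Lemma integral_normal_prob_affine (m s : R) (g : R -> R) : 0 < s ->
  continuous g -> (forall y, 0 <= g y) ->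
  (\int[normal_prob m s]_y (g y)%:E = \int[gam]_y (g (m + s * y))%:E)%E.
Proof.
move=> s0 cg g0.
have s1 : s != 0 by rewrite gt_eqF.
have mg : measurable_fun setT g by exact: continuous_measurable_fun.
pose F (y : R) := m + s * y.
have cF : continuous F.
  by move=> y; apply: cvgD; [exact: cvg_cst|exact: cvgMl_tmp].
have dF : F^`()%classic = cst s.
  apply/funext => y; rewrite derive1E /F deriveD// derive_cst add0r deriveM//.
  by rewrite derive_cst derive_id /GRing.scale/= mulr1 mulr0 addr0.
rewrite ge0_integral_normal_prob//; last exact/measurable_EFinP.
have mgF : measurable_fun setT (fun y => (g (m + s * y))%:E).
  apply/measurable_EFinP; apply: (@measurableT_comp _ _ _ _ _ _ g) => //.
  exact: continuous_measurable_fun cF.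
rewrite [RHS](ge0_integral_normal_prob _ _ mgF)//; last by move=> y; rewrite lee_fin.
transitivity (\int[mu]_y (g y * normal_pdf m s y)%:E)%E.
  by apply: eq_integral => y _; rewrite EFinM.
rewrite (@increasing_ge0_integration_by_substitutionT _ F (fun y => g y * normal_pdf m s y)).
- apply: eq_integral => y _; rewrite dF -EFinM; congr EFin.
  rewrite -[LHS]/(g (F y) * normal_pdf m s (F y) * s) -mulrA; congr (_ * _).
  rewrite !normal_pdfE ?oner_neq0// /normal_peak /normal_fun /F.
  have -> : m + s * y - m = s * y by ring.
  rewrite subr0 mulrAC exprMn expr1n mul1r.
  have -> : - (s ^+ 2 * y ^+ 2) / (s ^+ 2 *+ 2) = - y ^+ 2 / 2 by field.
  congr (_ * _); rewrite -mulrnAr sqrtrM ?sqr_ge0// sqrtr_sqr gtr0_norm//.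
  by rewrite invfM mulrAC mulVf// mul1r.
- by move=> x y xy; rewrite /F ltrD2l ltr_pM2l.
- by rewrite dF => x; exact: cvg_cst.
- by rewrite dF; exact: is_cvg_cst.
- by rewrite dF; exact: is_cvg_cst.
- by move=> x; rewrite /F.
- apply/cvgrNyPle => A; exists ((A - m) / s); split; first exact: num_real.
  by move=> x /ltW; rewrite ler_pdivlMr// mulrC lerBrDl.
- apply/cvgryPge => A; exists ((A - m) / s); split; first exact: num_real.
  by move=> x /ltW; rewrite ler_pdivrMr// mulrC lerBlDl.
- by move=> y; apply: cvgM; [exact: cg|exact: continuous_normal_pdf].
- by move=> y; rewrite mulr_ge0// normal_pdf_ge0.
Qed.

Context d (T : measurableType d) (P : probability T R).

(** A Gaussian variable has the law of m + s N with N standard, the degenerate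
    case s = 0 included. *)
Lemma gaussian_rv_affine (Y : T -> R) : measurable_fun setT Y -> gaussian_rv P Y ->
  exists m s : R, forall g : R -> R, continuous g -> (forall y, 0 <= g y) ->
  (\int[P]_w (g (Y w))%:E = \int[gam]_y (g (m + s * y))%:E)%E.
Proof.
move=> mY [m [s [s0 law]]]; exists m, s => g cg g0.
have mg : measurable_fun setT g by exact: continuous_measurable_fun.
have mgE : measurable_fun setT (EFin \o g) by exact/measurable_EFinP.
move: law; rewrite /gaussian_law; have [->|sn0] := eqVneq s 0 => law.
  transitivity (\int[pushforward P Y]_y (g y)%:E)%E.
    by rewrite ge0_integral_pushforward// => y _; rewrite lee_fin.
  transitivity (\int[\d_m]_y (g y)%:E)%E.
    by apply: eq_measure_integral => A mA _; exact: law.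
  rewrite integral_dirac//= diracT mul1e.
  by under eq_integral do rewrite mul0r addr0; rewrite integral_prob_cst.
rewrite -integral_normal_prob_affine//; last by rewrite lt_neqAle eq_sym sn0.
pose Y' : T -> measurableTypeR R := Y.
have mY' : measurable_fun setT Y' := mY.
have mg' : measurable_fun setT (fun y : measurableTypeR R => (g y)%:E) := mgE.
transitivity (\int[pushforward P Y']_y (g y)%:E)%E.
  by rewrite ge0_integral_pushforward// => y _; rewrite lee_fin.
have K := @eq_measure_integral _ (measurableTypeR R) R setT (normal_prob m s) (pushforward P Y') (fun y => (g y)%:E).
by apply: (K mY') => A mA _; exact: law.
Qed.

Lemma gaussian_rv_cos (Y : T -> R) : measurable_fun setT Y -> gaussian_rv P Y ->
  P.-integrable setT (fun w => (Y w ^+ 2)%:E) -> (\int[P]_w (Y w)%:E = 0)%E ->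
  \int[P]_w cos (Y w) = expR (- (\int[P]_w (Y w ^+ 2)) / 2).
Proof.
move=> mY gY Y2 Y0; have [m [s E]] := gaussian_rv_affine mY gY.
have afb (y : R) : `|m + s * y| <= (`|m| + `|s|) * (1 + y ^+ 2).
  rewrite (le_trans (ler_normD _ _))// normrM -(real_normK (num_real y)).
  have := normr_ge0 m; have := normr_ge0 s; have := sqr_ge0 (`|y| - 1).
  set a := `|m|; set b := `|s|; set z := `|y| => h b0 a0.
  have := mulr_ge0 b0 h; have := mulr_ge0 a0 (sqr_ge0 z).
  have := mulr_ge0 b0 (sqr_ge0 (z + 1)); nra.
have maf : measurable_fun setT (fun y : R => m + s * y).
  by apply: measurable_funD => //; apply: measurable_funM.
have [Iaf _] := integral_normal_pdfE maf afb.
have b1 (y : R) : `|id y| <= 1 * (1 + y ^+ 2).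
  by rewrite mul1r -(real_normK (num_real y)); have := sqr_ge0 (`|y| - 1); nra.
have [I1 _] := @integral_normal_pdfE R id 1 (@measurable_id _ _ _) b1.
have b2 (y : R) : `|y ^+ 2| <= 1 * (1 + y ^+ 2).
  by rewrite mul1r ger0_norm ?sqr_ge0// lerDr.
have [I2 _] := @integral_normal_pdfE R (fun y => y ^+ 2) 1
  (@measurable_funX _ _ _ _ _ 2 (@measurable_id _ _ _)) b2.
have Ic (r : R) : gam.-integrable setT (fun=> r%:E) by exact: finite_measure_integrable_cst.
have m0 : m = 0.
  have EY : (\int[P]_w (Y w)%:E = \int[gam]_y (m + s * y)%:E)%E.
    rewrite integralE [RHS]integralE; congr (_ - _)%E.
      transitivity (\int[P]_w (Num.max (Y w) 0)%:E)%E.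
        by apply: eq_integral => w _; rewrite funeposE EFin_max.
      rewrite (E (fun y => Num.max y 0))//; last 2 first.
      - by move=> y; apply: continuous_max => //; exact: cvg_cst.
      - by move=> y; rewrite le_max lexx orbT.
      by apply: eq_integral => w _; rewrite funeposE EFin_max.
    transitivity (\int[P]_w (Num.max (- Y w) 0)%:E)%E.
      by apply: eq_integral => w _; rewrite funenegE EFin_max.
    rewrite (E (fun y => Num.max (- y) 0))//; last 2 first.
    - move=> y; apply: continuous_max => //; last exact: cvg_cst.
      exact: opp_continuous.
    - by move=> y; rewrite le_max lexx orbT.
    by apply: eq_integral => w _; rewrite funenegE EFin_max.
  move: EY; rewrite Y0; under eq_integral do rewrite EFinD EFinM.
  rewrite integralD//; last exact: integrableZl.
  rewrite integral_prob_cst integralZl// integral_gauss_id mule0 adde0.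
  by move=> [->].
have s2 : \int[P]_w (Y w ^+ 2) = s ^+ 2.
  rewrite /Rintegral (E (fun y => y ^+ 2)); [|exact: exprn_continuous|by move=> ?; exact: sqr_ge0].
  rewrite [X in fine X](_ : _ = (s ^+ 2)%:E)//.
  transitivity (\int[gam]_y ((s ^+ 2)%:E * (y ^+ 2)%:E))%E.
    by apply: eq_integral => y _; rewrite m0 add0r exprMn EFinM.
  by rewrite integralZl// integral_gauss_sqr mule1.
have := E (fun y => 1 + cos y).
rewrite s2 => H.
have bc (z : R) : `|cos z| <= 1 by rewrite ler_norml cos_geN1 cos_le1.
have IcY : P.-integrable setT (EFin \o (fun w => cos (Y w))).
  apply: (@integrable_bounded _ _ _ P _ 1) => //.
  by apply: measurableT_comp => //; exact: continuous_measurable_fun (@continuous_cos R).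
have Icz : gam.-integrable setT (EFin \o (fun z => cos (s * z))).
  apply: (@integrable_bounded _ _ _ gam _ 1) => //.
  apply: (@measurableT_comp _ _ _ _ _ _ cos).
    by exact: continuous_measurable_fun (@continuous_cos R).
  exact: measurable_funM.
have {H} : (\int[P]_w (1 + cos (Y w))%:E = \int[gam]_y (1 + cos (s * y))%:E)%E.
  rewrite H.
  - by apply: eq_integral => y _; rewrite m0 add0r.
  - by move=> y; apply: cvgD; [exact: cvg_cst|exact: continuous_cos].
  - by move=> y; have := cos_geN1 y; lra.
under eq_integral do rewrite EFinD.
under [RHS]eq_integral do rewrite EFinD.
rewrite integralD//; last exact: finite_measure_integrable_cst.
rewrite integralD// !integral_prob_cst EFin_Rintegral// EFin_Rintegral//.
by rewrite -!EFinD char_normal_prob => -[] /addrI.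
Qed.

End gaussian_laws.

(** * Moments of Gaussian families weighted by a cosine *)

Section gaussian_calculus.
Context {R : realType}.

Lemma norm_sin_le (x : R) : `|sin x| <= `|x|.
Proof.
wlog x0 : x / 0 < x => [H|].
  have [x0|x0|->] := ltgtP x 0; [|exact: H|by rewrite sin0].
  by rewrite -normrN -sinN -[leRHS]normrN; apply: H; rewrite oppr_gt0.
have [c _] := @MVT R sin cos 0 x x0 (fun z _ => is_derive_sin z)
  (continuous_subspaceT (@continuous_sin R)).
rewrite sin0 !subr0 => ->; rewrite normrM ler_piMl//.
by rewrite ler_norml cos_geN1 cos_le1.
Qed.

Lemma cvg_slope (g : R -> R) (l : R) (u : nat -> R) :
  is_derive (0 : R) (1 : R) g l -> g 0 = 0 -> (forall n, u n != 0) ->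
  u n @[n --> \oo] --> 0 -> g (u n) / u n @[n --> \oo] --> l.
Proof.
move=> [dg gl] g0 un0 u0.
have : h^-1 *: (g (h + 0) - g 0) @[h --> 0^'] --> l.
  by move/cvg_ex : dg => [l' /=]; rewrite -gl /derive; under eq_fun do rewrite /GRing.scale/= mulr1;
    move=> H; rewrite (cvg_lim _ H).
move/cvgr_dnbhsP => /(_ u (conj un0 u0)).
by under eq_fun do rewrite addr0 g0 subr0 /GRing.scale/= mulrC.
Qed.

Lemma cvg_invS : (n.+1%:R^-1 : R) @[n --> \oo] --> (0 : R).
Proof. exact: cvg_harmonic. Qed.

(** (2 f 0 - f b - f (- b)) / b^2 for f b = exp (- (2 b c + b^2 s) / 2), as b tends to 0 *)
Lemma cvg_second_difference (s c : R) :
  (2 - (expR (- (2 * n.+1%:R^-1 * c + n.+1%:R^-1 ^+ 2 * s) / 2)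
        + expR (- (- (2 * n.+1%:R^-1 * c) + n.+1%:R^-1 ^+ 2 * s) / 2)))
     / n.+1%:R^-1 ^+ 2 @[n --> \oo] --> s - c ^+ 2.
Proof.
pose a n : R := n.+1%:R^-1.
have a0 n : a n != 0 by rewrite invr_eq0.
have ca : a n @[n --> \oo] --> 0 := cvg_invS.
have ca2 : a n ^+ 2 @[n --> \oo] --> 0.
  by rewrite -[X in _ --> X](mulr0 0); apply: cvgM.
have D1 : (1 - expR (- s / 2 * a n ^+ 2)) / a n ^+ 2 @[n --> \oo] --> s / 2.
  apply: (@cvg_slope (fun x => 1 - expR (- s / 2 * x))) => //.
  - by apply: is_derive_eq; rewrite mulr0 expR0 /GRing.scale/=; ring.
  - by rewrite mulr0 expR0 subrr.
  - by move=> n; rewrite expf_neq0.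
have D2 : (expR (c / 2 * a n) - expR (- c / 2 * a n)) / a n @[n --> \oo] --> c.
  apply: (@cvg_slope (fun x => expR (c / 2 * x) - expR (- c / 2 * x))) => //.
  - by apply: is_derive_eq; rewrite !mulr0 expR0 /GRing.scale/=; field.
  - by rewrite !mulr0 subrr.
have E0 : expR (- s / 2 * a n ^+ 2) @[n --> \oo] --> (1 : R).
  rewrite [X in _ --> X](_ : 1 = expR (- s / 2 * 0)); last by rewrite mulr0 expR0.
  by apply: continuous_cvg; [exact: continuous_expR|apply: cvgM => //; exact: cvg_cst].
have -> : s - c ^+ 2 = 2 * (s / 2) - 1 * (c * c) by field.
under eq_fun => n do rewrite -/(a n).
have E n : (2 - (expR (- (2 * a n * c + a n ^+ 2 * s) / 2) +
    expR (- (- (2 * a n * c) + a n ^+ 2 * s) / 2))) / a n ^+ 2 =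
  2 * ((1 - expR (- s / 2 * a n ^+ 2)) / a n ^+ 2) - expR (- s / 2 * a n ^+ 2)
   * ((expR (c / 2 * a n) - expR (- c / 2 * a n)) / a n
     * ((expR (c / 2 * a n) - expR (- c / 2 * a n)) / a n)).
  have -> : - (2 * a n * c + a n ^+ 2 * s) / 2 = - s / 2 * a n ^+ 2 + (- c / 2 * a n) + (- c / 2 * a n) by field.
  have -> : - (- (2 * a n * c) + a n ^+ 2 * s) / 2 = - s / 2 * a n ^+ 2 + (c / 2 * a n) + (c / 2 * a n) by field.
  have H : expR (c / 2 * a n) * expR (- c / 2 * a n) = 1.
    by rewrite -expRD !mulNr addrN expR0.
  rewrite !expRD; move: H; have := a0 n.
  set p := expR (c / 2 * a n); set q := expR (- c / 2 * a n); set e := expR _ => an0 H.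
  have -> : (p - q) / a n * ((p - q) / a n) = (p * p + q * q - 2 * (p * q)) / a n ^+ 2.
    by field.
  by rewrite H; field.
under eq_fun do rewrite E.
apply: cvgB; apply: cvgM => //; first exact: cvg_cst.
exact: cvgM.
Qed.

Context d (T : measurableType d) (P : probability T R).

(** Square-integrable centred random variables *)
Definition centered_L2 (Y : T -> R) : Prop :=
  [/\ measurable_fun setT Y, P.-integrable setT (fun w => (Y w ^+ 2)%:E) &
      (\int[P]_w (Y w)%:E = 0)%E].

Lemma integrable_mul_L2 (Y Z : T -> R) :
  measurable_fun setT Y -> P.-integrable setT (fun w => (Y w ^+ 2)%:E) ->
  measurable_fun setT Z -> P.-integrable setT (fun w => (Z w ^+ 2)%:E) ->
  P.-integrable setT (fun w => (Y w * Z w)%:E).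
Proof.
move=> mY Y2 mZ Z2.
apply: (@integrable_le_EFin _ _ _ P _ (fun w => Y w * Z w) (fun w => Y w ^+ 2 + Z w ^+ 2)) => //.
- exact: measurable_funM.
- move=> w _; rewrite normrM -(real_normK (num_real (Y w))) -(real_normK (num_real (Z w))).
  have := sqr_ge0 (`|Y w| - `|Z w|); have := sqr_ge0 (`|Y w|); have := sqr_ge0 (`|Z w|); nra.
- by rewrite /comp; under eq_fun do rewrite EFinD; exact: integrableD.
Qed.

Lemma centered_L2_integrable Y : centered_L2 Y -> P.-integrable setT (EFin \o Y).
Proof.
case=> mY Y2 _.
have := @integrable_mul_L2 Y (cst 1) mY Y2 (measurable_cst _) _.
rewrite (_ : (fun w => (Y w * cst 1 w)%:E) = EFin \o Y); last by apply/funext => w /=; rewrite mulr1.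
by apply; rewrite /= expr1n; exact: finite_measure_integrable_cst.
Qed.

Lemma centered_L2_mul Y Z : centered_L2 Y -> centered_L2 Z ->
  P.-integrable setT (EFin \o (fun w => Y w * Z w)).
Proof. by case=> ? ? _ [? ? _]; exact: integrable_mul_L2. Qed.

Lemma centered_L2_lin (a b : R) Y Z : centered_L2 Y -> centered_L2 Z ->
  centered_L2 (fun w => a * Y w + b * Z w).
Proof.
move=> cY cZ; have [mY Y2 Y0] := cY; have [mZ Z2 Z0] := cZ; split.
- by apply: measurable_funD; apply: measurable_funM.
- have -> : (fun w => ((a * Y w + b * Z w) ^+ 2)%:E) =
     (fun w => (a ^+ 2)%:E * (Y w ^+ 2)%:E + (2 * a * b)%:E * (Y w * Z w)%:E
        + (b ^+ 2)%:E * (Z w ^+ 2)%:E)%E.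
    by apply/funext => w; rewrite -!EFinM -!EFinD; congr EFin; ring.
  apply: integrableD => //; last exact: integrableZl.
  apply: integrableD => //; first exact: integrableZl.
  by apply: integrableZl => //; exact: centered_L2_mul.
- have iY := centered_L2_integrable cY; have iZ := centered_L2_integrable cZ.
  under eq_integral do rewrite EFinD !EFinM.
  rewrite integralD//; [|exact: integrableZl..].
  by rewrite !integralZl// Y0 Z0 !mule0 adde0.
Qed.

Lemma integrable_lin (a b : R) (f g : T -> R) : P.-integrable setT (EFin \o f) ->
  P.-integrable setT (EFin \o g) ->
  P.-integrable setT (EFin \o (fun w => a * f w + b * g w)).
Proof.
move=> If Ig; rewrite /comp; under eq_fun do rewrite EFinD !EFinM.
by apply: integrableD => //; exact: integrableZl.
Qed.

Lemma Rintegral_lin (a b : R) (f g : T -> R) : P.-integrable setT (EFin \o f) ->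
  P.-integrable setT (EFin \o g) ->
  \int[P]_w (a * f w + b * g w) = a * \int[P]_w f w + b * \int[P]_w g w.
Proof.
move=> If Ig; rewrite RintegralD ?RintegralZl//.
- by rewrite /comp; under eq_fun do rewrite EFinM; exact: integrableZl.
- by rewrite /comp; under eq_fun do rewrite EFinM; exact: integrableZl.
Qed.

Lemma Rintegral_sqr_lin (a b : R) Y Z : centered_L2 Y -> centered_L2 Z ->
  \int[P]_w ((a * Y w + b * Z w) ^+ 2) =
  a ^+ 2 * \int[P]_w (Y w ^+ 2) + 2 * a * b * \int[P]_w (Y w * Z w)
  + b ^+ 2 * \int[P]_w (Z w ^+ 2).
Proof.
move=> cY cZ; have [mY Y2 Y0] := cY; have [mZ Z2 Z0] := cZ.
have YZ := centered_L2_mul cY cZ.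
transitivity (\int[P]_w (a ^+ 2 * Y w ^+ 2 + 1 * (2 * a * b * (Y w * Z w) + b ^+ 2 * Z w ^+ 2))).
  by apply: eq_Rintegral => w _; ring.
transitivity (\int[P]_w (a ^+ 2 * Y w ^+ 2 + 1 * (2 * a * b * (Y w * Z w) + b ^+ 2 * Z w ^+ 2))) => //.
rewrite Rintegral_lin// ?mul1r ?Rintegral_lin// ?addrA//.
rewrite /comp; under eq_fun do rewrite EFinD !EFinM.
by apply: integrableD => //; apply: integrableZl.
Qed.

Let mcos : measurable_fun setT (@cos R).
Proof. exact: continuous_measurable_fun (@continuous_cos R). Qed.

Lemma integrable_cos (Y : T -> R) : measurable_fun setT Y ->
  P.-integrable setT (EFin \o (fun w => cos (Y w))).
Proof.
move=> mY; apply: (@integrable_bounded _ _ _ P _ 1); first exact: measurableT_comp.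
by move=> x; rewrite ler_norml cos_geN1 cos_le1.
Qed.

(** cos Y * A^2 is the limit of (2 cos Y - cos (Y + a A) - cos (Y - a A)) / a^2 as a
    tends to 0, and Y, Y + a A, Y - a A are Gaussian. *)
Lemma gaussian_cos_sqr (Y A : T -> R) : centered_L2 Y -> centered_L2 A ->
  (forall a, gaussian_rv P (fun w => Y w + a * A w)) ->
  P.-integrable setT (EFin \o (fun w => cos (Y w) * A w ^+ 2)) /\
  \int[P]_w (cos (Y w) * A w ^+ 2) =
  (\int[P]_w (A w ^+ 2) - (\int[P]_w (Y w * A w)) ^+ 2)
   * expR (- (\int[P]_w (Y w ^+ 2)) / 2).
Proof.
move=> cY cA G; have [mY Y2 Y0] := cY; have [mA A2 A0] := cA.
pose a n : R := n.+1%:R^-1.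
have a0 n : a n != 0 by rewrite invr_eq0.
have mg : measurable_fun setT (fun w => cos (Y w) * A w ^+ 2).
  by apply: measurable_funM; [exact: measurableT_comp|exact: measurable_funX].
have Ig : P.-integrable setT (EFin \o (fun w => cos (Y w) * A w ^+ 2)).
  apply: (integrable_le_EFin measurableT mg _ A2) => w _.
  by rewrite normrM [X in _ * X]ger0_norm ?sqr_ge0// ler_piMl ?sqr_ge0//
     ler_norml cos_geN1 cos_le1.
split => //.
pose f n w := cos (Y w) * (2 * (sin (a n * A w / 2) / a n)) ^+ 2.
have mf n : measurable_fun setT (fun w => (f n w)%:E).
  apply/measurable_EFinP; apply: measurable_funM; first exact: measurableT_comp.
  apply: measurable_funX; apply: measurable_funM => //; apply: measurable_funM => //.
  apply: measurableT_comp; first exact: continuous_measurable_fun (@continuous_sin R).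
  by apply: measurable_funM => //; apply: measurable_funM.
have cf w : setT w -> (f n w)%:E @[n --> \oo] --> (cos (Y w) * A w ^+ 2)%:E.
  move=> _; apply: cvg_EFin; first exact: nearW.
  apply: cvgM; first exact: cvg_cst.
  have L : 2 * (sin (a n * A w / 2) / a n) @[n --> \oo] --> 2 * (A w / 2).
    apply: cvgM; first exact: cvg_cst.
    apply: (@cvg_slope (fun x => sin (x * A w / 2)) (A w / 2) a) => //.
    - by apply: is_derive_eq; rewrite !mul0r cos0 /GRing.scale/=; field.
    - by rewrite !mul0r sin0.
    - exact: cvg_invS.
  rewrite (_ : 2 * (A w / 2) = A w) in L; last by field.
  by rewrite /=; under eq_fun do rewrite expr2; rewrite expr2; exact: cvgM.
have bf n w : setT w -> (`|(f n w)%:E| <= (A w ^+ 2)%:E)%E.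
  move=> _; rewrite /= lee_fin /f normrM.
  rewrite (@le_trans _ _ (1 * `|(2 * (sin (a n * A w / 2) / a n)) ^+ 2|))//.
    by rewrite ler_wpM2r// ler_norml cos_geN1 cos_le1.
  rewrite mul1r normrX -(real_normK (num_real (A w))) ler_sqr ?nnegrE//.
  rewrite !normrM normfV ger0_norm// mulrA ler_pdivrMr ?normr_gt0//.
  have := norm_sin_le (a n * A w / 2).
  rewrite [X in _ <= X -> _](_ : _ = `|a n| * `|A w| / 2); last first.
    by rewrite normrM (normrM (a n)) (@gtr0_norm _ 2^-1)// invr_gt0.
  by rewrite ler_pdivlMr// mulrC => /le_trans; apply; rewrite mulrC.
have := @dominated_cvg _ _ _ P setT measurableT (fun n w => (f n w)%:E) _
  (fun w => (A w ^+ 2)%:E) mf cf (fun _ _ => erefl) A2 bf.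
rewrite EFin_Rintegral// => L1.
have Ecos (x : R) : \int[P]_w cos (Y w + x * A w) =
    expR (- (\int[P]_w (Y w ^+ 2)) / 2) * expR (- (2 * x * \int[P]_w (Y w * A w) +
    x ^+ 2 * \int[P]_w (A w ^+ 2)) / 2).
  have [m1 m2 m3] := centered_L2_lin 1 x cY cA.
  rewrite gaussian_rv_cos//.
  - rewrite -expRD; congr expR.
    under eq_Rintegral do rewrite -[Y _]mul1r.
    by rewrite Rintegral_sqr_lin//; field.
  - by apply: measurable_funD => //; exact: measurable_funM.
  - by under eq_fun do rewrite -[Y _]mul1r.
  - by under eq_integral do rewrite -[Y _]mul1r.
have Ef n : (\int[P]_w (f n w)%:E = (expR (- (\int[P]_w (Y w ^+ 2)) / 2) *
   ((2 - (expR (- (2 * a n * \int[P]_w (Y w * A w) + a n ^+ 2 * \int[P]_w (A w ^+ 2)) / 2)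
        + expR (- (- (2 * a n * \int[P]_w (Y w * A w)) + a n ^+ 2 * \int[P]_w (A w ^+ 2)) / 2)))
     / a n ^+ 2))%:E)%E.
  have mcY x : measurable_fun setT (fun w => Y w + x * A w).
    by apply: measurable_funD => //; exact: measurable_funM.
  have Ic x := integrable_cos (mcY x).
  transitivity (\int[P]_w (2 / a n ^+ 2 * cos (Y w + 0 * A w) + (- 1 / a n ^+ 2) *
      (1 * cos (Y w + a n * A w) + 1 * cos (Y w + (- a n) * A w)))%:E)%E.
    apply: eq_integral => w _; congr EFin.
    rewrite mul0r addr0 (mulNr (a n)) cosB cosD /f.
    have -> : cos (a n * A w) = 1 - 2 * sin (a n * A w / 2) ^+ 2.
      rewrite {1}(_ : a n * A w = (a n * A w / 2) *+ 2); last by rewrite -mulr_natr divfK.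
      by rewrite cos_mulr2n; have := cos2Dsin2 (a n * A w / 2); lra.
    by have := a0 n; set b := a n => b0; field.
  have I12 := integrable_lin 1 1 (Ic (a n)) (Ic (- a n)).
  rewrite EFin_Rintegral//; last exact: integrable_lin (Ic 0) I12.
  congr EFin; rewrite Rintegral_lin//.
  rewrite Rintegral_lin// !Ecos expr0n/= !mulr0 !mul0r addr0 oppr0 !mul0r expR0 mulr1.
  rewrite sqrrN mulrN !mulNr; have := a0 n; set b := a n => b0; field.
  by [].
move: L1; under eq_fun do rewrite Ef; move=> L1.
have L2 := @cvg_second_difference (\int[P]_w (A w ^+ 2)) (\int[P]_w (Y w * A w)).
have L3 := cvgM (cvg_cst (expR (- (\int[P]_w (Y w ^+ 2)) / 2))) L2.
rewrite [RHS]mulrC.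
apply: EFin_inj.
apply: (cvg_unique (@ereal_hausdorff R) L1).
by apply: cvg_EFin; [exact: nearW|exact: L3].
Qed.

(** Polarization of the previous identity *)
Lemma gaussian_cos_mul (Y A B : T -> R) : centered_L2 Y -> centered_L2 A -> centered_L2 B ->
  (forall a b, gaussian_rv P (fun w => Y w + (a * A w + b * B w))) ->
  P.-integrable setT (EFin \o (fun w => cos (Y w) * (A w * B w))) /\
  \int[P]_w (cos (Y w) * (A w * B w)) =
  (\int[P]_w (A w * B w) - (\int[P]_w (Y w * A w)) * (\int[P]_w (Y w * B w)))
   * expR (- (\int[P]_w (Y w ^+ 2)) / 2).
Proof.
move=> cY cA cB G.
have H (s : R) : P.-integrable setT (EFin \o (fun w => cos (Y w) * (1 * A w + s * B w) ^+ 2)) /\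
  \int[P]_w (cos (Y w) * (1 * A w + s * B w) ^+ 2) =
  (\int[P]_w ((1 * A w + s * B w) ^+ 2) - (\int[P]_w (Y w * (1 * A w + s * B w))) ^+ 2)
   * expR (- (\int[P]_w (Y w ^+ 2)) / 2).
  apply: gaussian_cos_sqr => //; first exact: centered_L2_lin.
  move=> a; have := G a (a * s); congr gaussian_rv.
  by apply/funext => w; ring.
have [I1 E1] := H 1; have [I2 E2] := H (-1).
have YA := centered_L2_mul cY cA; have YB := centered_L2_mul cY cB.
have Elin s : \int[P]_w (Y w * (1 * A w + s * B w)) = \int[P]_w (Y w * A w) + s * \int[P]_w (Y w * B w).
  rewrite -[X in X + _]mul1r -Rintegral_lin//.
  by apply: eq_Rintegral => w _; ring.
rewrite !Elin !Rintegral_sqr_lin// in E1 E2.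
have E w : cos (Y w) * (A w * B w) = 4^-1 * (cos (Y w) * (1 * A w + 1 * B w) ^+ 2) +
   (- 4^-1) * (cos (Y w) * (1 * A w + -1 * B w) ^+ 2) by field.
split.
  rewrite /comp; under eq_fun do rewrite E EFinD !EFinM -!EFinM.
  apply: integrableD => //.
  - by under eq_fun do rewrite EFinM; apply: integrableZl.
  - by under eq_fun do rewrite EFinM; apply: integrableZl.
under eq_Rintegral do rewrite E.
by rewrite Rintegral_lin// E1 E2; field.
Qed.

End gaussian_calculus.

(** * Independence and expectations of products *)

Lemma measurable_prod_cond {R : realType} d (T : measurableType d) (I : finType)
    (Q : pred I) (g : I -> T -> R) : (forall i, Q i -> measurable_fun setT (g i)) ->
  measurable_fun setT (fun w => \prod_(i | Q i) g i w).
Proof.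
move=> mg; rewrite (_ : (fun w => _) = (fun w => \prod_i (if Q i then g i w else 1))).
  by apply: measurable_prod => i _; case: (Q i) (mg i) => [/(_ isT)|].
by apply/funext => w; rewrite big_mkcond.
Qed.

Section independence.
Context {R : realType} d (T : measurableType d) (P : probability T R).
Local Notation mu := (@lebesgue_measure R).

Let layer (y : R) : 0 <= y -> (\int[mu]_t (\1_(`[0, y[ : set R) t)%:E = y%:E)%E.
Proof.
move=> y0; rewrite integral_indic//= setIT.
have := lebesgue_measure_itv (`[0, y[ : interval R).
rewrite /= lte_fin => ->; case: ltP => // [_|yle0]; first by rewrite oppr0 adde0.
by congr EFin; apply/eqP; rewrite eq_le y0 yle0.
Qed.

Lemma measurable_level_prob (f : T -> R) :
  measurable_fun setT f ->
  measurable_fun setT (fun t : measurableTypeR R =>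
    \int[P]_w (\1_[set x | (0 <= t) && (t < f x)] w)%:E)%E.
Proof.
move=> mf.
pose F (z : T * measurableTypeR R) : \bar R := ((0 <= z.2) && (z.2 < f z.1))%:R%:E.
have mF : measurable_fun setT F.
  apply/measurable_EFinP.
  apply: (@measurableT_comp _ _ _ _ _ _ (fun b : bool => b%:R : R)) => //.
  apply: measurable_and.
    by apply: measurable_fun_ler => //.
  apply: measurable_fun_ltr => //; exact: measurableT_comp.
have F0 z : (0 <= F z)%E by rewrite lee_fin.
have := measurable_fun_fubini_tonelli_G (m1 := P) F mF F0.
apply: eq_measurable_fun => t _; rewrite /fubini_G; apply: eq_integral => w _.
rewrite /F /= indicE; congr (nat_of_bool _)%:R%:E.
by apply/idP/idP; rewrite inE.
Qed.

(** Tonelli: f w is the length of the set of levels t in [0, f w[. *)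
Lemma integral_mul_level_sets (f g : T -> R) :
  measurable_fun setT f -> (forall w, 0 <= f w) ->
  measurable_fun setT g -> (forall w, 0 <= g w) ->
  (\int[P]_w (f w * g w)%:E =
   \int[mu]_t \int[P]_w (\1_[set x | (0 <= t) && (t < f x)] w * g w)%:E)%E.
Proof.
move=> mf f0 mg g0.
pose F (z : T * R) : \bar R := (((0 <= z.2) && (z.2 < f z.1))%:R * g z.1)%:E.
have mF : measurable_fun setT F.
  apply/measurable_EFinP; apply: measurable_funM; last exact: measurableT_comp.
  apply: (@measurableT_comp _ _ _ _ _ _ (fun b : bool => b%:R : R)) => //.
  apply: measurable_and.
    by apply: measurable_fun_ler => //.
  apply: measurable_fun_ltr => //; exact: measurableT_comp.
have F0 z : (0 <= F z)%E by rewrite lee_fin mulr_ge0.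
have := fubini_tonelli (m1 := P) (m2 := mu) F mF F0.
rewrite /F /= => E.
transitivity (\int[P]_x \int[mu]_y (((0 <= y) && (y < f x))%:R * g x)%:E)%E.
  apply: eq_integral => w _; rewrite EFinM -{1}(layer (f0 w)) -ge0_integralZr//; last first.
    by rewrite lee_fin.
    by apply/measurable_EFinP; exact: measurable_indic.
  apply: eq_integral => t _; rewrite -EFinM; congr (_ * _)%:E.
  by rewrite indicE; congr (nat_of_bool _)%:R; apply/idP/idP; rewrite inE/= in_itv.
rewrite E; apply: eq_integral => t _; apply: eq_integral => w _.
congr (_ * _)%:E; rewrite indicE; congr (nat_of_bool _)%:R.
by apply/idP/idP; rewrite inE.
Qed.

Variables (I : finType) (G : I -> set_system T).
Hypothesis Gm : forall i E, G i E -> measurable E.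
Hypothesis indG : independent_systems P G.

(** Factors are turned into indicators one at a time, through their level sets;
    the induction is on the list of factors that are not yet indicators. *)
Lemma independent_prod (J : {set I}) (f : I -> T -> R) :
  (forall i w, 0 <= f i w) ->
  (forall i (A : set R), measurable A -> G i (f i @^-1` A)) ->
  (\int[P]_w (\prod_(i in J) f i w)%:E = \prod_(i in J) \int[P]_w (f i w)%:E)%E.
Proof.
move=> f0 fG.
suff H : forall (s : seq I) (h : I -> T -> R), (forall i w, 0 <= h i w) ->
    (forall i (A : set R), measurable A -> G i (h i @^-1` A)) ->
    (forall i, i \in J -> i \notin s -> exists2 E, G i E & h i = \1_E) ->
    (\int[P]_w (\prod_(i in J) h i w)%:E = \prod_(i in J) \int[P]_w (h i w)%:E)%E.
  by apply: (H (enum I)) => // i _; rewrite mem_enum.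
elim => [|i0 s IH] {f0 fG f} f f0 fG fI.
  have [E EP] : {E : I -> set T & forall i, i \in J -> G i (E i) /\ f i = \1_(E i)}.
    apply: (@choice _ _ (fun i E => i \in J -> G i E /\ f i = \1_E)) => i.
    have [iJ|iJ] := boolP (i \in J); last by exists set0.
    by have [E GE fE] := fI i iJ isT; exists E.
  have mE i : i \in J -> measurable (E i) by move=> /EP[/Gm].
  transitivity (\int[P]_w (\1_(\bigcap_(i in [set` J]) E i) w)%:E)%E.
    apply: eq_integral => w _; congr EFin.
    rewrite indicE; have [/set_mem wE|wE] := boolP (w \in _).
      rewrite big1// => i iJ; have [_ ->] := EP i iJ.
      by rewrite indicE mem_set//; exact: wE.
    have [i iJ wEi] : exists2 i, i \in J & ~ E i w.
      apply: contrapT => K; move/negP: wE; apply; apply/mem_set => i /= iJ.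
      by apply: contrapT => nE; apply: K; exists i.
    rewrite (bigD1 i)//=; have [_ ->] := EP i iJ.
    by rewrite indicE memNset// mul0r.
  rewrite integral_indic//; last first.
    by apply: fin_bigcap_measurable => [|i /mE//]; exact: finite_finset.
  rewrite setIT; have {}indE := @indG J E (fun i iJ => (EP i iJ).1).
  rewrite [LHS]indE.
  apply: eq_bigr => i iJ; have [_ ->] := EP i iJ.
  by rewrite integral_indic ?setIT//; exact: mE.
have mf i : measurable_fun setT (f i).
  by move=> _ A mA; rewrite setTI; apply: Gm; exact: fG.
have [iJ|iJ] := boolP (i0 \in J); last first.
  apply: (IH f) => // i iJ' is_; apply: fI => //; rewrite inE negb_or is_ andbT.
  by apply: contraNneq iJ => <-.
pose L t := [set x | (0 <= t) && (t < f i0 x)].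
pose ft t i := if i == i0 then \1_(L t) else f i.
have LG t : G i0 (L t).
  have -> : L t = f i0 @^-1` [set y | (0 <= t) && (t < y)] by [].
  apply: fG; case: (0 <= t) => /=.
    rewrite (_ : [set y | t < y] = `]t, +oo[%classic)//.
    by apply/seteqP; split => y /=; rewrite in_itv/= andbT.
  by have -> : [set _ : R | false] = set0 by apply/seteqP; split.
have LGi t (A : set R) : G i0 ((\1_(L t) : T -> R) @^-1` A).
  rewrite preimage_indic.
  have G0 : G i0 set0.
    by have := fG i0 set0 measurable0; rewrite preimage_set0.
  have GT : G i0 setT.
    by have := fG i0 setT measurableT; rewrite preimage_setT.
  have GC : G i0 (~` L t).
    have -> : ~` L t = f i0 @^-1` (~` [set y | (0 <= t) && (t < y)]) by [].
    apply: fG; apply: measurableC; case: (0 <= t) => /=.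
      rewrite (_ : [set y | t < y] = `]t, +oo[%classic)//.
      by apply/seteqP; split => y /=; rewrite in_itv/= andbT.
    by have -> : [set _ : R | false] = set0 by apply/seteqP; split.
  by case: ifPn => _; case: ifPn => _.
have E t : (\int[P]_w (\prod_(i in J) ft t i w)%:E = \prod_(i in J) \int[P]_w (ft t i w)%:E)%E.
  apply: IH.
  - by move=> i w; rewrite /ft; case: ifP.
  - by move=> i A mA; rewrite /ft; case: ifPn => [/eqP ->|_]; [exact: LGi|exact: fG].
  - move=> i iJ' is_; rewrite /ft; case: ifPn => [/eqP ->|ii0]; first by exists (L t).
    by apply: fI => //; rewrite inE negb_or ii0.
pose g w := \prod_(i in J | i != i0) f i w.
have g0 w : 0 <= g w by apply: prodr_ge0.
have mg : measurable_fun setT g.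
  by apply: measurable_prod_cond.
transitivity (\int[P]_w (f i0 w * g w)%:E)%E.
  by apply: eq_integral => w _; rewrite (bigD1 i0).
rewrite integral_mul_level_sets//.
transitivity (\int[mu]_t (\int[P]_w (\1_(L t) w)%:E *
     \prod_(i in J | i != i0) \int[P]_w (f i w)%:E))%E.
  apply: eq_integral => t _; have := E t; rewrite (bigD1 i0 iJ)/=.
  rewrite {2}/ft eqxx.
  rewrite (eq_bigr (fun i => \int[P]_w (f i w)%:E)%E); last first.
    by move=> i /andP[_ ii0]; rewrite /ft (negbTE ii0).
  move=> <-; apply: eq_integral => w _; rewrite (bigD1 i0 iJ)/= {1}/ft eqxx.
  congr (_ * _)%:E; apply: eq_bigr => i /andP[_ ii0]; by rewrite /ft (negbTE ii0).
have c0 : (0 <= \prod_(i in J | i != i0) \int[P]_w (f i w)%:E)%E.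
  by apply: prode_ge0 => i _; apply: integral_ge0 => w _; rewrite lee_fin.
have := @integral_mul_level_sets (f i0) (cst 1) (mf i0) (f0 i0) (measurable_cst _) (fun _ => ler01).
rewrite /=; under eq_integral do rewrite mulr1.
under [in RHS]eq_integral do under eq_integral do rewrite mulr1.
move=> E1; rewrite ge0_integralZr//.
- by rewrite [in RHS](bigD1 i0)//= E1.
- exact: measurable_level_prob.
- by move=> t _; apply: integral_ge0 => w _; rewrite lee_fin.
Qed.

(** Only the distinguished factor may be signed; the others are bounded. *)
Lemma independent_mul (i0 : I) (f0 : T -> R) (g : I -> T -> R) :
  P.-integrable setT (EFin \o f0) ->
  (forall A : set R, measurable A -> G i0 (f0 @^-1` A)) ->
  (forall i w, 0 <= g i w <= 1) ->
  (forall i (A : set R), measurable A -> G i (g i @^-1` A)) ->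
  \int[P]_w (f0 w * \prod_(i | i != i0) g i w) =
  \int[P]_w f0 w * \int[P]_w \prod_(i | i != i0) g i w.
Proof.
move=> If Gf g01 Gg.
have mg i : measurable_fun setT (g i).
  by move=> _ A mA; rewrite setTI; apply: Gm; exact: Gg.
have mf : measurable_fun setT f0.
  by move=> _ A mA; rewrite setTI; apply: Gm; exact: Gf.
pose p w := \prod_(i | i != i0) g i w.
have mp : measurable_fun setT p.
  by apply: measurable_prod_cond.
have p0 w : 0 <= p w by apply: prodr_ge0 => i _; case/andP: (g01 i w).
have p1 w : p w <= 1.
  by apply: prodr_ile1 => i _; exact: g01.
have pI : P.-integrable setT (EFin \o p).
  apply: (@integrable_bounded _ _ _ P _ 1) => // w; by rewrite ger0_norm.
have Ep : (\int[P]_w (p w)%:E = \prod_(i | i != i0) \int[P]_w (g i w)%:E)%E.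
  have := @independent_prod [set~ i0] g (fun i w => (andP (g01 i w)).1) Gg.
  under eq_integral do under eq_bigl do rewrite !inE.
  by under [in RHS]eq_bigl do rewrite !inE.
have key (h : T -> R) : (forall w, 0 <= h w) ->
    (forall A : set R, measurable A -> G i0 (h @^-1` A)) ->
    (\int[P]_w (h w * p w)%:E = \int[P]_w (h w)%:E * \int[P]_w (p w)%:E)%E.
  move=> h0 Gh; rewrite Ep.
  have := @independent_prod [set: I]%SET (fun i => if i == i0 then h else g i).
  have -> : (\prod_(i in [set: I]%SET) \int[P]_w ((if i == i0 then h else g i) w)%:E =
     \int[P]_w (h w)%:E * \prod_(i | i != i0) \int[P]_w (g i w)%:E)%E.
    rewrite (bigD1 i0) ?inE//= eqxx; congr (_ * _)%E.
    by apply: eq_big => [i|i /andP[_ /negbTE ->]]//; rewrite inE.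
  move=> <-.
  - apply: eq_integral => w _; rewrite (bigD1 i0) ?inE//= eqxx; congr (_ * _)%:E.
    by apply: eq_big => [i|i /negbTE ->]//; rewrite inE.
  - by move=> i w; case: ifP => // _; case/andP: (g01 i w).
  - by move=> i A mA; case: ifPn => [/eqP ->|_]; [exact: Gh|exact: Gg].
have posE w : f0 w = Num.max (f0 w) 0 - Num.max (- f0 w) 0.
  by rewrite /Num.max; case: ltgtP => ?; case: ltgtP => ?; lra.
have bmax (x : R) : `|Num.max x 0| <= `|x|.
  by rewrite ger0_norm ?le_max ?lexx ?orbT// ge_max ler_norm normr_ge0.
have Gmax (s : R) (A : set R) : measurable A -> G i0 ((fun w => Num.max (s * f0 w) 0) @^-1` A).
  move=> mA; have -> : (fun w => Num.max (s * f0 w) 0) @^-1` A =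
     f0 @^-1` ((fun y => Num.max (s * y) 0) @^-1` A) by [].
  apply: Gf; rewrite -[X in measurable X]setTI.
  have : measurable_fun setT (fun y : R => Num.max (s * y) 0).
    by apply: measurable_maxr => //; exact: measurable_funM.
  exact.
have Imax (s : R) : `|s| <= 1 -> P.-integrable setT (EFin \o (fun w => Num.max (s * f0 w) 0)).
  move=> s1; apply: (@integrable_le_EFin _ _ _ P setT _ (fun w => `|f0 w|)) => //.
  - by apply: measurable_maxr => //; exact: measurable_funM.
  - by move=> w _; rewrite (le_trans (bmax _))// normrM ler_piMl.
  - exact: integrable_norm.
have n1 : `|1| <= 1 :> R by rewrite normr1.
have n2 : `|-1| <= 1 :> R by rewrite normrN1.
have kR s : `|s| <= 1 -> P.-integrable setT (EFin \o (fun w => Num.max (s * f0 w) 0 * p w)) /\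
   \int[P]_w (Num.max (s * f0 w) 0 * p w) =
   \int[P]_w (Num.max (s * f0 w) 0) * \int[P]_w p w.
  move=> s1; split.
    apply: (@integrable_le_EFin _ _ _ P setT _ (fun w => Num.max (s * f0 w) 0)) => //.
    - by apply: measurable_funM => //; apply: measurable_maxr => //; exact: measurable_funM.
    - move=> w _; have m0 : 0 <= Num.max (s * f0 w) 0 by rewrite le_max lexx orbT.
      by rewrite ger0_norm ?mulr_ge0// ler_piMr.
    - exact: Imax.
  have K := key (fun w => Num.max (s * f0 w) 0) _ (Gmax s).
  rewrite {1}/Rintegral K; last by move=> w; rewrite le_max lexx orbT.
  by rewrite fineM//; apply: integrable_fin_num => //; exact: Imax.
have [I1 E1] := kR 1 n1; have [I2 E2] := kR (-1) n2.
have fE w : f0 w = 1 * Num.max (1 * f0 w) 0 + (-1) * Num.max (-1 * f0 w) 0.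
  by rewrite mul1r !mulN1r !mul1r; exact: posE.
transitivity (\int[P]_w (1 * (Num.max (1 * f0 w) 0 * p w) + (-1) * (Num.max (-1 * f0 w) 0 * p w))).
  by apply: eq_Rintegral => w _; rewrite {1}fE -/(p w); ring.
rewrite Rintegral_lin// E1 E2 -/p.
have -> : \int[P]_w f0 w = 1 * \int[P]_w (Num.max (1 * f0 w) 0) + (-1) * \int[P]_w (Num.max (-1 * f0 w) 0).
  by rewrite -Rintegral_lin; [apply: eq_Rintegral => w _; exact: fE|exact: Imax..].
by ring.
Qed.

End independence.

(** * Measures on a time interval and jointly measurable paths *)

Section time_measure.
Context {R : realType}.
Local Notation mu := (@lebesgue_measure R).

Lemma lebesgue_itv_lty (a b : R) : (mu `[a, b]%classic < +oo)%E.
Proof. by rewrite lebesgue_measure_itv/=; case: ifPn => // _; rewrite -EFinD ltry. Qed.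

(** Lebesgue measure on the interval [a, b], as a finite measure on the whole line *)
Definition itv_measure (a b : R) : {finite_measure set (measurableTypeR R) -> \bar R} :=
  @mfrestr _ (measurableTypeR R) R `[a, b] mu (measurable_itv `[a, b]) (lebesgue_itv_lty a b).

Lemma integral_itv_measure (a b : R) (f : R -> \bar R) : measurable_fun setT f ->
  (\int[itv_measure a b]_x f x = \int[mu]_(x in `[a, b]) f x)%E.
Proof.
move=> mf.
have key (g : R -> \bar R) : measurable_fun setT g -> (forall x, 0 <= g x)%E ->
    (\int[itv_measure a b]_x g x = \int[mu]_(x in `[a, b]) g x)%E.
  move=> mg g0.
  rewrite (@ge0_negligible_integral _ (measurableTypeR R) R (itv_measure a b) setT (~` `[a, b]))//.
  - rewrite setTD setCK; apply: eq_measure_integral => A mA Aab.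
    by rewrite /= /mfrestr /mrestr setIidl.
  - exact: measurableC.
  - by rewrite /= /mfrestr /mrestr setICl measure0.
rewrite integralE [RHS]integralE !key//; first exact: measurable_funeneg.
exact: measurable_funepos.
Qed.

End time_measure.

Section joint_measurability.
Context {R : realType} d (T : measurableType d).

Lemma continuous_clamp (f : R -> R) : {within `[0, +oo[, continuous f} ->
  continuous (fun t : R => f (Num.max 0 t)).
Proof.
move/subspace_continuousP => cf x.
have Ax : `[0, +oo[%classic (Num.max 0 x) by rewrite /= in_itv/= andbT le_max lexx.
have cm : Num.max 0 t @[t --> x] --> (Num.max 0 x : R).
  by apply: continuous_max; [exact: cvg_cst|exact: cvg_id].
apply: cvg_trans (cf _ Ax) => B HB; have H := cm _ HB.
apply: (@filterS _ (nbhs x) _ _ _ _ H) => y; apply.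
by rewrite /= in_itv/= andbT le_max lexx.
Qed.

(** A process that is measurable at each time and has continuous paths is jointly
    measurable, as a limit of step processes. Negative times are sent to 0. *)
Lemma measurable_clamp (X : R -> T -> R) :
  (forall t, 0 <= t -> measurable_fun setT (X t)) ->
  (forall w, {within `[0, +oo[, continuous (X ^~ w)}) ->
  measurable_fun setT (fun z : measurableTypeR R * T => X (Num.max 0 z.1) z.2).
Proof.
move=> mX cX.
pose k n (t : R) := Num.truncn (n.+1%:R * Num.max 0 t).
pose F n (z : measurableTypeR R * T) := X ((k n z.1)%:R / n.+1%:R) z.2.
have m0 (t : R) : 0 <= Num.max 0 t by rewrite le_max lexx.
apply: (@measurable_fun_cvg _ _ _ _ F) => [n|z _].
  move=> _ A mA; rewrite setTI.
  have -> : F n @^-1` A = \bigcup_j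
     ([set t : measurableTypeR R | j%:R <= n.+1%:R * Num.max 0 t < j.+1%:R] `*` (X (j%:R / n.+1%:R) @^-1` A)).
    apply/seteqP; split => [[t w] /= Atw|[t w] [j _ [/= tj Aw]]].
      by exists (k n t) => //=; split => //=; apply: truncn_itv; rewrite mulr_ge0.
    by rewrite /F /= /k (truncn_def tj).
  apply: bigcupT_measurable => j; apply: measurableX.
    rewrite -[X in measurable X]setTI.
    have mm : measurable_fun setT (fun t : R => n.+1%:R * Num.max 0 t).
      by apply: measurable_funM => //; exact: measurable_maxr.
    have -> : [set t : R | j%:R <= n.+1%:R * Num.max 0 t < j.+1%:R] =
       (fun t : R => n.+1%:R * Num.max 0 t) @^-1` `[j%:R, j.+1%:R[%classic.
      by apply/seteqP; split => t /=; rewrite in_itv.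
    by apply: mm => //; exact: measurable_itv.
  by rewrite -[X in measurable X]setTI; apply: mX.
have c := continuous_clamp (cX z.2).
have L : (k n z.1)%:R / n.+1%:R @[n --> \oo] --> (Num.max 0 z.1 : R).
  apply/cvgrPdist_le => e e0; near=> n.
  have /andP[h1 h2] := truncn_itv (mulr_ge0 (ler0n R n.+1) (m0 z.1)).
  rewrite -/(k n z.1) in h1 h2.
  have n0 : 0 < n.+1%:R :> R by [].
  rewrite ger0_norm; last by rewrite subr_ge0 ler_pdivrMr// mulrC.
  rewrite lerBlDl -(ler_pM2l n0) mulrDr mulrCA divff ?gt_eqF// mulr1.
  apply: (le_trans (ltW h2)); rewrite -natr1 lerD2l mulrC.
  rewrite -ler_pdivrMr// mul1r; apply: ltW; near: n.
  exact: near_infty_natSinv_lt (PosNum e0).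
have := cvg_comp _ _ L (c _).
have -> : (fun t => X (Num.max 0 t) z.2) (Num.max 0 z.1) = X (Num.max 0 z.1) z.2.
  by rewrite /= max_r.
apply: cvg_trans; apply: near_eq_cvg; near=> n.
by rewrite /F /= max_r// divr_ge0.
Unshelve. all: end_near. Qed.

End joint_measurability.

Section finite_product.
Context {R : realType} d1 d2 (T1 : measurableType d1) (T2 : measurableType d2).

(** The product of two finite measures, as a finite measure. *)
Definition finite_product (m1 : {finite_measure set T1 -> \bar R})
  (m2 : {finite_measure set T2 -> \bar R}) := (m1 \x m2)%E.

HB.instance Definition _ m1 m2 := Measure.on (finite_product m1 m2).

Let finite_product_fin m1 m2 : fin_num_fun (finite_product m1 m2).
Proof.
move=> A mA; rewrite ge0_fin_numE//.
apply: (@le_lt_trans _ _ (finite_product m1 m2 setT)).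
  by apply: le_measure; rewrite ?inE.
rewrite -setXTT /finite_product /= product_measure1E//.
by rewrite -ge0_fin_numE ?mule_ge0// fin_numM// fin_num_measure.
Qed.

HB.instance Definition _ m1 m2 :=
  Measure_isFinite.Build _ _ _ (finite_product m1 m2) (finite_product_fin m1 m2).

End finite_product.

(** * Positive semi-definiteness of Gaussian kernels *)

Section psd_kernels.
Context {R : realType}.
Local Notation gam := (normal_prob (0 : R) 1).

(** The Gaussian kernel is the Gaussian mixture of cosines. *)
Lemma gaussian_mixture d (Z : measurableType d) (nu : {sigma_finite_measure set Z -> \bar R})
    (F y : Z -> R) (kap : R) : 0 <= kap ->
  nu.-integrable setT (EFin \o F) -> measurable_fun setT y ->
  (\int[nu]_z (F z * expR (- (kap * y z ^+ 2)))%:E =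
   \int[gam]_x \int[nu]_z (F z * cos (Num.sqrt (2 * kap) * x * y z))%:E)%E.
Proof.
move=> kap0 IF my.
have mF : measurable_fun setT F by apply/measurable_EFinP; exact: measurable_int IF.
pose G (q : Z * measurableTypeR R) : \bar R := (F q.1 * cos (Num.sqrt (2 * kap) * q.2 * y q.1))%:E.
have mG : measurable_fun setT G.
  apply/measurable_EFinP; apply: measurable_funM; first exact: measurableT_comp.
  apply: (@measurableT_comp _ _ _ _ _ _ cos).
    exact: continuous_measurable_fun (@continuous_cos R).
  apply: measurable_funM; last exact: measurableT_comp.
  exact: measurable_funM.
have maG : measurable_fun setT (abse \o G) by exact: measurableT_comp.
have IG : (nu \x gam)%E.-integrable setT G.
  apply: (@integrable12ltyP _ _ Z (measurableTypeR R) R nu gam G mG).2.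
  case/integrableP : IF => _; apply: le_lt_trans.
  apply: ge0_le_integral => //.
  - by move=> z _; apply: integral_ge0.
  - exact: (@measurable_fun_fubini_tonelli_F _ _ Z (measurableTypeR R) R gam (abse \o G) maG (fun _ => abse_ge0 _)).
  - by apply: measurableT_comp => //; apply/measurable_EFinP.
  - move=> z _; apply: (@le_trans _ _ (\int[gam]_x (`|F z|)%:E)%E).
      apply: ge0_le_integral => //.
      + by apply: measurableT_comp => //; exact: measurableT_comp.
      + move=> x _; rewrite /= lee_fin normrM ler_piMr// ler_norml cos_geN1 cos_le1//.
    by rewrite integral_prob_cst.
rewrite -(Fubini IG); apply: eq_integral => z _; rewrite /G /=.
under eq_integral do rewrite EFinM.
rewrite integralZl//; last first.
  apply: (@integrable_bounded _ _ _ gam (fun x => cos (Num.sqrt (2 * kap) * x * y z)) 1).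
    apply: (@measurableT_comp _ _ _ _ _ _ cos).
      exact: continuous_measurable_fun (@continuous_cos R).
    by apply: measurable_funM => //; apply: measurable_funM.
  by move=> x; rewrite ler_norml cos_geN1 cos_le1.
rewrite EFinM; congr (_ * _)%E.
have -> : (\int[gam]_x (cos (Num.sqrt (2 * kap) * x * y z))%:E)%E =
    (\int[gam]_x (cos (Num.sqrt (2 * kap) * y z * x))%:E)%E.
  by apply: eq_integral => x _; rewrite mulrAC.
rewrite EFin_Rintegral//; last first.
  apply: (@integrable_bounded _ _ _ gam (fun x => cos (Num.sqrt (2 * kap) * y z * x)) 1).
    apply: (@measurableT_comp _ _ _ _ _ _ cos).
      exact: continuous_measurable_fun (@continuous_cos R).
    by apply: measurable_funM.
  by move=> x; rewrite ler_norml cos_geN1 cos_le1.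
rewrite char_normal_prob exprMn sqr_sqrtr ?mulr_ge0//; congr (expR _)%:E; by field.
Qed.

Context d (S : measurableType d).
Variable m : {finite_measure set S -> \bar R}.
Local Notation nu := (finite_product m m).

(** Gaussian kernel of the increment between two times of the family xs *)
Definition gauss_weight (kap : R) (xs : seq (S -> R)) (z : S * S) : R :=
  \prod_(x <- xs) expR (- (kap * (x z.1 - x z.2) ^+ 2)).

Lemma gauss_weight_ge0 kap xs z : 0 <= gauss_weight kap xs z.
Proof. by apply: prodr_ge0 => x _; exact: expR_ge0. Qed.

Lemma gauss_weight_le1 kap xs z : 0 <= kap -> gauss_weight kap xs z <= 1.
Proof.
move=> kap0; apply: prodr_ile1 => x _; rewrite expR_ge0/= -expR0 ler_expR oppr_le0.
by rewrite mulr_ge0// sqr_ge0.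
Qed.

Lemma measurable_gauss_weight kap (xs : seq (S -> R)) :
  (forall i, measurable_fun setT (nth (cst 0) xs i)) ->
  measurable_fun setT (gauss_weight kap xs).
Proof.
move=> mxs; rewrite /gauss_weight.
under eq_fun do rewrite (big_nth (cst 0)).
apply: measurable_prod => i _; apply: measurableT_comp => //; apply: measurableT_comp => //.
apply: measurable_funM => //; apply: measurable_funX; apply: measurable_funB.
  exact: measurableT_comp.
exact: measurableT_comp.
Qed.

(** Products of Gaussian kernels are positive semi-definite: one factor at a time is
    written as a mixture of cos (b (x t - x s)), and the cosine of a difference
    splits into two products, which are absorbed into f. *)
Lemma psd_gauss_weight (kap : R) (xs : seq (S -> R)) (f : S -> R) (C : R) : 0 <= kap ->
  (forall i, measurable_fun setT (nth (cst 0) xs i)) ->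
  measurable_fun setT f -> (forall t, `|f t| <= C) ->
  (0 <= \int[nu]_z (f z.1 * f z.2 * gauss_weight kap xs z)%:E)%E.
Proof.
move=> kap0; elim: xs f C => [|x xs IH] f C mxs mf fC.
  have If : m.-integrable setT (EFin \o f) by exact: (@integrable_bounded R _ S m f C mf fC).
  have mff : measurable_fun setT (fun z : S * S => f z.1 * f z.2).
    by apply: measurable_funM; exact: measurableT_comp.
  have Iff : nu.-integrable setT (EFin \o (fun z => f z.1 * f z.2)).
    apply: (@integrable_bounded _ _ _ nu _ (C * C)) => //.
    by move=> z; rewrite normrM ler_pM.
  have -> : (\int[nu]_z (f z.1 * f z.2 * gauss_weight kap [::] z)%:E =
      \int[nu]_z (EFin \o (fun z : S * S => f z.1 * f z.2)%R) z)%E.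
    by apply: eq_integral => z _; rewrite /gauss_weight big_nil mulr1.
  rewrite -(integral12_prod_meas1 Iff) /fubini_F/=.
  under eq_integral do under eq_integral do rewrite EFinM.
  under eq_integral do rewrite integralZl//.
  rewrite EFin_Rintegral//; under eq_integral do rewrite -EFinM mulrC EFinM.
  by rewrite integralZl// EFin_Rintegral// -EFinM lee_fin -expr2 sqr_ge0.
have mx : measurable_fun setT x := mxs 0%N.
have mxs' i : measurable_fun setT (nth (cst 0) xs i) := mxs i.+1.
pose F z := f z.1 * f z.2 * gauss_weight kap xs z.
have mF : measurable_fun setT F.
  apply: measurable_funM; last exact: measurable_gauss_weight.
  by apply: measurable_funM; exact: measurableT_comp.
have IF : nu.-integrable setT (EFin \o F).
  apply: (@integrable_bounded _ _ _ nu _ (C * C)) => //.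
  move=> z; rewrite !normrM (ger0_norm (gauss_weight_ge0 _ _ _)).
  by rewrite -[leRHS]mulr1 ler_pM ?mulr_ge0// ?gauss_weight_ge0 ?gauss_weight_le1// ler_pM.
pose y z := x z.1 - x z.2.
have my : measurable_fun setT y by apply: measurable_funB; exact: measurableT_comp.
have -> : (\int[nu]_z (f z.1 * f z.2 * gauss_weight kap (x :: xs) z)%:E =
    \int[nu]_z (F z * expR (- (kap * y z ^+ 2)))%:E)%E.
  by apply: eq_integral => z _; rewrite /gauss_weight big_cons /F mulrCA mulrC mulrA.
rewrite (gaussian_mixture kap0 IF my).
apply: integral_ge0 => a _.
set b := Num.sqrt _ * a.
have trig (h : R -> R) : continuous h -> (forall r, `|h r| <= 1) ->
   (0 <= \int[nu]_z ((f z.1 * h (b * x z.1)) * (f z.2 * h (b * x z.2)) * gauss_weight kap xs z)%:E)%E /\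
   nu.-integrable setT (EFin \o (fun z => (f z.1 * h (b * x z.1)) * (f z.2 * h (b * x z.2)) * gauss_weight kap xs z)).
  move=> ch h1.
  have mh : measurable_fun setT (fun t => f t * h (b * x t)).
    apply: measurable_funM => //; apply: measurableT_comp.
      exact: continuous_measurable_fun.
    exact: measurable_funM.
  have hC t : `|f t * h (b * x t)| <= C by rewrite normrM -[leRHS]mulr1 ler_pM.
  split; first exact: (IH (fun t => f t * h (b * x t)) C).
  apply: (@integrable_bounded _ _ _ nu _ (C * C)).
    apply: measurable_funM; last exact: measurable_gauss_weight.
    by apply: measurable_funM; [exact: (measurableT_comp mh)|exact: (measurableT_comp mh)].
  move=> z; rewrite normrM (ger0_norm (gauss_weight_ge0 _ _ _)) normrM.
  by rewrite -[leRHS]mulr1 ler_pM ?mulr_ge0// ?gauss_weight_ge0 ?gauss_weight_le1// ler_pM.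
have c1 r : `|cos r| <= 1 :> R by rewrite ler_norml cos_geN1 cos_le1.
have s1 r : `|sin r| <= 1 :> R by rewrite ler_norml sin_geN1 sin_le1.
have [p1 I1] := trig cos (@continuous_cos R) c1.
have [p2 I2] := trig sin (@continuous_sin R) s1.
rewrite (_ : (\int[nu]_z _)%E = (\int[nu]_z ((f z.1 * cos (b * x z.1)) * (f z.2 * cos (b * x z.2)) * gauss_weight kap xs z)%:E +
   \int[nu]_z ((f z.1 * sin (b * x z.1)) * (f z.2 * sin (b * x z.2)) * gauss_weight kap xs z)%:E)%E); first exact: adde_ge0.
rewrite -integralD//; apply: eq_integral => z _; rewrite -EFinD; congr EFin.
by rewrite /F /y mulrBr cosB; ring.
Qed.

End psd_kernels.

(** * Lower bound for the energy of a path *)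

Section kernel_lower_bound.
Context {R : realType} d (S : measurableType d) (m : {finite_measure set S -> \bar R}).
Local Notation mu := (@lebesgue_measure R).
Local Notation nu := (finite_product m m).

Variables (n : nat) (x D : 'I_n -> S -> R) (C : R).
Hypothesis mx : forall i, measurable_fun setT (x i).
Hypothesis mD : forall i, measurable_fun setT (D i).
Hypothesis DC : forall i t, `|D i t| <= C.

Let q (z : S * S) : R := \sum_i (x i z.1 - x i z.2) ^+ 2.
Let g (z : S * S) : R := \sum_i D i z.1 * D i z.2.

Variables (wt wt0 kap : measurableTypeR R -> R).
Hypothesis mwt : measurable_fun setT wt.
Hypothesis mwt0 : measurable_fun setT wt0.
Hypothesis mkap : measurable_fun setT kap.
Hypothesis kap0 : forall u, 0 <= kap u.
Hypothesis wt0_ge0 : forall u, 0 <= wt0 u.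
Hypothesis wt0_le : forall u, wt0 u <= wt u.

Let wt_ge0 u : 0 <= wt u. Proof. exact: le_trans (wt0_ge0 u) (wt0_le u). Qed.

Let mm1 (f : S -> R) : measurable_fun setT f -> measurable_fun setT (fun z : S * S => f z.1).
Proof. by move=> mf; exact: measurableT_comp. Qed.
Let mm2 (f : S -> R) : measurable_fun setT f -> measurable_fun setT (fun z : S * S => f z.2).
Proof. by move=> mf; exact: measurableT_comp. Qed.

Let mq : measurable_fun setT q.
Proof.
apply: measurable_sum => i; apply: measurable_funX; apply: measurable_funB.
  exact: mm1.
exact: mm2.
Qed.

Let mg : measurable_fun setT g.
Proof.
by apply: measurable_sum => i; apply: measurable_funM; [exact: mm1|exact: mm2].
Qed.

Let DD (i : 'I_n) (z : S * S) : R := D i z.1 * D i z.2.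

Let C0 (i : 'I_n) (t : S) : 0 <= C. Proof. exact: le_trans (DC i t). Qed.

Let gC z : `|g z| <= n%:R * (C * C).
Proof.
rewrite /g (le_trans (ler_norm_sum _ _ _))//.
rewrite (le_trans (ler_sum _ (_ : forall i, true -> _ <= C * C)))//.
  by move=> i _; rewrite normrM ler_pM.
by rewrite sumr_const card_ord mulr_natl.
Qed.

Let K (z : S * S) : \bar R := (\int[mu]_u (wt u * expR (- (kap u * q z)))%:E)%E.

Let weightE u z : expR (- (kap u * q z)) =
  gauss_weight (kap u) [seq x i | i <- enum 'I_n] z.
Proof.
rewrite /gauss_weight big_map big_enum/= -expR_sum; congr expR.
by rewrite /q mulr_sumr sumrN.
Qed.

Let h (f : measurableTypeR R -> R) (e : S * S -> R) (y : measurableTypeR R * (S * S)) : \bar R :=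
  (f y.1 * expR (- (kap y.1 * q y.2)) * e y.2)%:E.

Let mh (f : measurableTypeR R -> R) (e : S * S -> R) : measurable_fun setT f -> measurable_fun setT e -> measurable_fun setT (h f e).
Proof.
move=> mf me; apply/measurable_EFinP; apply: measurable_funM; last exact: measurableT_comp.
apply: measurable_funM; first exact: measurableT_comp.
apply: measurableT_comp => //; apply: measurableT_comp => //.
by apply: measurable_funM; exact: measurableT_comp.
Qed.

Hypothesis Kfin : (\int[nu]_z K z < +oo)%E.

Let Ih (f : measurableTypeR R -> R) (e : S * S -> R) (B : R) : measurable_fun setT f -> measurable_fun setT e ->
  (forall u, 0 <= f u <= wt u) -> (forall z, `|e z| <= B) ->
  (mu \x nu)%E.-integrable setT (h f e).
Proof.
move=> mf me f0 eB; have mfe := mh mf me.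
apply: (@integrable21ltyP _ _ (measurableTypeR R) (S * S)%type R mu nu (h f e) mfe).2.
have m1 : measurable_fun setT (h wt (cst 1)) by apply: mh.
have mK : measurable_fun setT K.
  have := @measurable_fun_fubini_tonelli_G _ _ (measurableTypeR R) (S * S)%type R mu (h wt (cst 1)) m1.
  move=> H; apply: (eq_measurable_fun _ _ (H _)).
    by move=> z _; apply: eq_integral => u _; rewrite /h/= mulr1.
  by move=> y; rewrite lee_fin /= mulr1 mulr_ge0 ?expR_ge0.
have K0 z : (0 <= K z)%E by apply: integral_ge0 => u _; rewrite lee_fin mulr_ge0 ?expR_ge0.
apply: (@le_lt_trans _ _ (\int[nu]_z (`|B|%:E * K z))%E); last first.
  by rewrite ge0_integralZl// lte_mul_pinfty.
apply: ge0_le_integral => //.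
- by move=> z _; apply: integral_ge0.
- have mae : measurable_fun setT (abse \o h f e) by exact: measurableT_comp.
  exact: (@measurable_fun_fubini_tonelli_G _ _ (measurableTypeR R) (S * S)%type R mu (abse \o h f e) mae (fun _ => abse_ge0 _)).
- by apply: emeasurable_funM.
- move=> z _; rewrite /K -ge0_integralZl//.
  + apply: ge0_le_integral => //.
    * have : measurable_fun setT (abse \o h f e) by exact: measurableT_comp.
      by move=> /(measurable_fun_pair1 z).
    * have := measurable_fun_pair1 z m1 => m1z.
      have -> : (fun u => `|B|%:E * (wt u * expR (- (kap u * q z)))%:E)%E =
        (fun u => `|B|%:E * h wt (cst 1%R) (u, z))%E.
        by apply/funext => u; rewrite /h/= mulr1.
      exact: emeasurable_funM.
    * move=> u _; rewrite /h/= -EFinM lee_fin !normrM (ger0_norm (expR_ge0 _)).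
      have /andP[f1 f2] := f0 u; rewrite (ger0_norm f1) mulrC ler_pM ?mulr_ge0 ?expR_ge0//.
        by rewrite (le_trans (eB z))// ler_norm.
      by rewrite ler_wpM2r ?expR_ge0.
  + have := measurable_fun_pair1 z m1 => m1z.
    have -> : (fun u => (wt u * expR (- (kap u * q z)))%:E) =
        (fun u => h wt (cst 1%R) (u, z)).
        by apply/funext => u; rewrite /h/= mulr1.
    exact: m1z.
  + by move=> u _; rewrite lee_fin mulr_ge0 ?expR_ge0.
Qed.

Let psd (f : measurableTypeR R -> R) (i : 'I_n) u : (forall u, 0 <= f u) ->
  (0 <= \int[nu]_z (h f (DD i) (u, z)))%E.
Proof.
move=> f0.
have E : (\int[nu]_z (h f (DD i) (u, z)) =
   (f u)%:E * \int[nu]_z (D i z.1 * D i z.2 * gauss_weight (kap u) [seq x i | i <- enum 'I_n] z)%:E)%E.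
  rewrite -integralZl//.
    apply: eq_integral => z _; by rewrite /h /DD/= weightE -EFinM; congr EFin; ring.
  apply: (@integrable_bounded _ _ _ nu (fun z => D i z.1 * D i z.2 * gauss_weight (kap u) [seq x i | i <- enum 'I_n] z) (C * C)).
    apply: measurable_funM; first by apply: measurable_funM; [exact: mm1|exact: mm2].
    apply: measurable_gauss_weight => k.
    have [kn|kn] := ltnP k n; last by rewrite nth_default// size_map size_enum_ord.
    by rewrite (nth_map (Ordinal kn)) ?size_enum_ord.
  move=> z; rewrite !normrM (ger0_norm (gauss_weight_ge0 _ _ _)).
  rewrite -[leRHS]mulr1 ler_pM ?mulr_ge0 ?gauss_weight_ge0 ?gauss_weight_le1//.
  by rewrite ler_pM.
rewrite E mule_ge0 ?lee_fin//.
apply: (@psd_gauss_weight _ _ _ _ _ _ _ C) => // k.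
have [kn|kn] := ltnP k n; last by rewrite nth_default// size_map size_enum_ord.
by rewrite (nth_map (Ordinal kn)) ?size_enum_ord.
Qed.

Let DDC i z : `|D i z.1 * D i z.2| <= C * C.
Proof. by rewrite normrM ler_pM. Qed.

Let mDD i : measurable_fun setT (DD i).
Proof. by apply: measurable_funM; [exact: mm1|exact: mm2]. Qed.

(** Here K is a mixture, with weights wt, of Gaussian kernels of the path x, and g is
    the scalar product of D at two times. Only one coordinate and a part of the
    mixture are kept; what is dropped is
    nonnegative because the Gaussian kernels are positive semi-definite. *)
Lemma kernel_energy_ge (i0 : 'I_n) :
  (\int[mu]_u \int[nu]_z (wt0 u * expR (- (kap u * q z)) * (D i0 z.1 * D i0 z.2))%:E
   <= \int[nu]_z (K z * (g z)%:E))%E.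
Proof.
have Iw : (mu \x nu)%E.-integrable setT (h wt g).
  by apply: (Ih mwt mg _ gC) => u; rewrite wt_ge0/=.
have -> : (\int[nu]_z (K z * (g z)%:E) = \int[nu]_z \int[mu]_u h wt g (u, z))%E.
  apply: eq_integral => z _; rewrite /h /K/=.
  have mk : measurable_fun setT (fun u : measurableTypeR R => (wt u * expR (- (kap u * q z)))%:E).
    have m1 : measurable_fun setT (h wt (cst 1)) by apply: mh.
    have := measurable_fun_pair1 z m1 => m1z.
    have -> : (fun u => (wt u * expR (- (kap u * q z)))%:E) =
        (fun u => h wt (cst 1%R) (u, z)).
        by apply/funext => u; rewrite /h/= mulr1.
    exact: m1z.
  have k0 u : (0 <= (wt u * expR (- (kap u * q z)))%:E)%E by rewrite lee_fin mulr_ge0 ?expR_ge0.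
  have [g0|g0] := leP 0 (g z).
    by rewrite -ge0_integralZr.
  have -> : ((g z)%:E = - (- g z)%:E)%E by rewrite EFinN oppeK.
  rewrite muleN -ge0_integralZr//; last by rewrite lee_fin oppr_ge0 ltW.
  rewrite -integral_ge0N; last by move=> u _; rewrite mule_ge0// lee_fin oppr_ge0 ltW.
  by apply: eq_integral => u _; rewrite -EFinM -EFinN; congr EFin; ring.
rewrite -(Fubini Iw).
have I0 : (mu \x nu)%E.-integrable setT (h wt0 (DD i0)).
  by apply: (Ih mwt0 (mDD i0) _ (DDC i0)) => u; rewrite wt0_ge0/=.
apply: ge0_le_integral => //.
- by move=> u _; exact: psd.
- exact: measurable_fubini_F I0.
- exact: measurable_fubini_F Iw.
- move=> u _; rewrite -[leLHS]/(\int[nu]_z h wt0 (DD i0) (u, z))%E.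
  have Iu (f : measurableTypeR R -> R) i : (forall u, 0 <= f u) -> nu.-integrable setT (fun z => h f (DD i) (u, z)).
    move=> f0; apply: (@integrable_bounded _ _ _ nu (fun z => f u * expR (- (kap u * q z)) * (D i z.1 * D i z.2)) (f u * (C * C))).
      apply: measurable_funM; last exact: mDD.
      apply: measurable_funM => //.
      by apply: measurableT_comp => //; apply: measurableT_comp => //; exact: measurable_funM.
    move=> z; rewrite normrM; apply: ler_pM; [by []|by []| |exact: DDC].
    rewrite normrM (ger0_norm (f0 u)) (ger0_norm (expR_ge0 _)).
    rewrite ler_piMr// -expR0 ler_expR oppr_le0 mulr_ge0// /q.
    by apply: sumr_ge0 => k _; exact: sqr_ge0.
  apply: (@le_trans _ _ (\int[nu]_z h wt (DD i0) (u, z))%E).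
    rewrite -subre_ge0; last by apply: integrable_fin_num => //; exact: Iu.
    rewrite -integralB//; [|exact: Iu..].
    have P0 : (0 <= \int[nu]_z h (fun u => wt u - wt0 u)%R (DD i0) (u, z))%E.
      by apply: psd => v; rewrite subr_ge0.
    apply: (le_trans P0); rewrite le_eqVlt; apply/orP; left; apply/eqP.
    by apply: eq_integral => z _; rewrite /h/= -EFinB; congr EFin; ring.
  have -> : (\int[nu]_z h wt g (u, z) = \sum_(i < n) \int[nu]_z h wt (DD i) (u, z))%E.
    rewrite -integral_sum//; last by move=> i; exact: Iu.
    by apply: eq_integral => z _; rewrite /h/= /g mulr_sumr sumEFin.
  rewrite (bigD1 i0)//= leeDl// sume_ge0// => i _; exact: psd.
Qed.

End kernel_lower_bound.

(** * Second moments of fractional Brownian motion *)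

(** Cauchy-Schwarz *)
Lemma centered_L2_CS {R : realType} d (T : measurableType d) (P : probability T R)
    (Y Z : T -> R) : centered_L2 P Y -> centered_L2 P Z ->
  (\int[P]_w (Y w * Z w)) ^+ 2 <= \int[P]_w (Y w ^+ 2) * \int[P]_w (Z w ^+ 2).
Proof.
move=> cY cZ.
have H a b : 0 <= a ^+ 2 * \int[P]_w (Y w ^+ 2) + 2 * a * b * \int[P]_w (Y w * Z w)
    + b ^+ 2 * \int[P]_w (Z w ^+ 2).
  by rewrite -Rintegral_sqr_lin// Rintegral_ge0// => w _; exact: sqr_ge0.
have Z0 : 0 <= \int[P]_w (Z w ^+ 2) by rewrite Rintegral_ge0// => w _; exact: sqr_ge0.
move: H Z0; set A := \int[P]_w (Y w ^+ 2); set G := \int[P]_w (Y w * Z w).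
set B := \int[P]_w (Z w ^+ 2) => H; rewrite le_eqVlt => /orP[/eqP B0|B0].
  by have := H G (- ((A + 1) / 2)); rewrite -B0; nra.
have := H B (- G); rewrite (_ : _ + _ = B * (A * B - G ^+ 2)); last by ring.
by rewrite pmulr_rge0// subr_ge0.
Qed.

Section fbm_second_moments.
Context {R : realType} d (T : measurableType d) (P : probability T R).
Variables (H : R) (B : R -> T -> R).
Hypothesis fB : real_fBm P H B.
Hypothesis H0 : 0 < H.
Hypothesis H1 : H < 1.
Local Notation p := (2 * H).

Let p0 : 0 < p. Proof. by rewrite mulr_gt0. Qed.
Let p2 : p < 2. Proof. by have := H1; lra. Qed.

Let fBm_mean t : 0 <= t -> (\int[P]_w (B t w)%:E = 0)%E.
Proof. by move=> t0; have [_ _ /(_ t t0) + _] := fB; rewrite unlock. Qed.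

Let fBm_covE s t : 0 <= s -> 0 <= t ->
  (\int[P]_w (B s w * B t w)%:E = (2^-1 * (s `^ p + t `^ p - `|s - t| `^ p))%:E)%E.
Proof.
move=> s0 t0; have [_ _ _ /(_ s t s0 t0)] := fB.
rewrite covariance.unlock !expectation.unlock !fBm_mean// (ger0_norm s0) (ger0_norm t0) => <-.
by apply: eq_integral => w _; rewrite -[RHS]/(((B s w - 0) * (B t w - 0))%:E) !subr0.
Qed.

Lemma fBm_centered t : 0 <= t -> centered_L2 P (B t).
Proof.
move=> t0; have [[mB _] _ _ _] := fB.
split; [exact: mB| |exact: fBm_mean].
apply/integrableP; split; first by apply/measurable_EFinP; apply: measurable_funX; exact: mB.
rewrite (_ : (\int[P]_x _)%E = (\int[P]_w (B t w * B t w)%:E)%E).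
  by rewrite fBm_covE// ltry.
by apply: eq_integral => w _; rewrite /= ger0_norm ?sqr_ge0// expr2.
Qed.

Lemma fBm_cov s t : 0 <= s -> 0 <= t ->
  \int[P]_w (B s w * B t w) = 2^-1 * (s `^ p + t `^ p - `|s - t| `^ p).
Proof. by move=> s0 t0; rewrite /Rintegral fBm_covE. Qed.

(** The same time may occur several times in l. *)
Lemma fBm_gaussian (l : seq (R * R)) : (forall c, c \in l -> 0 <= c.2) ->
  gaussian_rv P (fun w => \sum_(c <- l) c.1 * B c.2 w).
Proof.
move=> l0; have [[_ gB] _ _ _] := fB.
pose c (i : 'I_(size l)) := nth (0, 0) l i.
have := gB (size l) (fun i => (c i).2) (fun i => (c i).1) _.
have -> : (fun w => \sum_(i < size l) (c i).1 * B (c i).2 w) =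
   (fun w => \sum_(c <- l) c.1 * B c.2 w).
  by apply/funext => w; rewrite (big_nth (0, 0)) big_mkord.
by apply => i; apply: l0; exact: mem_nth.
Qed.

Lemma fBm_cov_lin (k1 k2 l1 l2 a b c e : R) : 0 <= a -> 0 <= b -> 0 <= c -> 0 <= e ->
  \int[P]_w ((k1 * B a w + k2 * B b w) * (l1 * B c w + l2 * B e w)) =
  k1 * l1 * (2^-1 * (a `^ p + c `^ p - `|a - c| `^ p)) +
  k1 * l2 * (2^-1 * (a `^ p + e `^ p - `|a - e| `^ p)) +
  (k2 * l1 * (2^-1 * (b `^ p + c `^ p - `|b - c| `^ p)) +
  k2 * l2 * (2^-1 * (b `^ p + e `^ p - `|b - e| `^ p))).
Proof.
move=> a0 b0 c0 e0.
have I (x y : R) : 0 <= x -> 0 <= y -> P.-integrable setT (EFin \o (fun w => B x w * B y w)).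
  by move=> x0 y0; apply: centered_L2_mul; exact: fBm_centered.
have [Iac Iae Ibc Ibe] := And4 (I _ _ a0 c0) (I _ _ a0 e0) (I _ _ b0 c0) (I _ _ b0 e0).
transitivity (\int[P]_w (1 * (k1 * l1 * (B a w * B c w) + k1 * l2 * (B a w * B e w)) +
   1 * (k2 * l1 * (B b w * B c w) + k2 * l2 * (B b w * B e w)))).
  by apply: eq_Rintegral => w _; ring.
by rewrite !Rintegral_lin ?fBm_cov ?mul1r//; exact: integrable_lin.
Qed.

Lemma fBm_var_increment (k a b : R) : 0 <= a -> 0 <= b ->
  \int[P]_w ((k * B a w + (- k) * B b w) ^+ 2) = k ^+ 2 * `|a - b| `^ p.
Proof.
move=> a0 b0; under eq_Rintegral do rewrite expr2.
rewrite fBm_cov_lin// !subrr normr0 powR0 ?gt_eqF// (distrC b a); by field.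
Qed.

Variables (T1 eps : R).
Hypothesis T10 : 0 <= T1.
Hypothesis eps0 : 0 < eps.

(** Times are clamped to [0, T1], which makes the paths bounded and continuous on the
    whole line. *)
Definition clamp (t : R) : R := Num.min T1 (Num.max 0 t).

Lemma clamp_ge0 t : 0 <= clamp t.
Proof. by rewrite /clamp le_min T10 le_max lexx. Qed.

Lemma clamp_le t : clamp t <= T1.
Proof. by rewrite /clamp ge_min lexx. Qed.

Lemma clampE t : 0 <= t <= T1 -> clamp t = t.
Proof. by case/andP => t0 tT; rewrite /clamp (max_idPr t0) (min_idPr tT). Qed.

Lemma clamp_dist s t : `|clamp s - clamp t| <= `|s - t|.
Proof.
rewrite /clamp /Order.min /Order.max ler_norml; move: (ler_norm (s - t)) (ler_norm (t - s)).
rewrite (distrC t s).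
case: (ltP 0 s) => ?; case: (ltP 0 t) => ?; case: ltP => ?; case: ltP => ? ? ?; lra.
Qed.

(** Symmetric difference quotient of the clamped process, with value 0 before
    time 0 *)
Definition slope (t : R) (w : T) : R :=
  (2 * eps)^-1 * (B (clamp (t + eps)) w - (if t < eps then 0 else B (clamp (t - eps)) w)).

Lemma slopeE t : slope t = fun w => (2 * eps)^-1 * B (clamp (t + eps)) w +
  (if t < eps then 0 else - (2 * eps)^-1) * B (clamp (t - eps)) w.
Proof. by apply/funext => w; rewrite /slope; case: ifP => _; ring. Qed.

Lemma slope_centered t : centered_L2 P (slope t).
Proof. by rewrite slopeE; apply: centered_L2_lin; apply: fBm_centered; exact: clamp_ge0. Qed.

Lemma powR2_le (x : R) : 0 <= x <= 2 * eps -> (2 * eps)^-1 ^+ 2 * x `^ p <= eps `^ (p - 2).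
Proof.
case/andP => x0 x2.
have e2 : 0 < 2 * eps by rewrite mulr_gt0.
apply: (@le_trans _ _ ((2 * eps)^-1 ^+ 2 * (2 * eps) `^ p)).
  by rewrite ler_wpM2l ?sqr_ge0// ge0_ler_powR// ?nnegrE ltW.
rewrite powRM ?(ltW eps0)//.
have -> : eps `^ p = eps ^+ 2 * eps `^ (p - 2).
  rewrite -powR_mulrn ?(ltW eps0)// -powRD ?(gt_eqF eps0) ?implybT//.
  by congr (_ `^ _); ring.
have : 2 `^ p <= 2 ^+ 2 :> R by rewrite -powR_mulrn// ler_powR ?(ltW p2)// ler1n.
set x2p := 2 `^ p => h.
have -> (z : R) : (2 * eps)^-1 ^+ 2 * (x2p * (eps ^+ 2 * z)) = x2p / 4 * z.
  by field; rewrite gt_eqF.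
by rewrite ler_piMl ?powR_ge0//; lra.
Qed.

Lemma slope_var t : \int[P]_w (slope t w ^+ 2) <= eps `^ (p - 2).
Proof.
rewrite slopeE; case: ltP => te.
  under eq_Rintegral do rewrite expr2.
  rewrite fBm_cov_lin ?clamp_ge0// subrr normr0 powR0 ?gt_eqF//.
  set a := clamp _; rewrite !(mul0r, mulr0) !addr0 subr0.
  have := @powR2_le a; rewrite clamp_ge0/= /a => /(_ _).
  have -> : clamp (t + eps) <= 2 * eps.
    rewrite /clamp ge_min; apply/orP; right; rewrite ge_max.
    by apply/andP; split; have := eps0; lra.
  move=> /(_ isT); rewrite -/a; set y := a `^ p; rewrite expr2; lra.
rewrite fBm_var_increment ?clamp_ge0// powR2_le// normr_ge0/=.
rewrite (le_trans (clamp_dist _ _))// (_ : _ - _ = 2 * eps); last by ring.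
by rewrite gtr0_norm// mulr_gt0.
Qed.

Lemma eps_powE : eps `^ p = eps ^+ 2 * eps `^ (p - 2).
Proof.
rewrite -powR_mulrn ?(ltW eps0)// -powRD ?(gt_eqF eps0) ?implybT//.
by congr (_ `^ _); ring.
Qed.

Lemma slope_cov_le t s : `|\int[P]_w (slope t w * slope s w)| <= eps `^ (p - 2).
Proof.
rewrite -ler_sqr ?nnegrE ?powR_ge0// real_normK ?num_real//.
rewrite (le_trans (centered_L2_CS (slope_centered t) (slope_centered s)))// expr2.
by rewrite ler_pM ?slope_var ?Rintegral_ge0// => w _; exact: sqr_ge0.
Qed.

(** Increment of the clamped process *)
Definition incr (t s : R) (w : T) : R := B (clamp t) w - B (clamp s) w.

Lemma incrE t s : incr t s = fun w => 1 * B (clamp t) w + (- 1) * B (clamp s) w.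
Proof. by apply/funext => w; rewrite /incr mul1r mulN1r. Qed.

Lemma incr_centered t s : centered_L2 P (incr t s).
Proof. by rewrite incrE; apply: centered_L2_lin; apply: fBm_centered; exact: clamp_ge0. Qed.

Lemma incr_var t s : \int[P]_w (incr t s w ^+ 2) = `|clamp t - clamp s| `^ p.
Proof. by rewrite incrE fBm_var_increment ?clamp_ge0// expr1n mul1r. Qed.

Lemma incr_slope_sqr_le t s r :
  (\int[P]_w (incr t s w * slope r w)) ^+ 2 <= `|clamp t - clamp s| `^ p * eps `^ (p - 2).
Proof.
rewrite (le_trans (centered_L2_CS (incr_centered t s) (slope_centered r)))// incr_var.
by rewrite ler_wpM2l ?powR_ge0// slope_var.
Qed.

Lemma gaussian_incr_slope (eta a b t s : R) :
  gaussian_rv P (fun w => eta * incr t s w + (a * slope t w + b * slope s w)).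
Proof.
pose k (t : R) := if t < eps then 0 else - (2 * eps)^-1.
have := @fBm_gaussian [:: (eta, clamp t); (- eta, clamp s);
  (a * (2 * eps)^-1, clamp (t + eps)); (a * k t, clamp (t - eps));
  (b * (2 * eps)^-1, clamp (s + eps)); (b * k s, clamp (s - eps))].
have -> : (fun w => eta * incr t s w + (a * slope t w + b * slope s w)) =
  (fun w => \sum_(c <- [:: (eta, clamp t); (- eta, clamp s);
  (a * (2 * eps)^-1, clamp (t + eps)); (a * k t, clamp (t - eps));
  (b * (2 * eps)^-1, clamp (s + eps)); (b * k s, clamp (s - eps))]) c.1 * B c.2 w).
  apply/funext => w; rewrite !big_cons big_nil/= !slopeE /incr /k; ring.
apply => c; rewrite !inE.
by do 5 (case/orP => [/eqP ->|]; first exact: clamp_ge0); move=> /eqP ->; exact: clamp_ge0.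
Qed.

Lemma cos_incr_slope (eta t s : R) :
  P.-integrable setT (EFin \o (fun w => cos (eta * incr t s w) * (slope t w * slope s w))) /\
  \int[P]_w (cos (eta * incr t s w) * (slope t w * slope s w)) =
  (\int[P]_w (slope t w * slope s w) -
   eta ^+ 2 * ((\int[P]_w (incr t s w * slope t w)) * (\int[P]_w (incr t s w * slope s w))))
   * expR (- (eta ^+ 2 * `|clamp t - clamp s| `^ p) / 2).
Proof.
have cY : centered_L2 P (fun w => eta * incr t s w).
  have := centered_L2_lin eta 0 (incr_centered t s) (incr_centered t s).
  by congr centered_L2; apply/funext => w; rewrite mul0r addr0.
have [I ->] := gaussian_cos_mul cY (slope_centered t) (slope_centered s)
  (fun a b => gaussian_incr_slope eta a b t s).
split => //.
have E r : \int[P]_w (eta * incr t s w * slope r w) = eta * \int[P]_w (incr t s w * slope r w).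
  rewrite -RintegralZl//; last by apply: centered_L2_mul; [exact: incr_centered|exact: slope_centered].
  by apply: eq_Rintegral => w _; rewrite mulrA.
have E2 : \int[P]_w ((eta * incr t s w) ^+ 2) = eta ^+ 2 * `|clamp t - clamp s| `^ p.
  rewrite -incr_var -RintegralZl//; last by have [] := incr_centered t s.
  by apply: eq_Rintegral => w _; rewrite exprMn.
by rewrite !E E2; congr (_ * _); ring.
Qed.

(** The main quantity: the expected product of two slopes, weighted by the cosine of
    the increment *)
Definition cos_moment (eta t s : R) := \int[P]_w (cos (eta * incr t s w) * (slope t w * slope s w)).

Lemma cos_moment_le eta t s :
  `|cos_moment eta t s| <= eps `^ (p - 2) * (1 + eta ^+ 2 * `|clamp t - clamp s| `^ p)
   * expR (- (eta ^+ 2 * `|clamp t - clamp s| `^ p) / 2).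
Proof.
rewrite /cos_moment (cos_incr_slope eta t s).2 normrM (ger0_norm (expR_ge0 _)) ler_wpM2r ?expR_ge0//.
rewrite (le_trans (ler_normB _ _))// mulrDr mulr1 lerD ?slope_cov_le//.
rewrite normrM ger0_norm ?sqr_ge0// mulrCA ler_wpM2l ?sqr_ge0// mulrC.
rewrite -ler_sqr ?nnegrE ?mulr_ge0 ?powR_ge0// real_normK ?num_real// exprMn [leRHS]expr2.
by rewrite ler_pM ?sqr_ge0// 1?[leRHS]mulrC incr_slope_sqr_le.
Qed.

Section interior.
Variables t s : R.
Hypothesis ht : eps <= t <= T1 - eps.
Hypothesis hs : eps <= s <= T1 - eps.

Let ct : clamp t = t. Proof. by apply: clampE; move: ht eps0; lra. Qed.
Let cs : clamp s = s. Proof. by apply: clampE; move: hs eps0; lra. Qed.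
Let slopet : slope t = fun w => (2 * eps)^-1 * B (t + eps) w + (- (2 * eps)^-1) * B (t - eps) w.
Proof.
rewrite slopeE !clampE; [|move: ht eps0; lra..].
by rewrite ltNge; have /andP[-> _] := ht.
Qed.
Let slopes : slope s = fun w => (2 * eps)^-1 * B (s + eps) w + (- (2 * eps)^-1) * B (s - eps) w.
Proof.
rewrite slopeE !clampE; [|move: hs eps0; lra..].
by rewrite ltNge; have /andP[-> _] := hs.
Qed.

Let tpm : 0 <= t + eps /\ 0 <= t - eps. Proof. by move: ht eps0; lra. Qed.
Let spm : 0 <= s + eps /\ 0 <= s - eps. Proof. by move: hs eps0; lra. Qed.

Lemma slope_cov_ge :
  eps `^ (p - 2) / 8 - `|t - s| `^ p / (4 * eps ^+ 2) <= \int[P]_w (slope t w * slope s w).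
Proof.
have [t1 t2] := tpm; have [s1 s2] := spm.
rewrite slopet slopes fBm_cov_lin//.
have -> : t + eps - (s + eps) = t - s by ring.
have -> : t - eps - (s - eps) = t - s by ring.
have -> : t + eps - (s - eps) = t - s + 2 * eps by ring.
have -> : t - eps - (s + eps) = t - s - 2 * eps by ring.
have : eps `^ p <= `|t - s + 2 * eps| `^ p + `|t - s - 2 * eps| `^ p.
  have [r0|r0] := leP 0 (t - s).
    rewrite -[leLHS]addr0 lerD ?powR_ge0// ge0_ler_powR ?nnegrE ?(ltW p0) ?(ltW eps0)//.
    by rewrite (le_trans _ (ler_norm _))//; move: eps0; lra.
  rewrite -[leLHS]add0r lerD ?powR_ge0// ge0_ler_powR ?nnegrE ?(ltW p0) ?(ltW eps0)//.
  by rewrite -normrN (le_trans _ (ler_norm _))//; move: eps0; lra.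
rewrite eps_powE.
set a := _ `^ p; set b := _ `^ p; set c := _ `^ p; set e := _ `^ p.
set u := _ `^ p; set v := _ `^ p; set E := eps `^ _ => h.
rewrite -subr_ge0.
rewrite [leRHS](_ : _ = (8 * eps ^+ 2)^-1 * (a + b - eps ^+ 2 * E)).
  by apply: mulr_ge0; [rewrite invr_ge0 mulr_ge0// sqr_ge0|rewrite subr_ge0].
by field; rewrite gt_eqF.
Qed.

Lemma incr_slopeE :
  \int[P]_w (incr t s w * slope t w) = (`|t - s + eps| `^ p - `|t - s - eps| `^ p) / (4 * eps) /\
  \int[P]_w (incr t s w * slope s w) = (`|t - s + eps| `^ p - `|t - s - eps| `^ p) / (4 * eps).
Proof.
have [t1 t2] := tpm; have [s1 s2] := spm.
have t0 : 0 <= t by move: eps0 ht; lra.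
have s0 : 0 <= s by move: eps0 hs; lra.
rewrite incrE ct cs slopet slopes !fBm_cov_lin//.
have -> : t - (t + eps) = - eps by ring.
have -> : t - (t - eps) = eps by ring.
have -> : s - (s + eps) = - eps by ring.
have -> : s - (s - eps) = eps by ring.
rewrite -[s - (t + eps)]opprB -[s - (t - eps)]opprB !normrN.
have -> : t + eps - s = t - s + eps by ring.
have -> : t - eps - s = t - s - eps by ring.
have -> : t - (s + eps) = t - s - eps by ring.
have -> : t - (s - eps) = t - s + eps by ring.
by split; field; rewrite gt_eqF.
Qed.

(** For |t - s| > eps this is Cauchy-Schwarz; for |t - s| <= eps, it follows from
    (1 + r)^p - (1 - r)^p <= (1 + r)^2 - (1 - r)^2 = 4 r for 0 <= r <= 1. *)
Lemma incr_slope_small : (\int[P]_w (incr t s w * slope t w)) ^+ 2 <=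
  eps `^ (p - 2) ^+ 2 * (t - s) ^+ 2.
Proof.
have [re|re] := leP `|t - s| eps; last first.
  rewrite (le_trans (incr_slope_sqr_le t s t))// ct cs mulrC expr2 -mulrA ler_wpM2l ?powR_ge0//.
  have -> : `|t - s| `^ p = `|t - s| `^ (p - 2) * (t - s) ^+ 2.
    have n0 : 0 < `|t - s| by rewrite (lt_trans eps0).
    rewrite -[(t - s) ^+ 2](real_normK (num_real _)) -powR_mulrn// -powRD ?(gt_eqF n0) ?implybT//.
    by congr (_ `^ _); ring.
  rewrite ler_wpM2r ?sqr_ge0// -[p - 2]opprK !(powRN _ (- (p - 2))).
  rewrite lef_pV2 ?posrE ?powR_gt0 ?(lt_trans eps0 re)//.
  by rewrite ge0_ler_powR ?nnegrE ?(ltW eps0) ?(ltW re)//; move: p2; lra.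
rewrite incr_slopeE.1.
have hr (r : R) : 0 <= r <= eps -> `|r + eps| `^ p - `|r - eps| `^ p <= 4 * eps * (eps `^ (p - 2) * r) /\
     0 <= `|r + eps| `^ p - `|r - eps| `^ p.
  case/andP => r0 re'.
  have e0 := ltW eps0; have en0 : eps != 0 by rewrite gt_eqF.
  split; last first.
    rewrite subr_ge0 ge0_ler_powR ?nnegrE ?(ltW p0)//.
    rewrite ler_norml; rewrite ger0_norm ?addr_ge0//; apply/andP; split; lra.
  pose rho := r / eps.
  have rhoE : r = eps * rho by rewrite /rho mulrC divfK.
  have rho0 : 0 <= rho by rewrite divr_ge0.
  have rho1 : rho <= 1 by rewrite ler_pdivrMr ?mul1r.
  have -> : `|r + eps| = eps * (1 + rho).
    by rewrite ger0_norm ?addr_ge0// rhoE; ring.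
  have -> : `|r - eps| = eps * (1 - rho).
    by rewrite distrC ger0_norm ?subr_ge0// rhoE; ring.
  rewrite !powRM ?subr_ge0 ?addr_ge0//.
  have h1 : (1 + rho) `^ p <= (1 + rho) ^+ 2.
    by rewrite -powR_mulrn ?addr_ge0// ler_powR ?(ltW p2)// lerDl.
  have h2 : (1 - rho) ^+ 2 <= (1 - rho) `^ p.
    have [->|n1] := eqVneq rho 1; first by rewrite subrr expr0n/= powR_ge0.
    rewrite -powR_mulrn ?subr_ge0// ger_powR ?(ltW p2)// subr_gt0 lt_neqAle n1 rho1/=.
    by rewrite gerBl.
  rewrite -mulrBr eps_powE rhoE -mulrA.
  rewrite (_ : 4 * _ = eps ^+ 2 * (eps `^ (p - 2) * (4 * rho))); last by ring.
  by rewrite -[leLHS]mulrA ler_pM2l ?exprn_gt0// ler_wpM2l ?powR_ge0//; lra.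
rewrite expr_div_n ler_pdivrMr ?exprn_gt0 ?mulr_gt0//.
rewrite -!exprMn.
have [r0|r0] := leP 0 (t - s).
  have [|h1 h2] := hr (t - s); first by rewrite r0 (le_trans (ler_norm _) re).
  by rewrite ler_sqr ?nnegrE ?(le_trans h2)//; lra.
have [|h1 h2] := hr (s - t); first by rewrite -[s - t]opprB oppr_ge0 (ltW r0) -ltr0_norm.
rewrite -[t - s]opprB -sqrrN -[leRHS]sqrrN.
have -> : - (s - t) + eps = - (s - t - eps) by ring.
have -> : - (s - t) - eps = - (s - t + eps) by ring.
rewrite !normrN opprB.
by rewrite ler_sqr ?nnegrE; lra.
Qed.

(** Sharper lower bound away from the ends of the interval: the first term dominates
    when |t - s| is small. *)
Lemma cos_moment_ge eta : (eps `^ (p - 2) / 8 - `|t - s| `^ p / (4 * eps ^+ 2)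
   - eta ^+ 2 * (eps `^ (p - 2) ^+ 2 * (t - s) ^+ 2)) * expR (- (eta ^+ 2 * `|t - s| `^ p) / 2)
  <= cos_moment eta t s.
Proof.
rewrite /cos_moment (cos_incr_slope eta t s).2 ct cs ler_wpM2r ?expR_ge0//.
have e := incr_slope_small; have [e1 e2] := incr_slopeE.
by rewrite e1 in e; rewrite e2 e1 -expr2 lerB ?slope_cov_ge// ler_wpM2l ?sqr_ge0.
Qed.

End interior.

End fbm_second_moments.

Lemma clamp_id {R : realType} (T t : R) : 0 <= t <= T -> clamp (T + 1) t = t.
Proof. by move=> ?; apply: clampE; lra. Qed.

(** * Deterministic estimate of the cosine energy *)

Section decay.
Context {R : realType}.
Local Notation mu := (@lebesgue_measure R).

(** A constant from the bound y^8 <= 16^8 exp (y / 2) *)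
Definition decay_const : R := 6 * 16 ^+ 8.

(** exp (- s^p / 2) decays at least like s^(-4), since s <= (s^p)^2 for s >= 1. *)
Lemma powR_exp_decay (p s : R) : 2^-1 < p -> 0 <= s ->
  (1 + s `^ p + s ^+ 2) * (1 + s ^+ 2) <= decay_const * expR (s `^ p / 2).
Proof.
move=> p2 s0; set y := s `^ p.
have y0 : 0 <= y by exact: powR_ge0.
have e1 : 1 <= expR (y / 2) by rewrite -expR0 ler_expR divr_ge0.
have [s1|s1] := leP s 1.
  have y1 : y <= 1.
    have <- : 1 `^ p = 1 :> R by rewrite powR1.
    by rewrite ge0_ler_powR ?nnegrE//; lra.
  have q1 : s ^+ 2 <= 1 by rewrite expr_le1.
  have q0 := sqr_ge0 s.
  apply: (@le_trans _ _ 6); first by nra.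
  by rewrite -[leLHS]mulr1 ler_pM// /decay_const; lra.
have y1 : 1 <= y by rewrite -(powRr0 s) ler_powR ?(ltW s1)//; lra.
have sy : s <= y ^+ 2.
  rewrite /y -powR_mulrn ?powR_ge0// -powRrM -[leLHS]powRr1//.
  by rewrite ler_powR ?(ltW s1)//; lra.
have s4 : s ^+ 2 <= y ^+ 4.
  by rewrite (_ : y ^+ 4 = (y ^+ 2) ^+ 2) ?ler_sqr ?nnegrE ?sqr_ge0// -exprM.
have y4 : y <= y ^+ 4 by rewrite -[leLHS]expr1 ler_weXn2l.
have y41 : 1 <= y ^+ 4 by rewrite exprn_ege1.
have ye : y ^+ 8 <= 16 ^+ 8 * expR (y / 2).
  have -> : expR (y / 2) = expR (y / 16) ^+ 8.
    by rewrite -expRM_natl; congr expR; lra.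
  rewrite -exprMn lerXn2r ?nnegrE ?mulr_ge0 ?expR_ge0//.
  have := expR_ge1Dx (y / 16); lra.
have y8 : y ^+ 8 = y ^+ 4 * y ^+ 4 by rewrite -exprD.
rewrite /decay_const -mulrA (le_trans _ (ler_wpM2l _ ye))// y8.
have := sqr_ge0 s; move: s4 y4 y41; set a := y ^+ 4; set b := s ^+ 2 => *.
rewrite (@le_trans _ _ ((3 * a) * (2 * a)))//; last by lra.
by apply: ler_pM; lra.
Qed.

Lemma powR_exp_decay' (p s c : R) : 2^-1 < p -> 0 <= s -> 0 <= c <= 1 + s `^ p + s ^+ 2 ->
  c * expR (- (s `^ p / 2)) <= decay_const / (1 + s ^+ 2).
Proof.
move=> p2 s0 /andP[c0 cs]; have h := powR_exp_decay p2 s0.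
have q0 : 0 < 1 + s ^+ 2 by rewrite ltr_pwDl// sqr_ge0.
rewrite ler_pdivlMr// expRN mulrAC ler_pdivrMr ?expR_gt0//.
by rewrite (le_trans _ h)// ler_wpM2r// ltW.
Qed.

(** Cauchy profile of width th, the integrable majorant used across the diagonal *)
Definition cauchy_density (th r : R) : R := (1 + (r / th) ^+ 2)^-1.

Lemma cauchy_density_bound th r : 0 <= cauchy_density th r <= 1.
Proof.
have h : 1 <= 1 + (r / th) ^+ 2 by rewrite lerDl sqr_ge0.
by rewrite invr_ge0 (le_trans _ h)//= invf_le1// (lt_le_trans _ h).
Qed.

Lemma continuous_cauchy_density th : continuous (cauchy_density th).
Proof.
move=> s; apply: cvgV; first by rewrite gt_eqF// ltr_pwDl// sqr_ge0.
apply: cvgD; first exact: cvg_cst.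
apply: (@continuous_comp _ _ _ (fun s : R => s / th) (fun y : R => y ^+ 2)).
  exact: cvgMr_tmp.
exact: exprn_continuous.
Qed.

Lemma integral_cauchy_density (th t T : R) : 0 < th -> 0 < T ->
  (\int[mu]_(s in `[0%R, T]) (cauchy_density th (t - s))%:E <= (pi * th)%:E)%E.
Proof.
move=> th0 T0.
pose F s := th * atan ((s - t) / th).
have th1 : th != 0 by rewrite gt_eqF.
have dF s : is_derive s (1 : R) F (cauchy_density th (t - s)).
  apply: is_derive_eq.
  rewrite /cauchy_density /GRing.scale/=.
  rewrite -[(t - s)]opprB mulNr sqrrN.
  set z := (_ + _)^-1; rewrite mulr0 add0r subr0 mulr1 mulrC.
  by rewrite -mulrA mulVf ?mulr1.
have cF : continuous F.
  by move=> x; apply/differentiable_continuous/derivable1_diffP; have [] := dF x.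
have cc : continuous (fun s => cauchy_density th (t - s) : R).
  move=> s; apply: (@continuous_comp _ _ _ (fun s : R => t - s) (cauchy_density th)).
    by apply: cvgB; [exact: cvg_cst|exact: cvg_id].
  exact: continuous_cauchy_density.
rewrite (@continuous_FTC2 _ _ F)//.
- rewrite -EFinB lee_fin /F -mulrBr mulrC ler_wpM2r ?(ltW th0)//.
  have := atan_ltpi2 ((T - t) / th); have := atan_gtNpi2 ((0 - t) / th); lra.
- exact: continuous_subspaceT.
- split.
  + by move=> x _; have [] := dF x.
  + by apply: cvg_at_right_filter; exact: cF.
  + by apply: cvg_at_left_filter; exact: cF.
- by move=> x _; rewrite derive1E; have [_ ->] := dF x.
Qed.

End decay.

Section square.
Context {R : realType}.
Local Notation mu := (@lebesgue_measure R).
Variables (T th : R).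
Hypothesis T0 : 0 < T.
Hypothesis th0 : 0 < th.
Local Notation m := (itv_measure 0 T).
Local Notation nu := (finite_product m m).
Local Notation S2 := (measurableTypeR R * measurableTypeR R)%type.

Lemma itv_measureE (A : set (measurableTypeR R)) : m A = mu (A `&` `[0, T]).
Proof. by []. Qed.

(** Almost every point for the product measure lies in the square [0, T]^2. *)
Lemma ae_square : {ae nu, forall z, (0 <= z.1 <= T) /\ (0 <= z.2 <= T)}.
Proof.
pose I := `[0, T]%classic : set (measurableTypeR R).
have mI : measurable I by exact: measurable_itv.
have mC : m (~` I) = 0 by rewrite itv_measureE setICl measure0.
exists ((~` I) `*` setT `|` setT `*` (~` I)); split.
- by apply: measurableU; apply: measurableX => //; exact: measurableC.
- rewrite measureU0//=; [| apply: measurableX => //; exact: measurableC..|].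
    transitivity (m (~` I) * m setT)%E; last by rewrite mC mul0e.
    by apply: product_measure1E => //; exact: measurableC.
  transitivity (m setT * m (~` I))%E; last by rewrite mC mule0.
  by apply: product_measure1E => //; exact: measurableC.
- move=> z /= nz; apply: contrapT => /not_orP[n1 n2]; apply: nz.
  split; apply: contrapT => h; [apply: n1|apply: n2]; split => //= h'; exact: h.
Qed.

(** Cauchy profile of the distance to the diagonal *)
Definition strip_density (z : S2) : R :=
  cauchy_density th (z.1 - z.2).

Lemma measurable_strip_density : measurable_fun setT strip_density.
Proof.
apply: measurableT_comp; last exact: measurable_funB.
by apply: continuous_measurable_fun; exact: continuous_cauchy_density.
Qed.

Lemma strip_density_ge0 z : 0 <= strip_density z.
Proof. by have /andP[] := cauchy_density_bound th (z.1 - z.2). Qed.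

Lemma integral_strip_density (A : set (measurableTypeR R)) : measurable A ->
  (\int[nu]_z (\1_A z.1 * strip_density z)%:E <= m A * (pi * th)%:E)%E /\
  (\int[nu]_z (\1_A z.2 * strip_density z)%:E <= m A * (pi * th)%:E)%E.
Proof.
move=> mA.
have mA1 : measurable_fun setT (\1_A : measurableTypeR R -> R) by exact: measurable_indic.
have mA2 : measurable_fun setT (EFin \o (\1_A : measurableTypeR R -> R)) by exact/measurable_EFinP.
have A0 y : (0 <= (EFin \o (\1_A : measurableTypeR R -> R)) y)%E by rewrite lee_fin.
have mcd (t : R) : measurable_fun setT (fun s : R => cauchy_density th (t - s)).
  apply: measurableT_comp; last exact: measurable_funB.
  by apply: continuous_measurable_fun; exact: continuous_cauchy_density.
have inner (t : R) : (\int[m]_s (cauchy_density th (t - s))%:E <= (pi * th)%:E)%E.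
  rewrite integral_itv_measure; first exact: integral_cauchy_density.
  by apply/measurable_EFinP; exact: mcd.
have mf (g : S2 -> measurableTypeR R) : measurable_fun setT g ->
    measurable_fun setT (fun z => (\1_A (g z) * strip_density z)%:E).
  move=> mg; apply/measurable_EFinP; apply: measurable_funM.
    exact: (measurableT_comp mA1 mg).
  exact: measurable_strip_density.
have f0 (g : S2 -> measurableTypeR R) z : (0 <= (\1_A (g z) * strip_density z)%:E)%E.
  by rewrite lee_fin mulr_ge0// strip_density_ge0.
have pith : 0 <= pi * th by rewrite mulr_ge0 ?pi_ge0// ltW.
have fin (h : R -> R -> R) : (forall t, (\int[m]_s (h t s)%:E <= (pi * th)%:E)%E) ->
   (forall t s, 0 <= h t s) -> (forall t, measurable_fun setT (h t)) ->
   measurable_fun setT (fun t => \int[m]_s (\1_A t * h t s)%:E)%E ->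
   (\int[m]_t \int[m]_s (\1_A t * h t s)%:E <= m A * (pi * th)%:E)%E.
  move=> ih h0 mh mi.
  have -> : (m A = \int[m]_t (\1_A t)%:E)%E by rewrite integral_indic// setIT.
  rewrite -ge0_integralZr//.
  apply: ge0_le_integral => //.
  - by move=> t _; apply: integral_ge0 => s _; rewrite lee_fin mulr_ge0.
  - by apply: emeasurable_funM.
  - move=> t _; under eq_integral do rewrite EFinM.
    rewrite ge0_integralZl//; first by rewrite lee_wpmul2l.
    + by apply/measurable_EFinP; exact: mh.
    + by move=> s _; rewrite lee_fin.
split.
- have E := @fubini_tonelli1 _ _ (measurableTypeR R) (measurableTypeR R) R m m _ (mf _ measurable_fst) (f0 fst).
  apply: (@le_trans _ _ (\int[m]_t \int[m]_s (\1_A t * cauchy_density th (t - s))%:E)%E).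
    by rewrite le_eqVlt; apply/orP; left; apply/eqP; exact: E.
  apply: fin => //.
  + by move=> t s; have /andP[] := cauchy_density_bound th (t - s).
  + exact: (@measurable_fun_fubini_tonelli_F _ _ (measurableTypeR R) (measurableTypeR R) R m _ (mf _ measurable_fst) (f0 fst)).
- have E := @fubini_tonelli2 _ _ (measurableTypeR R) (measurableTypeR R) R m m _ (mf _ measurable_snd) (f0 snd).
  have cs t s : cauchy_density th (s - t) = cauchy_density th (t - s) :> R.
    by rewrite /cauchy_density -opprB mulNr sqrrN.
  apply: (@le_trans _ _ (\int[m]_t \int[m]_s (\1_A t * cauchy_density th (t - s))%:E)%E).
    rewrite le_eqVlt; apply/orP; left; apply/eqP; rewrite (E : _ = _).
    by apply: eq_integral => t _; apply: eq_integral => s _; rewrite /strip_density/= cs.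
  apply: fin => //.
  + by move=> t s; have /andP[] := cauchy_density_bound th (t - s).
  + have := @measurable_fun_fubini_tonelli_F _ _ (measurableTypeR R) (measurableTypeR R) R m _ (mf _ measurable_fst) (f0 fst).
    exact.
Qed.

(** The strip t <= s <= t + th with e <= t <= T - th, where the energy density is
    bounded below by a positive constant *)
Definition strip (e : R) : set (S2) :=
  [set z | e <= z.1 <= T - th /\ 0 <= z.2 - z.1 <= th].

Lemma measurable_strip e : measurable (strip e).
Proof.
have m1 : measurable_fun setT (fun z : S2 => z.2 - z.1).
  exact: measurable_funB.
have i1 := m1 measurableT `[0, th]%classic (measurable_itv _).
have i2 := @measurable_fst _ _ (measurableTypeR R) (measurableTypeR R) measurableT `[e, T - th]%classic (measurable_itv _).
have -> : strip e = (setT `&` (fun z : S2 => z.2 - z.1) @^-1` `[0, th]%classic)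
   `&` (setT `&` fst @^-1` `[e, T - th]%classic).
  apply/seteqP; split => z /=; rewrite !in_itv/= /strip/=; first by move=> [-> ->].
  by move=> [[_ ?] [_ ?]].
exact: measurableI.
Qed.

Lemma strip_measure (e : R) : 0 <= e -> e <= T - th ->
  ((th * (T - th - e))%:E <= nu (strip e))%E.
Proof.
move=> e0 eT.
have [I [IE mI]] : exists I : set (measurableTypeR R), I = `[e, T - th]%classic /\ measurable I.
  by exists `[e, T - th]%classic; split => //; exact: measurable_itv.
have mi : measurable_fun setT (EFin \o (\1_I : measurableTypeR R -> R)).
  by apply/measurable_EFinP; exact: measurable_indic.
have E : nu (strip e) = (\int[m]_t m (xsection (strip e) t))%E by [].
have -> : ((th * (T - th - e))%:E = \int[m]_t (th%:E * (\1_I t)%:E))%E.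
  rewrite ge0_integralZl// ?lee_fin ?(ltW th0)//.
  have -> : (\int[m]_x (\1_I x)%:E)%E = m I by rewrite integral_indic// setIT.
  rewrite itv_measureE EFinM; congr (_ * _)%E.
  rewrite setIidl; last first.
    by rewrite IE => t /=; rewrite !in_itv/=; move: th0 e0; lra.
  rewrite IE lebesgue_measure_itv/= lte_fin; case: ltP => [//|]; rewrite -?EFinB//.
  by move=> Te; congr EFin; lra.
rewrite E; apply: ge0_le_integral => //.
- by move=> t _; rewrite mule_ge0// lee_fin// ltW.
- exact: measurable_funeM.
- by apply: measurable_fun_xsection; exact: measurable_strip.
- move=> t _; rewrite indicE; case: (boolP (t \in _)) => [|_]; last by rewrite mule0.
  rewrite inE IE/= in_itv/= mule1 => te.
  have -> : xsection (strip e) t = `[t, t + th]%classic.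
    apply/seteqP; split => s; rewrite /xsection/= in_itv/=.
      by rewrite inE /strip/= => -[_]; lra.
    by rewrite inE /strip/=; move: te; lra.
  rewrite itv_measureE setIidl; last first.
    by move=> s /=; rewrite !in_itv/=; move: te e0; lra.
  by rewrite lebesgue_measure_itv/= lte_fin ltrDl th0 -EFinB addrAC subrr add0r.
Qed.

End square.

(** Below, th = q eps is the width of the strip, E = eps^(p - 2) the order of the
    variance of a slope, sg = |r| / th and y = sg^p. *)
Section pointwise_bounds.
Context {R : realType}.
Variables (p eps q eta2 : R).
Hypothesis p1 : 2^-1 < p.
Hypothesis eps0 : 0 < eps.
Hypothesis q0 : 0 < q.
Local Notation th := (q * eps).
Local Notation E := (eps `^ (p - 2)).
Local Notation K := (@decay_const R).
Hypothesis a2 : 2 <= eta2 * th `^ p.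
Hypothesis a16 : eta2 * th `^ p <= 16.

Let th0 : 0 < th. Proof. exact: mulr_gt0. Qed.

Variable r : R.
Let sg := `|r| / th.
Let y := sg `^ p.
Let sg0 : 0 <= sg. Proof. by rewrite divr_ge0// ltW. Qed.
Let y0 : 0 <= y. Proof. exact: powR_ge0. Qed.

Let vE : `|r| `^ p = th `^ p * y.
Proof. by rewrite /y -powRM ?(ltW th0)// /sg mulrC divfK// gt_eqF. Qed.

Let WE : cauchy_density th r = (1 + sg ^+ 2)^-1.
Proof. by rewrite /cauchy_density /sg !expr_div_n real_normK ?num_real. Qed.

Let e2 : expR (- (eta2 * `|r| `^ p) / 2) <= expR (- (y / 2)) * expR (- (eta2 * `|r| `^ p) / 4).
Proof.
rewrite -expRD ler_expR vE mulrA; move: y0 a2; set a := eta2 * _.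
by move: y => z *; nra.
Qed.

Let e1 : expR (- (eta2 * `|r| `^ p) / 2) <= expR (- (y / 2)).
Proof.
rewrite ler_expR vE mulrA; move: y0 a2; set a := eta2 * _.
by move: y => z *; nra.
Qed.

(** General lower bound, used when one of the two times is within eps of 0 *)
Lemma boundary_bound : - (E * (4 * K * cauchy_density th r)) <=
  - (E * (1 + eta2 * `|r| `^ p) * expR (- (eta2 * `|r| `^ p) / 2)).
Proof.
rewrite lerN2 -mulrA ler_wpM2l ?powR_ge0//.
have h : 1 * expR (- (y / 2)) <= K * cauchy_density th r.
  by rewrite WE; apply: powR_exp_decay' => //; rewrite -/y ler01/= -addrA lerDl addr_ge0// sqr_ge0.
rewrite -mulrA (le_trans _ (ler_wpM2l _ h))// mul1r.
have e3 := expR_ge1Dx (eta2 * `|r| `^ p / 4).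
have x0 : 0 <= eta2 * `|r| `^ p by rewrite vE mulrA mulr_ge0//; move: a2; lra.
apply: (@le_trans _ _ (4 * expR (eta2 * `|r| `^ p / 4) * (expR (- (y / 2)) * expR (- (eta2 * `|r| `^ p) / 4)))).
  by rewrite ler_pM ?expR_ge0//; [move: x0; lra|move: x0 e3; lra].
rewrite mulrCA -!mulrA -expRD (_ : _ + _ = 0); last by lra.
by rewrite expR0 mulr1 mulrC.
Qed.

(** Away from 0 the negative part carries a factor that vanishes with q. *)
Lemma interior_bound (M : R) : 0 <= M <= 1 -> 1 - `|r| `^ p / (4 * th `^ p) <= M ->
  E * ((if `|r| <= th then 3 / 32 * expR (- 8) else 0) - (q `^ p / 4 + 16 * q `^ (2 - p)) * K * cauchy_density th r)
  <= M * ((E / 8 - `|r| `^ p / (4 * eps ^+ 2) - eta2 * (E ^+ 2 * r ^+ 2)) * expR (- (eta2 * `|r| `^ p) / 2)).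
Proof.
case/andP => M0 M1 hM.
have := e1; set e := expR (- (eta2 * _) / 2) => e1'.
have E0 : 0 < E by exact: powR_gt0.
have epsE : eps `^ p = eps ^+ 2 * E.
  rewrite -powR_mulrn ?(ltW eps0)// -powRD ?(gt_eqF eps0) ?implybT//.
  by congr (_ `^ _); ring.
have thE : th `^ p = q `^ p * (eps ^+ 2 * E) by rewrite powRM ?ltW// epsE.
have thp0 : 0 < th `^ p by exact: powR_gt0.
have qE : q ^+ 2 = q `^ p * q `^ (2 - p).
  rewrite -powR_mulrn ?(ltW q0)// -powRD ?(gt_eqF q0) ?implybT//.
  by congr (_ `^ _); ring.
have t1 : `|r| `^ p / (4 * eps ^+ 2) = E * (q `^ p / 4 * y).
  by rewrite vE thE; field; rewrite gt_eqF.
have t2 : eta2 * (E ^+ 2 * r ^+ 2) = E * (eta2 * th `^ p * q `^ (2 - p) * sg ^+ 2).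
  rewrite thE /sg expr_div_n real_normK ?num_real// exprMn qE.
  field.
  by rewrite !gt_eqF// powR_gt0.
rewrite t1 t2 -!mulrBr -[X in _ <= M * X]mulrA [X in _ <= X]mulrCA ler_pM2l//.
have q1 : 0 <= q `^ p by exact: powR_ge0.
have q2 : 0 <= q `^ (2 - p) by exact: powR_ge0.
have h1 : y * expR (- (y / 2)) <= K * cauchy_density th r.
  rewrite WE; apply: powR_exp_decay' => //; rewrite -/y y0/=.
  by have := sqr_ge0 sg; lra.
have h2 : sg ^+ 2 * expR (- (y / 2)) <= K * cauchy_density th r.
  rewrite WE; apply: powR_exp_decay' => //; rewrite -/y sqr_ge0/=.
  by have := y0; lra.
have ee0 : 0 <= e by exact: expR_ge0.
have h3 : (q `^ p / 4 * y + eta2 * th `^ p * q `^ (2 - p) * sg ^+ 2) * e <=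
    (q `^ p / 4 + 16 * q `^ (2 - p)) * K * cauchy_density th r.
  have k1 : y * e <= K * cauchy_density th r by rewrite (le_trans _ h1)// ler_wpM2l.
  have k2 : sg ^+ 2 * e <= K * cauchy_density th r by rewrite (le_trans _ h2)// ler_wpM2l// sqr_ge0.
  have gen (A KW yy s2 aa b : R) : 0 <= A -> 0 <= aa <= 16 -> 0 <= b -> 0 <= s2 -> yy * e <= KW -> s2 * e <= KW ->
      (A * yy + aa * b * s2) * e <= (A + 16 * b) * KW.
    move=> A0 /andP[aa0 aa16] b0 s20 ye se.
    rewrite mulrDl mulrDl lerD//; first by rewrite -mulrA ler_wpM2l.
    rewrite -mulrA ler_pM//; [exact: mulr_ge0|exact: mulr_ge0|exact: ler_wpM2r].
  rewrite -[leRHS]mulrA; apply: gen => //; [exact: divr_ge0| |exact: sqr_ge0].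
  by rewrite a16 andbT; move: a2; lra.
have y1 : 0 <= q `^ p / 4 * y + eta2 * th `^ p * q `^ (2 - p) * sg ^+ 2.
  rewrite addr_ge0//; first by rewrite mulr_ge0// divr_ge0.
  by rewrite mulr_ge0 ?sqr_ge0// mulr_ge0//; move: a2; lra.
move: h3 y1; set Z1 := q `^ p / 4 * y; set Z2 := _ * sg ^+ 2.
set D := _ * K * _ => h3 y1.
rewrite (_ : 8^-1 - Z1 - Z2 = 8^-1 - (Z1 + Z2)); last by ring.
rewrite mulrBl mulrBr lerB//; last first.
  by rewrite (le_trans _ h3)// ler_piMl// mulr_ge0.
case: ifPn => [rth|_]; last by rewrite mulr_ge0// mulr_ge0.
have sg1 : sg <= 1 by rewrite ler_pdivrMr// mul1r.
have y11 : y <= 1.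
  have <- : 1 `^ p = 1 :> R by rewrite powR1.
  by rewrite /y ge0_ler_powR ?nnegrE//; move: p1; lra.
have M34 : 3 / 4 <= M.
  rewrite (le_trans _ hM)// vE (_ : th `^ p * y / (4 * th `^ p) = y / 4); last by field; rewrite gt_eqF.
  by move: y11; lra.
have e8 : expR (- 8) <= e.
  rewrite ler_expR vE mulrA; move: a16 a2 y0 y11; set a := eta2 * _; move: y => z *; nra.
rewrite (_ : 3 / 32 = 3 / 4 * 8^-1); last by field.
by rewrite -mulrA ler_pM// ?mulr_ge0 ?expR_ge0// mulrC [leRHS]mulrC ler_wpM2r.
Qed.

End pointwise_bounds.

Section energy_bound.
Context {R : realType}.
Local Notation K := (@decay_const R).
Variables (p T : R).
Hypothesis p1 : 2^-1 < p.
Hypothesis p2 : p < 2.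
Hypothesis T0 : 0 < T.
Local Notation nu := (finite_product (itv_measure 0 T) (itv_measure 0 T)).
Local Notation S2 := (measurableTypeR R * measurableTypeR R)%type.

Lemma powR_small (dl : R) : 0 < dl -> exists q : R, [/\ 0 < q, q <= 1 & q `^ p / 4 + 16 * q `^ (2 - p) <= dl].
Proof.
move=> dl0; have p0 : 0 < p by move: p1; lra.
have p3 : 0 < 2 - p by rewrite subr_gt0.
pose r := Num.min 1 (dl / 17).
have r0 : 0 < r by rewrite lt_min ltr01 divr_gt0.
have r1 : r <= 1 by rewrite ge_min lexx.
have rd : r <= dl / 17 by rewrite ge_min lexx orbT.
have key x : 0 < x -> (r `^ x^-1) `^ x = r.
  by move=> x0; rewrite -powRrM mulVf ?gt_eqF// powRr1 ?ltW.
exists (Num.min (r `^ p^-1) (r `^ (2 - p)^-1)); split.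
- by rewrite lt_min !powR_gt0.
- rewrite ge_min; apply/orP; left.
  have <- : 1 `^ p^-1 = 1 :> R by rewrite powR1.
  by rewrite ge0_ler_powR ?nnegrE ?(ltW r0)// invr_ge0 ltW.
- set q := Num.min _ _.
  have q0 : 0 <= q by rewrite le_min !powR_ge0.
  have h1 : q `^ p <= r.
    by rewrite -[leRHS](key p)// ge0_ler_powR ?nnegrE ?powR_ge0 ?(ltW p0)// ge_min lexx.
  have h2 : q `^ (2 - p) <= r.
    by rewrite -[leRHS](key (2 - p))// ge0_ler_powR ?nnegrE ?powR_ge0 ?(ltW p3)// ge_min lexx orbT.
  move: rd r0; lra.
Qed.

Let K0 : 0 < K. Proof. by rewrite /decay_const; lra. Qed.

Let mle (e : R) : 0 <= e -> (itv_measure 0 T `]-oo, e[%classic <= e%:E)%E.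
Proof.
move=> e0; rewrite itv_measureE.
apply: (@le_trans _ _ (@lebesgue_measure R `[0, e]%classic)).
  apply: le_measure; rewrite ?inE//.
    by apply: measurableI; exact: measurable_itv.
  by move=> t [] /=; rewrite !in_itv/=; lra.
by rewrite lebesgue_measure_itv/= lte_fin; case: ltP => //= _; rewrite -EFinB subr0.
Qed.

Let mT : (itv_measure 0 T setT = T%:E)%E.
Proof. by rewrite itv_measureE setTI lebesgue_measure_itv/= lte_fin T0 -EFinB subr0. Qed.

(** A density Psi with the two lower bounds satisfied by the expected energy density
    has an integral at least c eps^(p - 1). The width parameter q and the
    bound e0 on eps are so small that the negative part takes at most half of the
    contribution of the strip. *)
Lemma energy_integral_ge : exists q c e0 : R, [/\ 0 < q <= 1, 0 < c, 0 < e0 <= 1 &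
  forall (eps eta2 C : R) (Psi M : S2 -> R), 0 < eps < e0 ->
  2 <= eta2 * (q * eps) `^ p <= 16 ->
  measurable_fun setT Psi -> (forall z, `|Psi z| <= C) ->
  (forall t s : R, 0 <= t <= T -> 0 <= s <= T ->
    - (eps `^ (p - 2) * (1 + eta2 * `|t - s| `^ p) * expR (- (eta2 * `|t - s| `^ p) / 2)) <= Psi (t, s)) ->
  (forall t s : R, eps <= t <= T -> eps <= s <= T ->
    M (t, s) * ((eps `^ (p - 2) / 8 - `|t - s| `^ p / (4 * eps ^+ 2) -
       eta2 * (eps `^ (p - 2) ^+ 2 * (t - s) ^+ 2)) * expR (- (eta2 * `|t - s| `^ p) / 2)) <= Psi (t, s)) ->
  (forall z, 0 <= M z <= 1) ->
  (forall t s : R, eps <= t <= T -> eps <= s <= T -> 1 - `|t - s| `^ p / (4 * (q * eps) `^ p) <= M (t, s)) ->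
  ((c * eps `^ (p - 1))%:E <= \int[nu]_z (Psi z)%:E)%E].
Proof.
have scale_out (n x y z c : R) : 0 < n -> x * (n * y * z) <= c -> x * (y * z) <= c / n.
  by move=> n0; rewrite ler_pdivlMr//; apply: le_trans; rewrite le_eqVlt; apply/orP; left; apply/eqP; ring.
have sum_le (c x e : R) : x <= c / 8 * T -> e <= c * T / 64 -> x + 8 * e <= c * T / 4 by lra.
have time_le (h e : R) : h <= e -> e < T / 4 -> e <= T - h /\ T / 2 <= T - h - e by move: T0; lra.
have sum_ge (w c a b : R) : w * (c * T / 2) <= a + b -> b <= w * (c * T / 4) -> w * (c * T / 4) <= a by lra.
pose c0 : R := 3 / 32 * expR (- 8).
have c00 : 0 < c0 by rewrite mulr_gt0 ?expR_gt0.
have pi0 : 0 < pi :> R by exact: pi_gt0.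
have Kpi : 0 < 8 * K * pi by rewrite !mulr_gt0.
have [q [q0 q1 hq]] := powR_small (divr_gt0 c00 Kpi).
pose dl := q `^ p / 4 + 16 * q `^ (2 - p).
have dl0 : 0 <= dl by rewrite addr_ge0// ?mulr_ge0 ?divr_ge0 ?powR_ge0.
pose e1 := c0 * T / (64 * K * pi).
have e10 : 0 < e1 by rewrite divr_gt0// ?mulr_gt0.
pose e0 := Num.min 1 (Num.min (T / 4) e1).
exists q, (c0 * T / 4 * q), e0; split; first by rewrite q0.
- by rewrite !mulr_gt0.
- by rewrite /e0 !lt_min ltr01 e10 divr_gt0//= ge_min lexx.
move=> eps eta2 C Psi M /andP[eps0 epse0] /andP[a2 a16] mPsi PsiC h1 h2 hM hM1.
move: epse0; rewrite !lt_min => /andP[eps1 /andP[epsT epse1]].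
set th := q * eps; have th0 : 0 < th by exact: mulr_gt0.
have the : th <= eps by rewrite ler_piMl// ltW.
set E := eps `^ (p - 2); have E0 : 0 < E by exact: powR_gt0.
pose W := strip_density th.
have W0 z : 0 <= W z by exact: strip_density_ge0.
pose A : set (measurableTypeR R) := `]-oo, eps[%classic.
have mA : measurable A by exact: measurable_itv.
(* [neg] bounds the negative part of Psi: its first term everywhere, the others where
   one of the two times is below eps. *)
pose k1 := E * (dl * K); pose k2 := E * (4 * K).
have k10 : 0 <= k1 by rewrite mulr_ge0 ?(ltW E0)// mulr_ge0// ltW.
have k20 : 0 <= k2 by rewrite mulr_ge0 ?(ltW E0)// mulr_ge0// ltW.
pose neg (z : S2) : R :=
  k1 * (\1_setT z.1 * W z) + (k2 * (\1_A z.1 * W z) + k2 * (\1_A z.2 * W z)).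
have X0 (B : set (measurableTypeR R)) x z : 0 <= \1_B x * W z by rewrite mulr_ge0.
have neg0 z : 0 <= neg z.
  by apply: addr_ge0; [|apply: addr_ge0]; apply: mulr_ge0.
have point z : 0 <= z.1 <= T -> 0 <= z.2 <= T ->
    E * c0 * \1_(strip T th eps) z <= Psi z + neg z.
  case: z => t s /= ht hs; rewrite -lerBlDr indicE.
  have bd : eps > t \/ eps > s -> E * c0 * ((t, s) \in strip T th eps)%:R - neg (t, s) <= Psi (t, s).
    move=> tse; apply: le_trans (h1 _ _ ht hs).
    apply: le_trans (boundary_bound p1 eps0 q0 a2 (t - s)).
    have [|n] := boolP ((t, s) \in strip T th eps).
      by rewrite inE /strip/= => -[]; move: tse; lra.
    rewrite mulr0 sub0r lerN2 mulrA -/k2 -[cauchy_density _ _]/(W (t, s)) /neg/=.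
    rewrite ler_wpDl ?(mulr_ge0 k10)//.
    case: tse => e.
      by rewrite ler_wpDr ?(mulr_ge0 k20)// [\1_A _]indicE mem_set ?mul1r//= /A/= in_itv.
    by rewrite ler_wpDl ?(mulr_ge0 k20)// [\1_A _]indicE mem_set ?mul1r//= /A/= in_itv.
  have [te|te] := ltP t eps; first by apply: bd; left.
  have [se|se] := ltP s eps; first by apply: bd; right.
  have ht' : eps <= t <= T by rewrite te; case/andP: ht.
  have hs' : eps <= s <= T by rewrite se; case/andP: hs.
  apply: (le_trans _ (h2 _ _ ht' hs')).
  apply: (le_trans _ (interior_bound p1 eps0 q0 a2 a16 (hM (t, s)) (hM1 _ _ ht' hs'))).
  rewrite -/E -/dl -/th mulrBr lerB//.
    have [|n] := boolP ((t, s) \in strip T th eps); last first.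
      by rewrite mulr0 mulr_ge0 ?(ltW E0)//; case: ifP => // _; rewrite -/c0 ltW.
    rewrite inE /strip/= => -[_ ts]; rewrite mulr1 ifT//.
    by case/andP: ts => ts1 ts2; rewrite distrC ger0_norm.
  rewrite /neg/= [\1_setT _]indicE mem_set// mul1r -[cauchy_density _ _]/(W (t, s)) mulrA -/k1 lerDl.
  by rewrite addr_ge0// (mulr_ge0 k20).
have mW : measurable_fun setT W by exact: measurable_strip_density.
have mi (B : set (measurableTypeR R)) (g : S2 -> measurableTypeR R) :
    measurable B -> measurable_fun setT g -> measurable_fun setT (fun z => \1_B (g z) * W z).
  move=> mB mg; apply: measurable_funM => //.
  have mB1 : measurable_fun setT (\1_B : measurableTypeR R -> R) by exact: measurable_indic.
  exact: (measurableT_comp mB1 mg).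
have mi1 := mi _ _ measurableT measurable_fst.
have mi2 := mi _ _ mA measurable_fst.
have mi3 := mi _ _ mA measurable_snd.
have mneg : measurable_fun setT neg.
  apply: measurable_funD; first exact: measurable_funM.
  by apply: measurable_funD; exact: measurable_funM.
have lin (k : R) (f : S2 -> R) (b : R) : 0 <= k -> measurable_fun setT f -> (forall z, 0 <= f z) ->
    (\int[nu]_z (f z)%:E <= b%:E)%E -> (\int[nu]_z (k * f z)%:E <= (k * b)%:E)%E.
  move=> kk mf f0 fb; under eq_integral do rewrite EFinM.
  rewrite ge0_integralZl//; first by rewrite EFinM lee_wpmul2l.
    exact/measurable_EFinP.
  by move=> z _; rewrite lee_fin.
have add (f g : S2 -> R) (a b : R) : measurable_fun setT f -> (forall z, 0 <= f z) ->
    measurable_fun setT g -> (forall z, 0 <= g z) ->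
    (\int[nu]_z (f z)%:E <= a%:E)%E -> (\int[nu]_z (g z)%:E <= b%:E)%E ->
    (\int[nu]_z (f z + g z)%:E <= (a + b)%:E)%E.
  move=> mf f0 mg g0 fa gb; under eq_integral do rewrite EFinD.
  rewrite ge0_integralD//; first by rewrite EFinD leeD.
  - by move=> z _; rewrite lee_fin.
  - exact/measurable_EFinP.
  - by move=> z _; rewrite lee_fin.
  - exact/measurable_EFinP.
have pth : 0 <= pi * th by rewrite mulr_ge0// ltW.
have J1 : (\int[nu]_z (\1_setT z.1 * W z)%:E <= (T * (pi * th))%:E)%E.
  by have := (integral_strip_density T0 th0 measurableT).1; rewrite [in leRHS]mT -EFinM.
have J2 : (\int[nu]_z (\1_A z.1 * W z)%:E <= (eps * (pi * th))%:E)%E.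
  apply: (le_trans (integral_strip_density T0 th0 mA).1).
  by rewrite [leRHS]EFinM; apply: lee_wpmul2r; [rewrite lee_fin|exact: mle (ltW eps0)].
have J3 : (\int[nu]_z (\1_A z.2 * W z)%:E <= (eps * (pi * th))%:E)%E.
  apply: (le_trans (integral_strip_density T0 th0 mA).2).
  by rewrite [leRHS]EFinM; apply: lee_wpmul2r; [rewrite lee_fin|exact: mle (ltW eps0)].
have Ineg : (\int[nu]_z (neg z)%:E <= (E * th * (c0 * T / 4))%:E)%E.
  apply: (@le_trans _ _ (k1 * (T * (pi * th)) + (k2 * (eps * (pi * th)) + k2 * (eps * (pi * th))))%:E).
    apply: (add (fun z => k1 * (\1_setT z.1 * W z)) (fun z => k2 * (\1_A z.1 * W z) + k2 * (\1_A z.2 * W z))).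
    - exact: measurable_funM.
    - by move=> z; exact: mulr_ge0.
    - by apply: measurable_funD; exact: measurable_funM.
    - by move=> z; apply: addr_ge0; exact: mulr_ge0.
    - by apply: (lin k1 (fun z => \1_setT z.1 * W z)) => // z; exact: X0.
    - apply: (add (fun z => k2 * (\1_A z.1 * W z)) (fun z => k2 * (\1_A z.2 * W z))).
      + exact: measurable_funM.
      + by move=> z; exact: mulr_ge0.
      + exact: measurable_funM.
      + by move=> z; exact: mulr_ge0.
      + by apply: (lin k2 (fun z => \1_A z.1 * W z)) => // z; exact: X0.
      + by apply: (lin k2 (fun z => \1_A z.2 * W z)) => // z; exact: X0.
  rewrite lee_fin /k1 /k2.
  have Kpi1 : 0 < K * pi by rewrite mulr_gt0.
  have H1 : dl * (K * pi) <= c0 / 8.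
    have : dl * (8 * K * pi) <= c0 by rewrite -ler_pdivlMr.
    exact: scale_out.
  have H2 : eps * (K * pi) <= c0 * T / 64.
    have : eps * (64 * K * pi) <= c0 * T by rewrite -ler_pdivlMr ?(ltW epse1)// !mulr_gt0.
    exact: scale_out.
  rewrite (_ : _ + _ = E * th * (dl * (K * pi) * T + 8 * (eps * (K * pi)))); last by ring.
  rewrite ler_wpM2l ?(mulr_ge0 (ltW E0) (ltW th0))//.
  have : dl * (K * pi) * T <= c0 / 8 * T by rewrite ler_wpM2r// ltW.
  by move=> H3; exact: sum_le H3 H2.
have IPsi : nu.-integrable setT (EFin \o Psi) by exact: integrable_bounded mPsi PsiC.
have ms := measurable_strip T th eps.
have mi4 : measurable_fun setT (fun z => E * c0 * \1_(strip T th eps) z).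
  by apply: measurable_funM => //; exact: measurable_indic.
have Ec0 : 0 <= E * c0 by rewrite mulr_ge0// ltW.
have Istrip : ((E * th * (c0 * T / 2))%:E <= \int[nu]_z (E * c0 * \1_(strip T th eps) z)%:E)%E.
  under eq_integral do rewrite EFinM.
  rewrite ge0_integralZl ?lee_fin//; last first.
    by apply/measurable_EFinP; exact: measurable_indic.
  rewrite integral_indic// setIT.
  have eT : eps <= T - th by have [] := time_le _ _ the epsT.
  have sm := strip_measure th0 (ltW eps0) eT.
  apply: (@le_trans _ _ ((E * c0)%:E * (th * (T - th - eps))%:E)%E); last first.
    by apply: lee_wpmul2l; rewrite ?lee_fin.
  rewrite -EFinM lee_fin (_ : _ * (c0 * T / 2) = E * c0 * (th * (T / 2))); last by ring.
  by rewrite ler_wpM2l// ler_wpM2l ?(ltW th0)//; by have [] := time_le _ _ the epsT.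
have Ineg' : nu.-integrable setT (EFin \o neg).
  apply/integrableP; split; first exact/measurable_EFinP.
  under eq_integral do rewrite /= ger0_norm//.
  by rewrite (le_lt_trans Ineg)// ltry.
have ILE : (\int[nu]_z (E * c0 * \1_(strip T th eps) z)%:E <= \int[nu]_z (Psi z + neg z)%:E)%E.
  pose f := fun z => E * c0 * \1_(strip T th eps) z.
  have f0 z : 0 <= f z by rewrite /f mulr_ge0.
  have mPn : measurable_fun setT (fun z => Psi z + neg z) by exact: measurable_funD.
  rewrite [leRHS](_ : _ = \int[nu]_z (Num.max (f z) (Psi z + neg z))%:E)%E; last first.
    apply: ae_eq_integral => //.
    - exact/measurable_EFinP.
    - by apply/measurable_EFinP; exact: measurable_maxr.
    - have [N [mN N0 subN]] := @ae_square R T; exists N; split => // z nz.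
      apply: subN => -[z1 z2]; apply: nz => _; congr EFin.
      by rewrite max_r//; exact: point.
  apply: ge0_le_integral => //.
  - by move=> z _; rewrite lee_fin f0.
  - exact/measurable_EFinP.
  - by apply/measurable_EFinP; exact: measurable_maxr.
  - by move=> z _; rewrite lee_fin le_max lexx.
have : (\int[nu]_z (Psi z + neg z)%:E = \int[nu]_z (Psi z)%:E + \int[nu]_z (neg z)%:E)%E.
  by under eq_integral do rewrite EFinD; rewrite integralD.
move=> E3; rewrite E3 in ILE.
have fP : (\int[nu]_z (Psi z)%:E)%E \is a fin_num := integrable_fin_num measurableT IPsi.
have fn : (\int[nu]_z (neg z)%:E)%E \is a fin_num := integrable_fin_num measurableT Ineg'.
move: (le_trans Istrip ILE) Ineg; rewrite -(fineK fP) -(fineK fn).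
move: (fine _) (fine _) => a b.
rewrite -EFinD !lee_fin => h3 h4.
have -> : eps `^ (p - 1) = E * eps.
  rewrite -[X in _ * X]powRr1 ?(ltW eps0)// -powRD ?(gt_eqF eps0) ?implybT//.
  by congr (_ `^ _); ring.
rewrite (_ : _ * _ = E * th * (c0 * T / 4)); last by rewrite /th; ring.
exact: sum_ge h3 h4.
Qed.

End energy_bound.

(** * Expected energy at a fixed scale *)

Section paths.
Context {R : realType} d (T : measurableType d) (P : probability T R).
Variables (H : R) (B : R -> T -> R).
Hypothesis fB : real_fBm P H B.
Variables (T1 eps : R).
Hypothesis T10 : 0 <= T1.

Lemma clamp_path_bounded w : exists C, forall t, `|B (clamp T1 t) w| <= C.
Proof.
have [_ cB _ _] := fB.
have c : {within `[0, T1], continuous (B ^~ w)}.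
  apply: continuous_subspaceW (cB w) => t /=.
  by rewrite !in_itv/= => /andP[->].
have [c1 _ h1] := EVT_max T10 c; have [c2 _ h2] := EVT_min T10 c.
exists (`|B c1 w| + `|B c2 w|) => t.
have ti : clamp T1 t \in `[0, T1] by rewrite in_itv/= clamp_ge0// clamp_le.
have := h1 _ ti; have := h2 _ ti; have := ler_norm (B c1 w); have := ler_norm (- B c2 w).
have := normr_ge0 (B c1 w); have := normr_ge0 (B c2 w).
by rewrite normrN ler_norml; lra.
Qed.

Lemma slope_path_bounded w : exists C, forall t, `|slope B T1 eps t w| <= C.
Proof.
have [C hC] := clamp_path_bounded w.
exists (`|(2 * eps)^-1| * (C + C)) => t; rewrite /slope normrM ler_wpM2l//.
rewrite (le_trans (ler_normB _ _))// lerD//.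
by case: ifP => // _; rewrite normr0 (le_trans _ (hC 0)).
Qed.

Lemma measurable_clamp_path :
  measurable_fun setT (fun z : measurableTypeR R * T => B (clamp T1 z.1) z.2).
Proof.
have [[mB _] cB _ _] := fB.
have h := measurable_clamp mB cB.
have -> : (fun z : measurableTypeR R * T => B (clamp T1 z.1) z.2) =
   (fun z : measurableTypeR R * T => B (Num.max 0 z.1) z.2) \o
   (fun z : measurableTypeR R * T => (clamp T1 z.1 : measurableTypeR R, z.2)).
  by apply/funext => z /=; rewrite max_r// clamp_ge0.
apply: measurableT_comp => //.
apply/measurable_fun_pairP; split; last exact: measurable_snd.
rewrite /comp/= /clamp.
by apply: measurable_minr => //; apply: measurable_maxr.
Qed.

Lemma measurable_slope_path :
  measurable_fun setT (fun z : measurableTypeR R * T => slope B T1 eps z.1 z.2).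
Proof.
rewrite (_ : (fun _ => _) = (fun z : measurableTypeR R * T => (2 * eps)^-1 * B (clamp T1 (z.1 + eps)) z.2 +
  (if z.1 < eps then 0 else - (2 * eps)^-1) * B (clamp T1 (z.1 - eps)) z.2)); last first.
  by apply/funext => z; rewrite slopeE.
have shift (a : R) : measurable_fun setT (fun z : measurableTypeR R * T => B (clamp T1 (z.1 + a)) z.2).
  have -> : (fun z : measurableTypeR R * T => B (clamp T1 (z.1 + a)) z.2) =
    (fun z : measurableTypeR R * T => B (clamp T1 z.1) z.2) \o
    (fun z : measurableTypeR R * T => (z.1 + a : measurableTypeR R, z.2)) by [].
  apply: measurableT_comp measurable_clamp_path _.
  apply/measurable_fun_pairP; split; last exact: measurable_snd.
  by rewrite /comp/=; exact: measurable_funD.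
apply: measurable_funD; first exact: measurable_funM.
apply: measurable_funM; last exact: shift.
apply: measurable_fun_ifT => //.
exact: measurable_fun_ltr.
Qed.

End paths.

Section process_sigma_algebra.
Context {R : realType} d (T : measurableType d).
Implicit Types B : R -> T -> R.

(** The underlying set of outcomes, with the sigma-algebra of the process: random
    variables that are measurable on this type have their level sets in
    [sigma_process B]. *)
Definition process_type B :=
  g_sigma_algebraType (\bigcup_(t in `[0, +oo[) preimage_set_system setT (B t) measurable).

Lemma measurable_process B t : 0 <= t ->
  measurable_fun setT (B t : process_type B -> R).
Proof.
move=> t0 _ A mA; apply: sub_sigma_algebra; exists t; first by rewrite /= in_itv/= t0.
by exists A.
Qed.

Lemma sigma_process_preimage B (f : process_type B -> R) : measurable_fun setT f ->
  forall A : set R, measurable A -> sigma_process B (f @^-1` A).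
Proof. by move=> mf A mA; have := mf measurableT A mA; rewrite setTI. Qed.

Lemma sigma_process_sub B : (forall t, 0 <= t -> measurable_fun setT (B t)) ->
  forall E, sigma_process B E -> measurable E.
Proof.
move=> mB; apply: smallest_sub; first exact: sigma_algebra_measurable.
move=> E [t /= t0 [A mA <-]]; apply: mB => //.
by move: t0; rewrite in_itv/= andbT.
Qed.

Lemma measurable_process_clamp B (T1 t : R) : 0 <= T1 ->
  measurable_fun setT (fun w : process_type B => B (clamp T1 t) w).
Proof. by move=> T10; apply: measurable_process; exact: clamp_ge0. Qed.

Lemma measurable_process_slope B (T1 eps t : R) : 0 <= T1 ->
  measurable_fun setT (fun w : process_type B => slope B T1 eps t w).
Proof.
move=> T10; rewrite slopeE; apply: measurable_funD; apply: measurable_funM => //;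
  exact: measurable_process_clamp.
Qed.

End process_sigma_algebra.

(** No integrability is needed: both parts of f have measurable partial integrals. *)
Lemma measurable_partial_integral {R : realType} d1 d2 (T1 : measurableType d1) (T2 : measurableType d2)
    (m2 : {sigma_finite_measure set T2 -> \bar R}) (f : T1 * T2 -> \bar R) :
  measurable_fun setT f -> measurable_fun setT (fun x => \int[m2]_y f (x, y))%E.
Proof.
move=> mf.
rewrite (_ : (fun _ => _) = (fun x => \int[m2]_y (f^\+ (x, y)) - \int[m2]_y (f^\- (x, y)))%E); last first.
  apply/funext => x; rewrite integralE; congr (_ - _)%E; apply: eq_integral => y _.
    by rewrite !funeposE.
  by rewrite !funenegE.
apply: emeasurable_funB.
- have mp : measurable_fun setT (f^\+)%E by exact: measurable_funepos.
  exact: (@measurable_fun_fubini_tonelli_F _ _ T1 T2 R m2 _ mp (fun _ => funepos_ge0 _ _)).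
- have mp : measurable_fun setT (f^\-)%E by exact: measurable_funeneg.
  exact: (@measurable_fun_fubini_tonelli_F _ _ T1 T2 R m2 _ mp (fun _ => funeneg_ge0 _ _)).
Qed.

Lemma measurable_two_times {R : realType} disp (Omega : measurableType disp)
    (S := measurableTypeR R) (f : S * Omega -> R) : measurable_fun setT f ->
  measurable_fun setT (fun y : Omega * (S * S) => f (y.2.1, y.1)) /\
  measurable_fun setT (fun y : Omega * (S * S) => f (y.2.2, y.1)).
Proof.
move=> mf; split.
  apply: (measurableT_comp mf (g := fun y : Omega * (S * S) => (y.2.1, y.1))).
  apply/measurable_fun_pairP; split; last exact: measurable_fst.
  exact: (measurableT_comp measurable_fst measurable_snd).
apply: (measurableT_comp mf (g := fun y : Omega * (S * S) => (y.2.2, y.1))).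
apply/measurable_fun_pairP; split; last exact: measurable_fst.
exact: (measurableT_comp measurable_snd measurable_snd).
Qed.

Section energy_mixture.
Context {R : realType} disp (Omega : measurableType disp) (P : probability Omega R).
Variables (d : nat) (H : R) (X : R -> Omega -> 'rV[R]_d).
Hypothesis hX : fBm P H X.
Hypothesis H0 : 0 < H.
Hypothesis H1 : H < 1.
Variables (T eps : R).
Hypothesis T0 : 0 < T.
Hypothesis eps0 : 0 < eps.
Local Notation S := (measurableTypeR R).
Local Notation nu := (finite_product (itv_measure 0 T) (itv_measure 0 T)).
Local Notation zet := (finite_product P nu).
Local Notation gam := (normal_prob (0 : R) 1).

(** The coordinate processes, their paths clamped to [0, T + 1], and their slopes *)
Definition component (i : 'I_d) (t : R) (w : Omega) : R := X t w ord0 i.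
Definition track (i : 'I_d) (w : Omega) (t : S) : R := component i (clamp (T + 1) t) w.
Definition pslope (i : 'I_d) (w : Omega) (t : S) : R := slope (component i) (T + 1) eps t w.

Let T10 : 0 <= T + 1. Proof. by rewrite addr_ge0// ltW. Qed.
Let fB i : real_fBm P H (component i). Proof. exact: hX.1. Qed.

Variable i0 : 'I_d.
Variable kap : R.
Hypothesis kap0 : 0 <= kap.

Let others : seq 'I_d := enum (predC1 i0).
Let wgt (w : Omega) (z : S * S) := gauss_weight kap [seq track i w | i <- others] z.

Let wgtE w z : wgt w z = \prod_(i | i != i0) expR (- (kap * (track i w z.1 - track i w z.2) ^+ 2)).
Proof. by rewrite /wgt /gauss_weight big_map big_enum. Qed.

(** Energy density of the coordinate i0, weighted by the Gaussian kernels of the other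
    coordinates *)
Definition energy_density (y : Omega * (S * S)) : R :=
  wgt y.1 y.2 * (pslope i0 y.1 y.2.1 * pslope i0 y.1 y.2.2).
Let F := energy_density.
Let Y (y : Omega * (S * S)) : R := track i0 y.1 y.2.1 - track i0 y.1 y.2.2.

Let mpath i := measurable_two_times (measurable_clamp_path (fB i) T10).
Let mslope i := measurable_two_times (measurable_slope_path (fB i) eps T10).

Let mpathw i w : measurable_fun setT (track i w).
Proof. exact: (measurable_fun_pair1 w (measurable_clamp_path (fB i) T10)). Qed.
Let mslopew i w : measurable_fun setT (pslope i w).
Proof. exact: (measurable_fun_pair1 w (measurable_slope_path (fB i) eps T10)). Qed.

Let mwgt : measurable_fun setT (fun y : Omega * (S * S) => wgt y.1 y.2).
Proof.
rewrite (_ : (fun _ => _) = (fun y : Omega * (S * S) => \prod_(i | i != i0) expR (- (kap * (track i y.1 y.2.1 - track i y.1 y.2.2) ^+ 2)))); last first.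
  by apply/funext => y; exact: wgtE.
apply: measurable_prod_cond => i _; apply: measurableT_comp => //; apply: measurableT_comp => //.
apply: measurable_funM => //; apply: measurable_funX.
by have [] := mpath i; exact: measurable_funB.
Qed.

Let mF : measurable_fun setT F.
Proof.
apply: measurable_funM mwgt _.
by have [] := mslope i0; exact: measurable_funM.
Qed.

Let mY : measurable_fun setT Y.
Proof. by have [] := mpath i0; exact: measurable_funB. Qed.

Let wgt01 w z : 0 <= wgt w z <= 1.
Proof. by rewrite gauss_weight_ge0 gauss_weight_le1. Qed.

Let IF : zet.-integrable setT (EFin \o F).
Proof.
have mEF : measurable_fun setT (EFin \o F) by exact/measurable_EFinP.
apply: (@integrable21ltyP _ _ Omega (S * S)%type R P nu (EFin \o F) mEF).2.
have fb (z : S * S) : (\int[P]_w `|(EFin \o F) (w, z)| <= (eps `^ (2 * H - 2))%:E)%E.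
  have ct t := slope_centered (fB i0) eps T10 t.
  have I t : P.-integrable setT (EFin \o (fun w => slope (component i0) (T + 1) eps t w ^+ 2)).
    by have [_ h _] := ct t.
  apply: (@le_trans _ _ (\int[P]_w (2^-1 * slope (component i0) (T + 1) eps z.1 w ^+ 2 +
     2^-1 * slope (component i0) (T + 1) eps z.2 w ^+ 2)%:E)%E).
    apply: ge0_le_integral => //.
    - have : measurable_fun setT (abse \o (EFin \o F)) by exact: measurableT_comp.
      by move=> /(measurable_fun_pair1 z).
    - have [m1 _ _] := ct z.1; have [m2 _ _] := ct z.2.
      by apply/measurable_EFinP; apply: measurable_funD; apply: measurable_funM => //; exact: measurable_funX.
    - move=> w _; rewrite /= lee_fin /F /energy_density/= normrM.
      have /andP[w0 w1] := wgt01 w z; rewrite ger0_norm//.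
      rewrite (@le_trans _ _ `|pslope i0 w z.1 * pslope i0 w z.2|)//; first by rewrite ler_piMl.
      rewrite /pslope; set a := slope _ _ _ _ _; set b := slope _ _ _ _ _.
      have := sqr_ge0 (a - b); have := sqr_ge0 (a + b); rewrite sqrrB sqrrD => h1 h2.
      by rewrite ler_norml; lra.
  rewrite EFin_Rintegral//; last exact: integrable_lin.
  rewrite lee_fin Rintegral_lin//.
  have := slope_var (fB i0) H0 H1 T10 eps0 z.1; have := slope_var (fB i0) H0 H1 T10 eps0 z.2.
  lra.
apply: (@le_lt_trans _ _ (\int[nu]_z (eps `^ (2 * H - 2))%:E)%E).
  apply: ge0_le_integral => //.
  - by move=> z _; exact: integral_ge0.
  - have mae : measurable_fun setT (abse \o (EFin \o F)) by exact: measurableT_comp.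
    exact: (@measurable_fun_fubini_tonelli_G _ _ Omega (S * S)%type R P (abse \o (EFin \o F)) mae (fun _ => abse_ge0 _)).
rewrite -/(\int[nu]_z (cst (eps `^ (2 * H - 2))%:E) z)%E integral_cst// lte_mul_pinfty ?lee_fin ?powR_ge0//.
by rewrite -ge0_fin_numE// fin_num_measure.
Qed.

Let IFc (eta : R) : zet.-integrable setT (EFin \o (fun y => F y * cos (eta * Y y))).
Proof.
have mc : measurable_fun setT (fun y : Omega * (S * S) => cos (eta * Y y)).
  apply: (measurableT_comp (f := cos)); last exact: measurable_funM.
  by apply: continuous_measurable_fun; exact: continuous_cos.
apply: (@integrable_le_EFin R _ _ zet setT _ (fun y => `|F y|)) => //.
- exact: measurable_funM.
- move=> y _; rewrite normrM ler_piMr// ler_norml cos_geN1 cos_le1//.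
- have := integrable_abse IF; apply: eq_integrable => //.
Qed.

(** The Gaussian kernel of the coordinate i0 replaced by the cosine of frequency eta *)
Definition cos_energy (eta : R) : \bar R := (\int[zet]_y (F y * cos (eta * Y y))%:E)%E.

Lemma expected_energy_mixture :
  (\int[P]_w \int[nu]_z
    (expR (- (kap * \sum_i (track i w z.1 - track i w z.2) ^+ 2)) * (pslope i0 w z.1 * pslope i0 w z.2))%:E
  = \int[gam]_x cos_energy (Num.sqrt (2 * kap) * x))%E.
Proof.
pose G (y : Omega * (S * S)) := F y * expR (- (kap * Y y ^+ 2)).
have mG : measurable_fun setT G.
  apply: measurable_funM mF _; apply: measurableT_comp => //; apply: measurableT_comp => //.
  by apply: measurable_funM => //; exact: measurable_funX.
have IG : zet.-integrable setT (EFin \o G).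
  apply: (@integrable_le_EFin R _ _ zet setT _ (fun y => `|F y|)) => //.
  - move=> y _; rewrite normrM ler_piMr// ger0_norm ?expR_ge0//.
    by rewrite -expR0 ler_expR oppr_le0 mulr_ge0// sqr_ge0.
  - have := integrable_abse IF; apply: eq_integrable => //.
transitivity (\int[zet]_y (EFin \o G) y)%E; last exact: (gaussian_mixture kap0 IF mY).
have := @integral12_prod_meas1 _ _ Omega (S * S)%type R P nu (EFin \o G) IG.
rewrite /fubini_F => <-; apply: eq_integral => w _; apply: eq_integral => z _.
rewrite /G /F /energy_density /= wgtE (bigD1 i0)//= mulrDr opprD expRD.
rewrite -expR_sum sumrN -mulr_sumr; congr EFin; rewrite /Y/=; ring.
Qed.

Lemma cos_energy_ge0 eta : (0 <= cos_energy eta)%E.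
Proof.
have := @integral12_prod_meas1 _ _ Omega (S * S)%type R P nu _ (IFc eta).
rewrite /cos_energy /fubini_F => <-; apply: integral_ge0 => w _.
have [C hC] := slope_path_bounded (fB i0) eps T10 w.
have trig (h : R -> R) : continuous h -> (forall r, `|h r| <= 1) ->
   nu.-integrable setT (EFin \o (fun z : S * S => (pslope i0 w z.1 * h (eta * track i0 w z.1)) * (pslope i0 w z.2 * h (eta * track i0 w z.2)) * wgt w z)) /\
   (0 <= \int[nu]_z ((pslope i0 w z.1 * h (eta * track i0 w z.1)) * (pslope i0 w z.2 * h (eta * track i0 w z.2)) * wgt w z)%:E)%E.
  move=> ch h1.
  have mh : measurable_fun setT (fun t : S => pslope i0 w t * h (eta * track i0 w t)).
    apply: measurable_funM => //.
    apply: (measurableT_comp (f := h)); last exact: measurable_funM.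
    exact: continuous_measurable_fun.
  have hC' t : `|pslope i0 w t * h (eta * track i0 w t)| <= C.
    by rewrite normrM -[leRHS]mulr1 ler_pM//; exact: hC.
  have mxs k : measurable_fun setT (nth (cst 0) [seq track i w | i <- others] k).
    have [kn|kn] := ltnP k (size others); last by rewrite nth_default// size_map.
    by rewrite (nth_map i0).
  have mw : measurable_fun setT (fun z : S * S => wgt w z).
    exact: measurable_gauss_weight.
  split; last first.
    exact: (@psd_gauss_weight R _ S (itv_measure 0 T) kap _ (fun t : S => pslope i0 w t * h (eta * track i0 w t)) C kap0 mxs mh hC').
  apply: (@integrable_bounded _ _ _ nu _ (C * C)).
    apply: measurable_funM => //.
    by apply: measurable_funM; [exact: (measurableT_comp mh measurable_fst)|exact: (measurableT_comp mh measurable_snd)].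
  move=> z; rewrite normrM -[leRHS]mulr1; apply: ler_pM => //.
    by rewrite normrM ler_pM.
  by have /andP[a0 a1] := wgt01 w z; rewrite ger0_norm.
have [I1 P1] := trig cos (@continuous_cos R) (fun r => ltac:(by rewrite ler_norml cos_geN1 cos_le1)).
have [I2 P2] := trig sin (@continuous_sin R) (fun r => ltac:(by rewrite ler_norml sin_geN1 sin_le1)).
rewrite (_ : (\int[nu]_z _)%E = (\int[nu]_z
   (((pslope i0 w z.1 * cos (eta * track i0 w z.1)) * (pslope i0 w z.2 * cos (eta * track i0 w z.2)) * wgt w z)%:E +
   ((pslope i0 w z.1 * sin (eta * track i0 w z.1)) * (pslope i0 w z.2 * sin (eta * track i0 w z.2)) * wgt w z)%:E))%E).
  by rewrite integralD// adde_ge0.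
apply: eq_integral => z _; rewrite /F /energy_density /Y/= mulrBr cosB -EFinD; congr EFin; ring.
Qed.

Lemma measurable_cos_energy (b : R) : measurable_fun setT (fun x : measurableTypeR R => cos_energy (b * x)).
Proof.
pose f (u : measurableTypeR R * (Omega * (S * S))) := (F u.2 * cos (b * u.1 * Y u.2))%:E.
have mf : measurable_fun setT f.
  apply/measurable_EFinP; apply: measurable_funM; first exact: (measurableT_comp mF measurable_snd).
  apply: (measurableT_comp (f := cos)).
    by apply: continuous_measurable_fun; exact: continuous_cos.
  apply: measurable_funM; first exact: measurable_funM.
  exact: (measurableT_comp mY measurable_snd).
exact: (@measurable_partial_integral R _ _ (measurableTypeR R) (Omega * (S * S))%type zet f mf).
Qed.

(** The weight carried by the remaining coordinates, in expectation *)
Definition mean_weight (z : S * S) : R := \int[P]_w wgt w z.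

(** Independence of the coordinates separates the weight from the coordinate i0. *)
Lemma energy_fiber eta z :
  (\int[P]_w (F (w, z) * cos (eta * Y (w, z)))%:E =
  (mean_weight z * cos_moment P (component i0) (T + 1) eps eta z.1 z.2)%:E)%E.
Proof.
pose f0 w := cos (eta * incr (component i0) (T + 1) z.1 z.2 w) *
  (slope (component i0) (T + 1) eps z.1 w * slope (component i0) (T + 1) eps z.2 w).
pose g (i : 'I_d) w := expR (- (kap * (component i (clamp (T + 1) z.1) w - component i (clamp (T + 1) z.2) w) ^+ 2)).
have gE w : wgt w z = \prod_(i | i != i0) g i w by exact: wgtE.
have [If0 _] := cos_incr_slope (fB i0) H0 eps T10 eta z.1 z.2.
have Gm (i : 'I_d) E : sigma_process (component i) E -> measurable E.
  by apply: sigma_process_sub => t t0; have [[+ _] _ _ _] := fB i; exact.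
have mf0 : measurable_fun setT (f0 : process_type (component i0) -> R).
  apply: measurable_funM; last first.
    by apply: measurable_funM; exact: measurable_process_slope.
  apply: (measurableT_comp (f := cos)).
    by apply: continuous_measurable_fun; exact: continuous_cos.
  by apply: measurable_funM => //; apply: measurable_funB; exact: measurable_process_clamp.
have mg i : measurable_fun setT (g i : process_type (component i) -> R).
  apply: measurableT_comp => //; apply: measurableT_comp => //.
  apply: measurable_funM => //; apply: measurable_funX.
  by apply: measurable_funB; exact: measurable_process_clamp.
have g01 i w : 0 <= g i w <= 1.
  by rewrite expR_ge0 -expR0 ler_expR oppr_le0 mulr_ge0// sqr_ge0.
have E := independent_mul Gm hX.2 If0 (sigma_process_preimage mf0) g01 (fun i => sigma_process_preimage (mg i)).
have mf0' : measurable_fun setT f0 by apply/measurable_EFinP; exact: measurable_int If0.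
have mgP : measurable_fun setT (fun w => \prod_(i | i != i0) g i w).
  apply: measurable_prod_cond => i _.
  by move=> _ A mA; rewrite setTI; apply: (Gm i); exact: sigma_process_preimage (mg i) _ mA.
have p01 w : 0 <= \prod_(i | i != i0) g i w <= 1.
  apply/andP; split; first by apply: prodr_ge0 => i _; case/andP: (g01 i w).
  by apply: prodr_ile1 => i _; exact: g01.
have If : P.-integrable setT (EFin \o (fun w => f0 w * \prod_(i | i != i0) g i w)).
  apply: (@integrable_le_EFin R _ _ P setT _ (fun w => `|f0 w|)) => //.
  - exact: measurable_funM.
  - by move=> w _; have /andP[a0 a1] := p01 w; rewrite normrM ler_piMr// ger0_norm.
  - by have := integrable_abse If0; apply: eq_integrable.
have -> : (\int[P]_w (F (w, z) * cos (eta * Y (w, z)))%:E = \int[P]_w (f0 w * \prod_(i | i != i0) g i w)%:E)%E.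
  by apply: eq_integral => w _; congr EFin; rewrite /F /energy_density/= gE /f0 /pslope /Y/= /incr /track; ring.
rewrite EFin_Rintegral// E mulrC; congr ((_ * _)%:E).
by apply: eq_Rintegral => w _; rewrite gE.
Qed.

(** Expected energy density at a pair of times *)
Definition energy_mean eta (z : S * S) : R :=
  mean_weight z * cos_moment P (component i0) (T + 1) eps eta z.1 z.2.

Lemma measurable_energy_mean eta : measurable_fun setT (energy_mean eta).
Proof.
apply/measurable_EFinP.
have := measurable_fubini_G (IFc eta); apply: eq_measurable_fun => z _.
by rewrite /fubini_G [LHS]energy_fiber.
Qed.

Lemma cos_energyE eta : cos_energy eta = (\int[nu]_z (energy_mean eta z)%:E)%E.
Proof.
have := @integral21_prod_meas1 _ _ Omega (S * S)%type R P nu _ (IFc eta).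
rewrite /cos_energy /fubini_G => <-; apply: eq_integral => z _; exact: energy_fiber.
Qed.

Let mwgtw z : measurable_fun setT (fun w => wgt w z).
Proof. exact: (measurable_fun_pair1 z mwgt). Qed.

Let Iwgt z : P.-integrable setT (EFin \o (fun w => wgt w z)).
Proof.
apply: (@integrable_bounded _ _ _ P _ 1) => // w.
by have /andP[a0 a1] := wgt01 w z; rewrite ger0_norm.
Qed.

Lemma mean_weight_bounds z : 0 <= mean_weight z <= 1.
Proof.
rewrite /mean_weight Rintegral_ge0/=; last by move=> w _; have /andP[] := wgt01 w z.
rewrite -lee_fin -EFin_Rintegral// -(integral_prob_cst P 1).
apply: ge0_le_integral => //.
- by move=> w _; have /andP[] := wgt01 w z.
- exact/measurable_EFinP.
- by move=> w _; rewrite lee_fin; have /andP[] := wgt01 w z.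
Qed.

Lemma mean_weight_ge z :
  1 - kap * (d%:R * `|clamp (T + 1) z.1 - clamp (T + 1) z.2| `^ (2 * H)) <= mean_weight z.
Proof.
set v := `|_| `^ _.
have v0 : 0 <= v by exact: powR_ge0.
have cI i := incr_centered (fB i) T10 z.1 z.2.
have mI i : measurable_fun setT (fun w => (incr (component i) (T + 1) z.1 z.2 w ^+ 2)%:E).
  by have [m _ _] := cI i; apply/measurable_EFinP; exact: measurable_funX.
have I2 i : (\int[P]_w (incr (component i) (T + 1) z.1 z.2 w ^+ 2)%:E = v%:E)%E.
  rewrite EFin_Rintegral//; last by have [_ h _] := cI i.
  by rewrite (incr_var (fB i)).
have J : (\int[P]_w (\sum_(i <- others) (incr (component i) (T + 1) z.1 z.2 w ^+ 2)%:E) <= (d%:R * v)%:E)%E.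
  rewrite ge0_integral_sum//; last by move=> i w _; rewrite lee_fin sqr_ge0.
  under eq_bigr do rewrite I2.
  rewrite sumEFin lee_fin /others big_enum/= sumr_const -[leLHS]mulr_natl ler_wpM2r// ler_nat.
  by rewrite (leq_trans (max_card _))// card_ord.
have K : (1 <= \int[P]_w ((wgt w z)%:E + kap%:E * (\sum_(i <- others) (incr (component i) (T + 1) z.1 z.2 w ^+ 2)%:E)))%E.
  rewrite -(integral_prob_cst P 1); apply: ge0_le_integral => //.
  - apply: emeasurable_funD; first exact/measurable_EFinP.
    by apply: measurable_funeM; exact: emeasurable_sum.
  - move=> w _; rewrite sumEFin -EFinM -EFinD lee_fin /others big_enum/=.
    rewrite wgtE -expR_sum sumrN -mulr_sumr.
    by have := @expR_ge1Dx R (- (kap * \sum_(i | i != i0) (track i w z.1 - track i w z.2) ^+ 2)); rewrite /incr /track; lra.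
move: K; rewrite ge0_integralD//; last 4 first.
- by move=> w _; have /andP[] := wgt01 w z.
- exact/measurable_EFinP.
- by move=> w _; rewrite mule_ge0 ?lee_fin// sume_ge0// => i _; rewrite lee_fin sqr_ge0.
- by apply: measurable_funeM; exact: emeasurable_sum.
rewrite ge0_integralZl//; last 2 first.
- exact: emeasurable_sum.
- by move=> w _; rewrite sume_ge0// => i _; rewrite lee_fin sqr_ge0.
rewrite EFin_Rintegral// => K.
have := le_trans K (leeD (lexx _) (lee_wpmul2l (_ : 0 <= kap%:E)%E J)).
by rewrite lee_fin => /(_ kap0); rewrite -EFinM -EFinD lee_fin /mean_weight; lra.
Qed.

End energy_mixture.

Lemma normal_prob_itv_gt0 {R : realType} (a b : R) : 0 <= a -> a < b ->
  exists2 g : R, 0 < g & (g%:E <= normal_prob 0 1 `[a, b]%classic)%E.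
Proof.
move=> a0 ab.
have b0 : 0 <= b by rewrite (le_trans a0)// ltW.
pose I : set R := `[a, b]%classic.
have mI : measurable I by exact: measurable_itv.
have f1 (y : R) : `|\1_I y| <= 1 * (1 + y ^+ 2).
  rewrite mul1r indicE ger0_norm// (@le_trans _ _ 1)//; last by rewrite lerDl sqr_ge0.
  by case: (_ \in _).
have [_ E] := @integral_normal_pdfE R \1_I 1 (measurable_indic mI) f1.
rewrite integral_indic// setIT in E.
pose k := (Num.sqrt (pi *+ 2))^-1 : R.
have k0 : 0 < k by rewrite invr_gt0 sqrtr_gt0 mulrn_wgt0// pi_gt0.
exists (k * (expR (- b ^+ 2 / 2) * (b - a))).
  by rewrite !mulr_gt0 ?expR_gt0// subr_gt0.
rewrite E EFinM lee_wpmul2l ?lee_fin ?(ltW k0)//.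
apply: (@le_trans _ _ (\int[lebesgue_measure]_y ((expR (- b ^+ 2 / 2))%:E * (\1_I y)%:E))%E).
  rewrite ge0_integralZl ?lee_fin ?expR_ge0//; last by apply/measurable_EFinP; exact: measurable_indic.
  have -> : (\int[lebesgue_measure]_y (\1_I y)%:E)%E = lebesgue_measure I.
    by rewrite integral_indic// setIT.
  by rewrite lebesgue_measure_itv/= lte_fin ab -EFinB -EFinM.
apply: ge0_le_integral => //.
- by apply: measurable_funeM; apply/measurable_EFinP; exact: measurable_indic.
- apply/measurable_EFinP; apply: measurable_funM; first exact: measurable_indic.
  apply: measurableT_comp => //; apply: measurable_funM => //; apply: measurableT_comp => //.
- move=> y _; rewrite -EFinM lee_fin indicE.
  case: (boolP (y \in I)); rewrite ?mulr0 ?mul0r// mulr1 mul1r inE /I/= in_itv/= => /andP[ya yb].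
  by rewrite ler_expR !mulNr lerN2 ler_wpM2r// ler_sqr ?nnegrE// (le_trans a0).
Qed.

(** At scales u comparable to (q eps)^(2 H), frequencies eta = x / sqrt (2 u) with
    8 d <= x^2 <= 32 d satisfy 2 <= eta^2 (q eps)^(2 H) <= 16, as required by
    [energy_integral_ge]; the other frequencies only contribute nonnegatively. *)
Lemma expected_energy_ge {R : realType} disp (Omega : measurableType disp) (P : probability Omega R)
    (d : nat) (H : R) (X : R -> Omega -> 'rV[R]_d) (T : R) :
  fBm P H X -> 4^-1 < H -> H < 1 -> 0 < T -> (0 < d)%N ->
  exists q c e0 : R, [/\ 0 < q, 0 < c, 0 < e0 <= 1 &
  forall eps u i0, 0 < eps < e0 -> d%:R * (q * eps) `^ (2 * H) <= u <= 2 * (d%:R * (q * eps) `^ (2 * H)) ->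
  ((c * eps `^ (2 * H - 1))%:E <=
   \int[P]_w \int[finite_product (itv_measure 0 T) (itv_measure 0 T)]_z
    (expR (- ((4 * u)^-1 * \sum_i (track X T i w z.1 - track X T i w z.2) ^+ 2)) *
     (pslope X T eps i0 w z.1 * pslope X T eps i0 w z.2))%:E)%E].
Proof.
move=> hX H14 H1 T0 d0.
have H0 : 0 < H by move: H14; lra.
have d0' : 0 < d%:R :> R by rewrite ltr0n.
have p1 : 2^-1 < 2 * H by move: H14; lra.
have p2 : 2 * H < 2 by move: H1; lra.
have [q [c [e0 [/andP[q0 q1] c0 /andP[e00 e01] HE]]]] := energy_integral_ge p1 p2 T0.
(* the Gaussian mixture is restricted to frequencies with x in [a, 2 a] *)
pose a := Num.sqrt (8 * d%:R) : R.
have a0 : 0 < a by rewrite sqrtr_gt0 mulr_gt0.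
have a2 : a ^+ 2 = 8 * d%:R by rewrite sqr_sqrtr// mulr_ge0// ltW.
have [g g0 hg] := @normal_prob_itv_gt0 R a (2 * a) (ltW a0) ltac:(by rewrite ltr_pMl// ltr1n).
exists q, (c * g), e0; split => //; [exact: mulr_gt0|by rewrite e00|].
move=> eps u i0 /andP[eps0 epse0] /andP[u1 u2].
set th := q * eps in u1 u2 *.
have th0 : 0 < th by exact: mulr_gt0.
have thp : 0 < th `^ (2 * H) by exact: powR_gt0.
have u0 : 0 < u by rewrite (lt_le_trans _ u1)// mulr_gt0.
have kap0 : 0 <= (4 * u)^-1 by rewrite invr_ge0 mulr_ge0// ltW.
rewrite (expected_energy_mixture hX H0 H1 T0 eps0 i0 kap0).
set b := Num.sqrt _.
pose A : set (measurableTypeR R) := `[a, 2 * a]%classic.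
have mA : measurable A by exact: measurable_itv.
have mind : measurable_fun setT (EFin \o (\1_A : measurableTypeR R -> R)).
  by apply/measurable_EFinP; exact: measurable_indic.
have cp : 0 <= c * eps `^ (2 * H - 1) by rewrite mulr_ge0 ?powR_ge0// ltW.
apply: (@le_trans _ _ (\int[normal_prob 0 1]_x ((c * eps `^ (2 * H - 1))%:E * (\1_A x)%:E))%E).
  rewrite ge0_integralZl//.
  have -> : (\int[normal_prob 0 1]_x (\1_A x)%:E)%E = normal_prob 0 1 A.
    by rewrite integral_indic// setIT.
  rewrite (_ : (c * g * _) = (c * eps `^ (2 * H - 1)) * g); last by ring.
  by rewrite EFinM lee_wpmul2l.
apply: ge0_le_integral => //.
- by move=> x _; rewrite mule_ge0// lee_fin.
- exact: measurable_funeM.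
- by apply: (measurable_cos_energy hX).
- move=> x _; rewrite indicE; case: (boolP (x \in A)) => [|_]; last first.
    by rewrite /= mule0; apply: (cos_energy_ge0 hX).
  rewrite /= mule1 inE /A/= in_itv/= => /andP[x1 x2].
  rewrite (cos_energyE hX H0 H1 T0 eps0 i0 kap0).
  set eta := b * x.
  have clE t : 0 <= t <= T -> clamp (T + 1) t = t by exact: clamp_id.
  have T10 : 0 <= T + 1 by rewrite addr_ge0// ltW.
  have mw := mean_weight_bounds hX T0 i0 kap0.
  have cmle (t s : R) := cos_moment_le (hX.1 i0) H0 H1 T10 eps0 eta t s.
  have eta2 : eta ^+ 2 = x ^+ 2 / (2 * u).
    by rewrite /eta exprMn sqr_sqrtr ?mulr_ge0//; field; rewrite gt_eqF.
  have x2l : a ^+ 2 <= x ^+ 2 by rewrite ler_sqr ?nnegrE ?(ltW a0)// (le_trans (ltW a0)).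
  have x2u : x ^+ 2 <= (2 * a) ^+ 2.
    by rewrite ler_sqr ?nnegrE ?mulr_ge0 ?(ltW a0)// (le_trans (ltW a0)).
  have small t s : `|energy_mean P X T eps i0 (4 * u)^-1 eta (t, s)| <= `|cos_moment P (component X i0) (T + 1) eps eta t s|.
    by rewrite /energy_mean/= normrM ler_piMl//; have /andP[m0 m1] := mw (t, s); rewrite ger0_norm.
  have x1e (y : R) : (1 + y) * expR (- y / 2) <= 2.
    have e : 1 + y / 2 <= expR (y / 2) by exact: expR_ge1Dx.
    have : expR (y / 2) * expR (- y / 2) = 1 by rewrite -expRD (_ : _ + _ = 0) ?expR0//; clear; lra.
    have := expR_gt0 (- y / 2); move: e; set E1 := expR _; set E2 := expR _ => h1 h2 h3.
    by rewrite (@le_trans _ _ (2 * E1 * E2))//; [rewrite ler_pM2r//; move: h1 (expR_gt0 (y / 2)); rewrite -/E1; clear; lra|rewrite -mulrA h3 mulr1].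
  apply: (HE eps (eta ^+ 2) (eps `^ (2 * H - 2) * 2) (energy_mean P X T eps i0 (4 * u)^-1 eta) (mean_weight P X T i0 (4 * u)^-1)).
  - by rewrite eps0.
  - rewrite eta2 -/th; apply/andP; split.
      rewrite mulrAC ler_pdivlMr ?mulr_gt0//.
      by rewrite a2 in x2l; move: x2l u2 thp; clear; nra.
    rewrite mulrAC ler_pdivrMr ?mulr_gt0//.
    by rewrite exprMn a2 in x2u; move: x2u u1 thp; clear; nra.
  - by apply: (measurable_energy_mean hX H0 H1).
  - move=> [t s]; rewrite (le_trans (small t s))// (le_trans (cmle t s))// -mulrA ler_wpM2l ?powR_ge0//.
  - move=> t s ht hs; have := le_trans (small t s) (cmle t s).
    by rewrite !clE// ler_norml => /andP[].
  - move=> t s ht hs; rewrite /energy_mean/= ler_wpM2l//; first by have /andP[] := mw (t, s).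
    by apply: (cos_moment_ge (hX.1 i0) H0 H1 T10 eps0); move: ht hs epse0 e01; clear; lra.
  - exact: mw.
  - move=> t s ht hs; apply: le_trans (mean_weight_ge hX H0 T0 i0 kap0 (t, s)); rewrite /= !clE; [|by move: ht hs eps0; clear; lra..].
    rewrite -/th lerB// mulrA mulrC ler_wpM2l ?powR_ge0//.
    rewrite mulrC ler_pdivrMr ?mulr_gt0// mulrC ler_pdivlMr ?mulr_gt0//.
    by move: u1; clear; lra.
Qed.

(** * Positivity of the Gamma function *)

Section Gamma_positive.
Context {R : realType}.
Local Notation mu := (@lebesgue_measure R).
Variable alpha : R.
Hypothesis alpha0 : 0 < alpha.

Let f (t : R) : R := t `^ (alpha - 1) * expR (- t).

Let mf : measurable_fun setT f.
Proof.
apply: measurable_funM => //; apply: measurableT_comp => //.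
Qed.

Let f0 t : 0 <= f t. Proof. by rewrite mulr_ge0 ?powR_ge0 ?expR_ge0. Qed.

Let integral_powR_itv (a : R) : 0 < a -> a < 1 ->
  (\int[mu]_(t in `[a, 1%R]) (t `^ (alpha - 1))%:E <= (alpha^-1)%:E)%E.
Proof.
move=> a0 a1.
pose F (t : R) := alpha^-1 * t `^ alpha.
have dF (t : R) : 0 < t -> is_derive t (1 : R) F (t `^ (alpha - 1)).
  move=> t0; apply: is_derive_eq.
    apply: is_deriveM; exact: is_derive1_powR.
  rewrite /GRing.scale/= mulr0 addr0 mulrA mulVf ?mul1r// gt_eqF//.
have cF (t : R) : 0 < t -> {for t, continuous F}.
  by move=> t0; apply/differentiable_continuous/derivable1_diffP; have [] := dF t t0.
rewrite (@continuous_FTC2 _ _ F)//.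
- rewrite -EFinB lee_fin /F powR1 mulr1 gerBl mulr_ge0 ?powR_ge0// invr_ge0 ltW//.
- apply: derivable_within_continuous => t; rewrite in_itv/= => /andP[ta _].
  by apply: derivable_powR; rewrite in_itv/= andbT (lt_le_trans a0).
- split.
  + by move=> x; rewrite in_itv/= => /andP[ax _]; have [] := dF x (lt_trans a0 ax).
  + by apply: cvg_at_right_filter; exact: cF.
  + by apply: cvg_at_left_filter; exact: cF.
- move=> x; rewrite in_itv/= => /andP[ax _]; rewrite derive1E.
  by have [_ ->] := dF x (lt_trans a0 ax).
Qed.

Let integral_near0 : (\int[mu]_(t in `]0%R, 1%R]) (f t)%:E <= (alpha^-1)%:E)%E.
Proof.
pose F (i : nat) : set R := `[i.+2%:R^-1, 1]%classic.
have UF : \bigcup_i F i = `]0, 1]%classic.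
  apply/seteqP; split => t.
    move=> [i _]; rewrite /F/= !in_itv/= => /andP[h ->]; rewrite andbT.
    by rewrite (lt_le_trans _ h).
  rewrite /= in_itv/= => /andP[t0 t1].
  exists (Num.truncn t^-1) => //; rewrite /F /= in_itv/= t1 andbT.
  rewrite -[leRHS]invrK lef_pV2 ?posrE ?invr_gt0//.
  by rewrite (le_trans (ltW (truncnS_gt _)))// ler_nat.
have nd : nondecreasing_seq F.
  apply/nondecreasing_seqP => n; rewrite subsetEset => t; rewrite /F/= !in_itv/= => /andP[h ->].
  by rewrite andbT (le_trans _ h)// lef_pV2 ?posrE// ler_nat.
have mF i : measurable (F i) by exact: measurable_itv.
have mfE i : measurable_fun (F i) (EFin \o f).
  by apply/measurable_EFinP; exact: measurable_funS mf.
have fE0 i x : F i x -> (0 <= (EFin \o f) x)%E by move=> _; rewrite lee_fin f0.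
have L := ge0_nondecreasing_set_cvg_integral (mu := lebesgue_measure) nd mF mfE fE0.
rewrite UF in L.
apply: (cvge_to_le L); apply: nearW => n.
have n0 : 0 < n.+2%:R^-1 :> R by rewrite invr_gt0.
have n1 : n.+2%:R^-1 < 1 :> R by rewrite invf_lt1// ltr1n.
apply: le_trans (integral_powR_itv n0 n1).
apply: ge0_le_integral.
- exact: mF.
- by move=> t _; rewrite lee_fin f0.
- exact: mfE.
- by apply/measurable_EFinP; apply: (@measurable_funS _ _ _ _ setT) => //; exact: measurable_powR.
- move=> t; rewrite /F/= in_itv/= => /andP[t0 _]; rewrite lee_fin /f ler_piMr ?powR_ge0//.
  by rewrite -expR0 ler_expR oppr_le0 (le_trans _ t0)// ltW.
Qed.

(** With N >= alpha - 1, t^N <= (2 N)^N exp (t / 2). *)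
Let tail_bound : exists2 C : R, 0 <= C & forall t, 1 <= t -> f t <= C * exponential_pdf 2^-1 t.
Proof.
pose N := (Num.truncn (alpha - 1)).+1.
have aN : alpha - 1 <= N%:R by rewrite ltW// truncnS_gt.
pose C : R := (2 * N%:R) ^+ N * 2.
exists C; first by rewrite mulr_ge0// exprn_ge0// mulr_ge0.
move=> t t1; have t0 : 0 <= t by rewrite (le_trans _ t1).
rewrite exponential_pdfE// /f.
have h1 : t `^ (alpha - 1) <= t ^+ N by rewrite -powR_mulrn// ler_powR.
have N0 : 0 < 2 * N%:R :> R by rewrite mulr_gt0// ltr0n.
have h2 : t ^+ N <= (2 * N%:R) ^+ N * expR (t / 2).
  have -> : expR (t / 2) = expR (t / (2 * N%:R)) ^+ N.
    by rewrite -expRM_natl; congr expR; field; rewrite pnatr_eq0.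
  rewrite -exprMn lerXn2r ?nnegrE ?mulr_ge0 ?expR_ge0//.
  have := expR_ge1Dx (t / (2 * N%:R)); rewrite -ler_pdivrMl// [_^-1 * _]mulrC.
  by set x := t / _; lra.
rewrite (@le_trans _ _ ((2 * N%:R) ^+ N * expR (t / 2) * expR (- t)))//.
  by rewrite ler_wpM2r ?expR_ge0// (le_trans h1).
rewrite -mulrA -expRD /C mulrA mulfK// (_ : t / 2 - t = - 2^-1 * t)//; lra.
Qed.

Let Gamma_fin : (\int[mu]_(t in `]0%R, +oo[) (f t)%:E < +oo)%E.
Proof.
have [C C0 hC] := tail_bound.
have mfE D : measurable_fun D (EFin \o f).
  by apply/measurable_EFinP; exact: measurable_funS mf.
have -> : `]0, +oo[%classic = `]0, 1]%classic `|` `]1, +oo[%classic :> set R.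
  by rewrite -itv_bndbnd_setU// bnd_simp.
rewrite ge0_integral_setU//=; last 3 first.
- exact: mfE.
- by move=> t _; rewrite lee_fin f0.
- apply/disj_setPS => t [] /=; rewrite !in_itv/= => /andP[_ t1] /andP[]; lra.
apply: lte_add_pinfty; first by rewrite (le_lt_trans integral_near0)// ltry.
have r0 : 0 < 2^-1 :> R by rewrite invr_gt0.
apply: (@le_lt_trans _ _ (\int[mu]_t (C * exponential_pdf 2^-1 t)%:E)%E).
  apply: (@le_trans _ _ (\int[mu]_(t in `]1%R, +oo[) (C * exponential_pdf 2^-1 t)%:E)%E).
    apply: ge0_le_integral => //.
    - by move=> t _; rewrite lee_fin f0.
    - exact: mfE.
    - apply/measurable_EFinP; apply: measurable_funM => //.
      by apply: (@measurable_funS _ _ _ _ setT) => //; exact: measurable_exponential_pdf.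
    - by move=> t; rewrite /= in_itv/= andbT => t1; rewrite lee_fin hC// ltW.
  apply: ge0_subset_integral => //.
  - apply/measurable_EFinP; apply: measurable_funM => //; exact: measurable_exponential_pdf.
  - by move=> t _; rewrite lee_fin mulr_ge0// exponential_pdf_ge0// ltW.
under eq_integral do rewrite EFinM.
rewrite ge0_integralZl//.
- by rewrite integral_exponential_pdf// mule1 ltry.
- by apply/measurable_EFinP; exact: measurable_exponential_pdf.
- by move=> t _; rewrite lee_fin exponential_pdf_ge0// ltW.
Qed.

(** Finiteness matters here: [Gamma] would be 0 if its integral were infinite. *)
Lemma Gamma_gt0 : 0 < Gamma alpha.
Proof.
have f1 : ((expR (- 2) / 2)%:E <= \int[mu]_(t in `]0%R, +oo[) (f t)%:E)%E.
  apply: (@le_trans _ _ (\int[mu]_(t in `]1%R, 2%R]) (f t)%:E)%E); last first.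
    apply: ge0_subset_integral => //.
    - by apply/measurable_EFinP; exact: measurable_funS mf.
    - by move=> t _; rewrite lee_fin f0.
    - by move=> t /=; rewrite !in_itv/= andbT => /andP[t1 _]; rewrite (lt_trans _ t1).
  apply: (@le_trans _ _ (\int[mu]_(t in `]1%R, 2%R]) (cst (expR (- 2) / 2)%:E t))%E).
    rewrite integral_cst// [X in (_ * X)%E](_ : _ = 1%E) ?mule1//.
    transitivity (@lebesgue_measure R `]1, 2]%classic) => //.
    by rewrite lebesgue_measure_itv/= lte_fin ltr1n/= -EFinB; congr EFin; lra.
  apply: ge0_le_integral => //.
  - by move=> t _; rewrite lee_fin divr_ge0// expR_ge0.
  - by apply/measurable_EFinP; exact: measurable_funS mf.
  - move=> t; rewrite /= in_itv/= => /andP[t1 t2]; rewrite lee_fin /f.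
    have t0 : 0 < t by rewrite (lt_trans _ t1).
    rewrite mulrC ler_pM ?expR_ge0//.
      rewrite powRB ?(gt_eqF t0) ?implybT// powRr1 ?(ltW t0)//.
      rewrite -[leLHS]mul1r ler_pM ?invr_ge0//; first by rewrite -[leLHS](powRr0 t) ler_powR ?(ltW t1) ?(ltW alpha0).
      by rewrite lef_pV2 ?posrE.
    by rewrite ler_expR lerN2.
rewrite /Gamma /Rintegral fine_gt0// Gamma_fin andbT.
by rewrite (lt_le_trans _ f1)// lte_fin divr_gt0// expR_gt0.
Qed.

End Gamma_positive.

(** * The Bessel energy and its expectation *)

Section kernel_weights.
Context {R : realType}.
Variables (d : nat) (alpha : R).
Hypothesis alpha0 : 0 < alpha.
Local Notation mu := (@lebesgue_measure R).

(** Constant factor of the Bessel kernel, which is the mixture of the Gaussian kernels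
    exp (- kernel_rate u |x|^2) with weights [kernel_weight u]; the power u^(-1) stands
    for the inverse. *)
Definition kernel_const : R := (Gamma alpha * (4 * pi) `^ (d%:R / 2))^-1.

Definition kernel_rate (u : measurableTypeR R) : R := 4^-1 * u `^ (-1).

Definition kernel_weight (u : measurableTypeR R) : R :=
  kernel_const * (\1_(`]0, +oo[%classic : set (measurableTypeR R)) u *
  (u `^ (alpha - d%:R / 2) * expR (- u) * u `^ (-1))).

Lemma kernel_const_gt0 : 0 < kernel_const.
Proof.
rewrite /kernel_const invr_gt0; apply: mulr_gt0; first exact: Gamma_gt0.
by apply: powR_gt0; apply: mulr_gt0 => //; exact: pi_gt0.
Qed.

Lemma kernel_rate_ge0 u : 0 <= kernel_rate u.
Proof. by rewrite mulr_ge0 ?powR_ge0. Qed.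

Lemma kernel_rateE u : 0 < u -> kernel_rate u = (4 * u)^-1.
Proof. by move=> u0; rewrite /kernel_rate powR_inv1 ?ltW// invfM. Qed.

Lemma kernel_weight_ge0 u : 0 <= kernel_weight u.
Proof.
by rewrite mulr_ge0 ?(ltW kernel_const_gt0)// mulr_ge0// !mulr_ge0 ?powR_ge0 ?expR_ge0.
Qed.

Lemma measurable_kernel_rate : measurable_fun setT kernel_rate.
Proof. by apply: measurable_funM => //; exact: measurable_powR. Qed.

Lemma measurable_kernel_weight : measurable_fun setT kernel_weight.
Proof.
apply: measurable_funM => //; apply: measurable_funM.
  by apply: measurable_indic; exact: measurable_itv.
apply: measurable_funM; last exact: measurable_powR.
apply: measurable_funM; first exact: measurable_powR.
by apply: measurableT_comp.
Qed.

Lemma bessel_kernelE (x : 'rV[R]_d) : bessel_kernel alpha x =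
  (\int[mu]_u (kernel_weight u * expR (- (kernel_rate u * dotv x x)))%:E)%E.
Proof.
have c0 := kernel_const_gt0.
pose f (u : measurableTypeR R) : R := \1_(`]0, +oo[%classic : set (measurableTypeR R)) u *
  (u `^ (alpha - d%:R / 2) * expR (- u) * u `^ (-1)) * expR (- (kernel_rate u * dotv x x)).
have f0 u : 0 <= f u by rewrite mulr_ge0 ?expR_ge0// mulr_ge0// !mulr_ge0 ?powR_ge0 ?expR_ge0.
have mf : measurable_fun setT f.
  apply: measurable_funM; last first.
    apply: measurableT_comp => //; apply: measurableT_comp => //.
    by apply: measurable_funM => //; exact: measurable_kernel_rate.
  apply: measurable_funM.
    by apply: measurable_indic; exact: measurable_itv.
  apply: measurable_funM; last exact: measurable_powR.
  apply: measurable_funM; first exact: measurable_powR.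
  by apply: measurableT_comp.
transitivity (kernel_const%:E * \int[mu]_u (f u)%:E)%E; last first.
  rewrite -ge0_integralZl// ?lee_fin ?(ltW c0)//.
  - by apply: eq_integral => u _; rewrite -EFinM /f /kernel_weight !mulrA.
  - exact/measurable_EFinP.
  - by move=> u _; rewrite lee_fin.
rewrite /bessel_kernel -/kernel_const; congr (_ * _)%E.
rewrite integral_mkcond; apply: eq_integral => u _.
rewrite patchE /f indicE; case: ifPn => [|_]; last by rewrite !mul0r.
rewrite inE/= in_itv/= andbT => u0; congr EFin.
rewrite mul1r kernel_rateE// powR_inv1 ?ltW// expRD invfM.
rewrite [dotv x x * _]mulrC mulrA; ring.
Qed.

End kernel_weights.

Section energy_lower_bound.
Context {R : realType} disp (Omega : measurableType disp) (P : probability Omega R).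
Variables (d : nat) (H alpha : R) (X : R -> Omega -> 'rV[R]_d).
Hypothesis hX : fBm P H X.
Hypothesis alpha0 : 0 < alpha.
Variables (T eps : R).
Hypothesis T0 : 0 < T.
Hypothesis eps0 : 0 < eps.
Hypothesis eps1 : eps <= 1.
Local Notation S := (measurableTypeR R).
Local Notation mu := (@lebesgue_measure R).
Local Notation m := (itv_measure 0 T).
Local Notation nu := (finite_product m m).
Local Notation wt := (kernel_weight d alpha).

Let T10 : 0 <= T + 1. Proof. by rewrite addr_ge0// ltW. Qed.
Let fB i : real_fBm P H (component X i). Proof. exact: hX.1. Qed.

(** Squared distance between two points of the path, scalar product of two slopes, and
    Bessel kernel between two points of the path *)
Definition path_dist2 w (z : S * S) : R := \sum_i (track X T i w z.1 - track X T i w z.2) ^+ 2.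
Definition slope_dot w (z : S * S) : R := \sum_i pslope X T eps i w z.1 * pslope X T eps i w z.2.
Definition path_kernel w (z : S * S) : \bar R :=
  (\int[mu]_u (wt u * expR (- (kernel_rate u * path_dist2 w z)))%:E)%E.

Let mpath i := measurable_two_times (measurable_clamp_path (fB i) T10).
Let mslope i := measurable_two_times (measurable_slope_path (fB i) eps T10).

Let mpathw i w : measurable_fun setT (track X T i w).
Proof. exact: (measurable_fun_pair1 w (measurable_clamp_path (fB i) T10)). Qed.
Let mslopew i w : measurable_fun setT (pslope X T eps i w).
Proof. exact: (measurable_fun_pair1 w (measurable_slope_path (fB i) eps T10)). Qed.

Let mdist : measurable_fun setT (fun y : Omega * (S * S) => path_dist2 y.1 y.2).
Proof.
apply: measurable_sum => i; apply: measurable_funX.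
by have [] := mpath i; exact: measurable_funB.
Qed.

Let mdot : measurable_fun setT (fun y : Omega * (S * S) => slope_dot y.1 y.2).
Proof.
apply: measurable_sum => i.
by have [] := mslope i; exact: measurable_funM.
Qed.

Let mexp : measurable_fun setT (fun y : (Omega * (S * S)) * S => expR (- (kernel_rate y.2 * path_dist2 y.1.1 y.1.2))).
Proof.
apply: measurableT_comp => //; apply: measurableT_comp => //.
apply: measurable_funM; first exact: (measurableT_comp measurable_kernel_rate measurable_snd).
exact: (measurableT_comp mdist measurable_fst).
Qed.

Let mkern : measurable_fun setT (fun y : Omega * (S * S) => path_kernel y.1 y.2).
Proof.
pose f (y : (Omega * (S * S)) * S) := (wt y.2 * expR (- (kernel_rate y.2 * path_dist2 y.1.1 y.1.2)))%:E.
have mf : measurable_fun setT f.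
  apply/measurable_EFinP; apply: measurable_funM mexp.
  exact: (measurableT_comp (measurable_kernel_weight _ _) measurable_snd).
exact: (@measurable_partial_integral R _ _ (Omega * (S * S))%type S mu f mf).
Qed.

Let kern_ge0 w z : (0 <= path_kernel w z)%E.
Proof.
by apply: integral_ge0 => u _; rewrite lee_fin mulr_ge0 ?expR_ge0// kernel_weight_ge0.
Qed.

Let integrand (y : Omega * (S * S)) : \bar R := (path_kernel y.1 y.2 * (slope_dot y.1 y.2)%:E)%E.

Let mint : measurable_fun setT integrand.
Proof. by apply: emeasurable_funM => //; exact/measurable_EFinP. Qed.

Let clE t : 0 <= t <= T + 1 -> clamp (T + 1) t = t. Proof. exact: clampE. Qed.

Let kernelE w (t s : R) : 0 <= t <= T -> 0 <= s <= T ->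
  bessel_kernel alpha (X t w - X s w) = path_kernel w (t, s).
Proof.
move=> ht hs; rewrite bessel_kernelE//; apply: eq_integral => u _.
congr (_ * expR (- (_ * _)))%:E; apply: eq_bigr => i _.
by rewrite !mxE /track /component/= expr2 !clamp_id.
Qed.

Let dotE w (t s : R) : 0 <= t <= T -> 0 <= s <= T ->
  dotv (D0 eps (X ^~ w) t) (D0 eps (X ^~ w) s) = slope_dot w (t, s).
Proof.
move=> ht hs; apply: eq_bigr => i _; rewrite !mxE /pslope /slope /component/=.
have h t' : 0 <= t' <= T -> (2 * eps)^-1 * (X (t' + eps) w ord0 i - (if t' < eps then 0 else X (t' - eps) w) ord0 i) =
  (2 * eps)^-1 * (X (clamp (T + 1) (t' + eps)) w ord0 i - (if t' < eps then 0 else X (clamp (T + 1) (t' - eps)) w ord0 i)).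
  move=> ht'; rewrite clE; last by move: eps0 eps1; lra.
  case: ltP => te; first by rewrite mxE.
  by rewrite clE//; move: eps0 eps1; lra.
by rewrite -!h.
Qed.

Let mfib w (t : S) : measurable_fun setT (fun s : S => integrand (w, (t, s))).
Proof.
apply: (measurableT_comp mint (g := fun s : S => (w, (t, s)))).
apply/measurable_fun_pairP; split; first exact: measurable_cst.
by apply/measurable_fun_pairP; split; [exact: measurable_cst|exact: measurable_id].
Qed.

Let miter : measurable_fun setT (fun y : Omega * S => \int[m]_s integrand (y.1, (y.2, s)))%E.
Proof.
pose f (y : (Omega * S) * S) := integrand (y.1.1, (y.1.2, y.2)).
have mf : measurable_fun setT f.
  apply: (measurableT_comp mint (g := fun y : (Omega * S) * S => (y.1.1, (y.1.2, y.2)))).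
  apply/measurable_fun_pairP; split; first exact: (measurableT_comp measurable_fst measurable_fst).
  apply/measurable_fun_pairP; split; last exact: measurable_snd.
  exact: (measurableT_comp measurable_snd measurable_fst).
exact: (@measurable_partial_integral R _ _ (Omega * S)%type S m f mf).
Qed.

(** The definition of [Zfun] with the time interval built into the measure *)
Lemma Zfun_iterated w : Zfun T alpha eps (X ^~ w) =
  (\int[m]_t \int[m]_s (path_kernel w (t, s) * (slope_dot w (t, s))%:E))%E.
Proof.
rewrite integral_itv_measure; last exact: (measurable_fun_pair2 w miter).
apply: eq_integral => t; rewrite inE/= in_itv/= => ht.
rewrite integral_itv_measure; last exact: mfib.
by apply: eq_integral => s; rewrite inE/= in_itv/= => hs; rewrite kernelE// dotE.
Qed.

Lemma measurable_Zfun : measurable_fun setT (fun w => Zfun T alpha eps (X ^~ w)).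
Proof.
rewrite (funext Zfun_iterated).
exact: (@measurable_partial_integral R _ _ Omega S m _ miter).
Qed.

Let slope_bound w : exists C, forall i t, `|pslope X T eps i w t| <= C.
Proof.
have /choice[C hC] i := slope_path_bounded (fB i) eps T10 w.
exists (\sum_i `|C i|) => i t; rewrite (le_trans (hC i t))// (le_trans (ler_norm _))//.
by rewrite (bigD1 i)//= lerDl sumr_ge0.
Qed.

(** Energy of one coordinate at the scale u *)
Definition scale_energy (i0 : 'I_d) w (u : S) : \bar R :=
  (\int[nu]_z (expR (- (kernel_rate u * path_dist2 w z)) *
     (pslope X T eps i0 w z.1 * pslope X T eps i0 w z.2))%:E)%E.

Let mdistw w : measurable_fun setT (path_dist2 w).
Proof. exact: (measurable_fun_pair2 w mdist). Qed.

Let mdotw w : measurable_fun setT (slope_dot w).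
Proof. exact: (measurable_fun_pair2 w mdot). Qed.

Let path_dist2_ge0 w z : 0 <= path_dist2 w z.
Proof. by apply: sumr_ge0 => i _; exact: sqr_ge0. Qed.

Let mss i0 w : measurable_fun setT (fun z : S * S => pslope X T eps i0 w z.1 * pslope X T eps i0 w z.2).
Proof.
by apply: measurable_funM; [exact: (measurableT_comp (mslopew i0 w) measurable_fst)|
  exact: (measurableT_comp (mslopew i0 w) measurable_snd)].
Qed.

Let mew (u : S) w : measurable_fun setT (fun z => expR (- (kernel_rate u * path_dist2 w z))).
Proof. by apply: measurableT_comp => //; apply: measurableT_comp => //; exact: measurable_funM. Qed.

Let integrable_scale i0 w u : nu.-integrable setT (EFin \o (fun z => expR (- (kernel_rate u * path_dist2 w z)) *
     (pslope X T eps i0 w z.1 * pslope X T eps i0 w z.2))).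
Proof.
have [C hC] := slope_bound w.
apply: (@integrable_bounded _ _ _ nu _ (1 * (C * C))); first exact: measurable_funM.
move=> z; rewrite normrM; apply: ler_pM => //.
  rewrite ger0_norm ?expR_ge0// -expR0 ler_expR oppr_le0.
  by rewrite mulr_ge0// kernel_rate_ge0.
by rewrite normrM ler_pM.
Qed.

Lemma scale_energy_ge0 i0 w u : (0 <= scale_energy i0 w u)%E.
Proof.
have [C hC] := slope_bound w.
rewrite (_ : scale_energy _ _ _ = \int[nu]_z (pslope X T eps i0 w z.1 * pslope X T eps i0 w z.2 *
   gauss_weight (kernel_rate u) [seq track X T i w | i <- enum 'I_d] z)%:E)%E; last first.
  apply: eq_integral => z _; congr EFin; rewrite mulrC; congr (_ * _).
  rewrite /gauss_weight big_map big_enum/= -expR_sum; congr expR.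
  by rewrite /path_dist2 mulr_sumr sumrN.
apply: (@psd_gauss_weight R _ S m _ _ _ C) => //; first exact: kernel_rate_ge0.
move=> k; have [kn|kn] := ltnP k (size (enum 'I_d)); last by rewrite nth_default// size_map.
by rewrite (nth_map i0).
Qed.

Variable U : set S.
Hypothesis mU : measurable U.
Let wt0 (u : S) : R := \1_U u * wt u.

Let wt_ge0 u : 0 <= wt u. Proof. exact: kernel_weight_ge0. Qed.
Let mwt : measurable_fun setT wt. Proof. exact: measurable_kernel_weight. Qed.
Let mwt0 : measurable_fun setT wt0.
Proof. by apply: measurable_funM => //; exact: measurable_indic. Qed.
Let wt0_ge0 u : 0 <= wt0 u. Proof. by rewrite mulr_ge0. Qed.
Let wt0_le u : wt0 u <= wt u.
Proof. by rewrite /wt0 indicE; case: (_ \in _); rewrite ?mul1r ?mul0r. Qed.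

Lemma Zfun_ge i0 w : (\int[nu]_z path_kernel w z < +oo)%E ->
  (\int[mu]_u ((wt0 u)%:E * scale_energy i0 w u) <= Zfun T alpha eps (X ^~ w))%E.
Proof.
move=> Kfin.
have [C hC] := slope_bound w.
have mk : measurable_fun setT (path_kernel w) := measurable_fun_pair2 w mkern.
have mi : measurable_fun setT (fun z => integrand (w, z)) := measurable_fun_pair2 w mint.
have dotC z : `|slope_dot w z| <= d%:R * (C * C).
  rewrite /slope_dot (le_trans (ler_norm_sum _ _ _))//.
  rewrite (le_trans (ler_sum _ (_ : forall i, true -> _ <= C * C)))//.
    by move=> i _; rewrite normrM ler_pM.
  by rewrite sumr_const card_ord mulr_natl.
have Ii : nu.-integrable setT (fun z => integrand (w, z)).
  apply/integrableP; split => //.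
  apply: (@le_lt_trans _ _ (\int[nu]_z ((d%:R * (C * C))%:E * path_kernel w z))%E).
    apply: ge0_le_integral => //.
    - exact: measurableT_comp.
    - exact: measurable_funeM.
    - move=> z _; rewrite /integrand/= abseM (gee0_abs (kern_ge0 _ _)) muleC lee_wpmul2r//.
      by rewrite abse_EFin lee_fin.
  have C0 : 0 <= C by exact: le_trans (hC i0 0).
  rewrite ge0_integralZl// ?lee_fin ?mulr_ge0//.
  by rewrite lte_mul_pinfty ?lee_fin ?mulr_ge0.
have -> : Zfun T alpha eps (X ^~ w) = (\int[nu]_z (path_kernel w z * (slope_dot w z)%:E))%E.
  rewrite Zfun_iterated.
  have := @integral12_prod_meas1 _ _ S S R m m _ Ii.
  by rewrite /fubini_F.
have := @kernel_energy_ge R _ S m d (fun i => track X T i w) (fun i => pslope X T eps i w) C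
  (fun i => mpathw i w) (fun i => mslopew i w) hC wt wt0 kernel_rate mwt mwt0
  measurable_kernel_rate kernel_rate_ge0 wt0_ge0 wt0_le Kfin i0.
apply: le_trans; rewrite le_eqVlt; apply/orP; left; apply/eqP.
apply: eq_integral => u _; rewrite /scale_energy -integralZl//; last exact: integrable_scale.
by apply: eq_integral => z _; rewrite -EFinM; congr EFin; exact: mulrA.
Qed.

Let mscale i0 : measurable_fun setT (fun y : Omega * S => scale_energy i0 y.1 y.2).
Proof.
pose f (y : (Omega * S) * (S * S)) : \bar R := (expR (- (kernel_rate y.1.2 * path_dist2 y.1.1 y.2)) *
     (pslope X T eps i0 y.1.1 y.2.1 * pslope X T eps i0 y.1.1 y.2.2))%:E.
have mp : measurable_fun setT (fun y : (Omega * S) * (S * S) => (y.1.1, y.2) : Omega * (S * S)).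
  apply/measurable_fun_pairP; split; last exact: measurable_snd.
  exact: (measurableT_comp measurable_fst measurable_fst).
have mf : measurable_fun setT f.
  apply/measurable_EFinP; apply: measurable_funM.
    apply: measurableT_comp => //; apply: measurableT_comp => //.
    apply: measurable_funM; last exact: (measurableT_comp mdist mp).
    apply: (measurableT_comp measurable_kernel_rate).
    exact: (measurableT_comp measurable_snd measurable_fst).
  by have [m1 m2] := mslope i0; apply: measurable_funM; [exact: (measurableT_comp m1 mp)|exact: (measurableT_comp m2 mp)].
exact: (@measurable_partial_integral R _ _ (Omega * S)%type (S * S)%type nu f mf).
Qed.

(** The expected energy, bounded below by the scales u in U: if one coordinate has
    expected energy at least b at each of them, then b times their total weight *)
Lemma expected_Zfun_ge i0 (b : R) : 0 <= b ->
  {ae P, forall w, (\int[nu]_z path_kernel w z < +oo)%E} ->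
  (forall u, U u -> (b%:E <= \int[P]_w scale_energy i0 w u)%E) ->
  (b%:E * \int[mu]_u (wt0 u)%:E <= \int[P]_w Zfun T alpha eps (X ^~ w))%E.
Proof.
move=> b0 hfin hU.
pose h (y : Omega * S) : \bar R := ((wt0 y.2)%:E * scale_energy i0 y.1 y.2)%E.
have h0 y : (0 <= h y)%E by rewrite mule_ge0 ?lee_fin// scale_energy_ge0.
have mh : measurable_fun setT h.
  apply: emeasurable_funM => //; apply/measurable_EFinP.
  exact: (measurableT_comp mwt0 measurable_snd).
pose G w := (\int[mu]_u h (w, u))%E.
have mG : measurable_fun setT G.
  exact: (@measurable_partial_integral R _ _ Omega S mu h mh).
have G0 w : (0 <= G w)%E by exact: integral_ge0.
have mZ := measurable_Zfun.
have -> : (\int[P]_w Zfun T alpha eps (X ^~ w) = \int[P]_w (maxe (G w) (Zfun T alpha eps (X ^~ w))))%E.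
  apply: ae_eq_integral => //; first exact: measurable_maxe.
  have [N [mN N0 subN]] := hfin; exists N; split => // w nw.
  apply: subN => hw; apply: nw => _; rewrite max_r//.
  exact: (Zfun_ge i0 hw).
apply: (@le_trans _ _ (\int[P]_w G w)%E); last first.
  apply: ge0_le_integral => //; first exact: measurable_maxe.
  by move=> w _; rewrite le_max lexx.
rewrite /G (@fubini_tonelli _ _ Omega S R P mu h mh h0).
have mwt0E : measurable_fun setT (EFin \o wt0) by exact/measurable_EFinP.
rewrite -ge0_integralZl//; last by move=> u _; rewrite lee_fin.
apply: ge0_le_integral => //.
- by move=> u _; rewrite mule_ge0 ?lee_fin.
- exact: measurable_funeM.
- exact: (@measurable_fun_fubini_tonelli_G _ _ Omega S R P h mh h0).
- move=> u _; rewrite /h/= ge0_integralZl ?lee_fin//.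
  + rewrite muleC; have [uU|nU] := pselect (U u); first by rewrite lee_wpmul2l ?lee_fin// hU.
    by rewrite /wt0 indicE memNset// mul0r !mul0e.
  + exact: (measurable_fun_pair1 u (mscale i0)).
  + by move=> w _; exact: scale_energy_ge0.
Qed.

(** Integrability of the kernel along the path, in terms of the Gaussian mixture *)
Lemma path_kernel_fin w :
  (\int[mu]_(s in `[0%R, T]) \int[mu]_(t in `[0%R, T]) bessel_kernel alpha (X t w - X s w)%R < +oo)%E ->
  (\int[nu]_z path_kernel w z < +oo)%E.
Proof.
have mk : measurable_fun setT (path_kernel w) := measurable_fun_pair2 w mkern.
have mG : measurable_fun setT (fun s : S => \int[m]_t path_kernel w (t, s))%E.
  exact: (@measurable_fun_fubini_tonelli_G _ _ S S R m _ mk (fun z => kern_ge0 w z)).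
have E : (\int[nu]_z path_kernel w z = \int[m]_s \int[m]_t path_kernel w (t, s))%E :=
  @fubini_tonelli2 _ _ S S R m m _ mk (fun z => kern_ge0 w z).
apply: le_lt_trans; rewrite le_eqVlt; apply/orP; left; apply/eqP; rewrite E.
rewrite (integral_itv_measure 0 T mG).
apply: eq_integral => s; rewrite inE/= in_itv/= => hs.
rewrite integral_itv_measure; last exact: (measurable_fun_pair1 s mk).
by apply: eq_integral => t; rewrite inE/= in_itv/= => ht; rewrite kernelE.
Qed.

End energy_lower_bound.

(** * Divergence of the expected energy *)

Section kernel_mass.
Context {R : realType}.
Variables (d : nat) (alpha : R).
Hypothesis alpha0 : 0 < alpha.
Local Notation mu := (@lebesgue_measure R).

(** Mass that the Gaussian mixture gives to the scales between u1 and 2 u1 *)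
Lemma kernel_mass_ge : exists2 k : R, 0 < k & forall u1 : R, 0 < u1 -> u1 <= d%:R ->
  ((k * u1 `^ (alpha - d%:R / 2))%:E <=
   \int[mu]_u (\1_(`[u1, (2 * u1)%R]%classic : set (measurableTypeR R)) u * kernel_weight d alpha u)%:E)%E.
Proof.
set g := alpha - d%:R / 2.
have c0 := kernel_const_gt0 d alpha0.
pose m0 : R := 2 `^ (- `|g|).
have m00 : 0 < m0 by exact: powR_gt0.
exists (kernel_const d alpha * m0 * expR (- (2 * d%:R)) / 2).
  by rewrite !mulr_gt0 ?expR_gt0.
move=> u1 u10 u1d.
pose U : set (measurableTypeR R) := `[u1, (2 * u1)%R]%classic.
have mU : measurable U by exact: measurable_itv.
pose a : R := kernel_const d alpha * (u1 `^ g * m0 * expR (- (2 * d%:R)) * (2 * u1)^-1).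
have a0 : 0 <= a.
  by rewrite mulr_ge0 ?(ltW c0)// !mulr_ge0 ?powR_ge0 ?expR_ge0 ?invr_ge0 ?mulr_ge0// ltW.
apply: (@le_trans _ _ (\int[mu]_u (a%:E * (\1_U u)%:E))%E).
  rewrite ge0_integralZl ?lee_fin//; last by apply/measurable_EFinP; exact: measurable_indic.
  have -> : (\int[mu]_u (\1_U u)%:E)%E = mu U by rewrite integral_indic// setIT.
  rewrite lebesgue_measure_itv/= lte_fin ltr_pMl// ltr1n -EFinB -EFinM lee_fin.
  rewrite le_eqVlt; apply/orP; left; apply/eqP; rewrite /a -/g; field.
  by rewrite gt_eqF.
apply: ge0_le_integral => //.
- by move=> u _; rewrite -EFinM lee_fin mulr_ge0.
- by apply: measurable_funeM; apply/measurable_EFinP; exact: measurable_indic.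
- apply/measurable_EFinP; apply: measurable_funM; first exact: measurable_indic.
  exact: measurable_kernel_weight.
- move=> u _; rewrite -EFinM lee_fin -/U indicE.
  have [|_] := boolP (u \in U); last by rewrite mulr0 mul0r.
  rewrite inE /U/= in_itv/= => /andP[uu1 uu2]; rewrite mulr1 mul1r /kernel_weight ler_wpM2l ?(ltW c0)//.
  have u0 : 0 < u by rewrite (lt_le_trans u10).
  rewrite indicE mem_set ?mul1r; last by rewrite /= in_itv/= u0.
  rewrite powR_inv1 ?(ltW u0)//.
  have ug : u1 `^ g * m0 <= u `^ g.
    have -> : u = u1 * (u / u1) by rewrite mulrC divfK// gt_eqF.
    rewrite powRM ?divr_ge0 ?(ltW u0) ?(ltW u10)// ler_wpM2l ?powR_ge0//.
    have x1 : 1 <= u / u1 by rewrite ler_pdivlMr// mul1r.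
    have x2 : u / u1 <= 2 by rewrite ler_pdivrMr.
    apply: (@le_trans _ _ ((u / u1) `^ (- `|g|))).
      rewrite /m0 !powRN lef_pV2 ?posrE ?powR_gt0 ?(lt_le_trans _ x1)//.
      by rewrite ge0_ler_powR ?nnegrE// (le_trans _ x1).
    by rewrite ler_powR// lerNl -normrN ler_norm.
  apply: ler_pM.
  - by rewrite !mulr_ge0 ?powR_ge0 ?expR_ge0// ltW.
  - by rewrite invr_ge0 mulr_ge0// ltW.
  - apply: ler_pM => //; first by rewrite mulr_ge0 ?powR_ge0// ltW.
    by rewrite ler_expR lerN2 (le_trans uu2)// ler_wpM2l.
  - by rewrite lef_pV2 ?posrE ?mulr_gt0.
Qed.
End kernel_mass.

Lemma limf_einf_pinfty {R : realType} (f : R -> \bar R) :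
  (forall A : R, exists2 e : R, 0 < e & forall x, 0 < x < e -> (A%:E <= f x)%E) ->
  limf_einf f 0^'+ = +oo%E.
Proof.
move=> fA; rewrite limf_einfE; apply: eq_infty => A.
have [e e0 he] := fA A; apply: le_ereal_sup_tmp.
exists (ereal_inf (f @` [set x | 0 < x < e])).
  exists [set x | 0 < x < e] => //; exists e => //= x; rewrite /ball/= sub0r normrN => xe x0.
  by rewrite x0 (le_lt_trans _ xe)// ler_norm.
by apply: le_ereal_inf_tmp => _ [x hx <-]; exact: he.
Qed.

Theorem theorem20 (R : realType) (disp : measure_display)
    (Omega : measurableType disp) (P : probability Omega R)
    (d : nat) (T H alpha : R) (X : R -> Omega -> 'rV[R]_d)
    (hd : (1 <= d)%N) (hT : 0 < T) (hH0 : 4^-1 < H) (hH1 : H < 1)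
    (hX : fBm P H X)
    (halpha0 : 0 < alpha) (halpha1 : alpha < alpha_crit d H)
    (hint : {ae P, forall w,
       (\int[lebesgue_measure]_(s in `[0%R, T])
          \int[lebesgue_measure]_(t in `[0%R, T])
            bessel_kernel alpha (X t w - X s w)%R < +oo)%E}) :
  limf_einf (fun eps : R => (\int[P]_w Zfun T alpha eps (X ^~ w))%E) 0^'+
  = +oo%E.
Proof.
have H0 : 0 < H by rewrite (lt_trans _ hH0)// invr_gt0.
have p0 : 0 < 2 * H by rewrite mulr_gt0.
have d0 : 0 < d%:R :> R by rewrite ltr0n.
pose i0 : 'I_d := Ordinal hd.
have [q [c [e0 [q0 c0 /andP[e00 e01] HE]]]] := expected_energy_ge hX hH0 hH1 hT hd.
have [k k0 Hk] := kernel_mass_ge d halpha0.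
pose g := alpha - d%:R / 2.
(* E Z is at least of order eps^(- kappa), and kappa > 0 because alpha < alpha_crit *)
pose kappa := - (2 * H - 1 + 2 * H * g).
have kappa0 : 0 < kappa.
  have : 2 * H * (alpha - d%:R / 2 + 1) < 2 * H * (2 * H)^-1.
    by rewrite ltr_pM2l//; move: halpha1; rewrite /alpha_crit; lra.
  rewrite divff ?gt_eqF// /kappa /g; lra.
pose C := c * (k * (d%:R * q `^ (2 * H)) `^ g).
have C0 : 0 < C.
  by rewrite mulr_gt0// mulr_gt0// powR_gt0// mulr_gt0// powR_gt0.
(* eps < q^-1 makes the scale u1 at most d *)
pose e1 := Num.min e0 q^-1.
have e10 : 0 < e1 by rewrite lt_min e00 invr_gt0.
have key eps : 0 < eps < e1 -> ((C * eps `^ (- kappa))%:E <= \int[P]_w Zfun T alpha eps (X ^~ w))%E.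
  rewrite lt_min => /andP[eps0 /andP[epse0 epsq]].
  have eps1 : eps <= 1 by rewrite ltW// (lt_le_trans epse0).
  have th0 : 0 < q * eps by rewrite mulr_gt0.
  have th1 : q * eps <= 1 by rewrite mulrC -ler_pdivlMr// div1r ltW.
  pose u1 := d%:R * (q * eps) `^ (2 * H).
  have u10 : 0 < u1 by rewrite mulr_gt0// powR_gt0.
  have u1d : u1 <= d%:R.
    rewrite ler_piMr ?(ltW d0)//.
    apply: (@le_trans _ _ (1 `^ (2 * H))); last by rewrite powR1.
    by rewrite ge0_ler_powR ?nnegrE ?(ltW p0) ?(ltW th0).
  have bn : 0 <= c * eps `^ (2 * H - 1) by rewrite mulr_ge0 ?powR_ge0// ltW.
  pose U : set (measurableTypeR R) := `[u1, (2 * u1)%R]%classic.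
  have mU : measurable U by exact: measurable_itv.
  have hfin : {ae P, forall w, (\int[finite_product (itv_measure 0 T) (itv_measure 0 T)]_z
      path_kernel alpha X T w z < +oo)%E}.
    have [N [mN N0 subN]] := hint; exists N; split => // w nw.
    by apply: subN => hw; apply: nw; exact: (path_kernel_fin hX halpha0 hT hw).
  have hU u : U u -> ((c * eps `^ (2 * H - 1))%:E <= \int[P]_w scale_energy X T eps i0 w u)%E.
    rewrite /U/= in_itv/= => u12; have /andP[u1u _] := u12.
    have u0 : 0 < u by rewrite (lt_le_trans u10).
    have := HE eps u i0; rewrite eps0 epse0 => /(_ isT u12).
    by rewrite /scale_energy kernel_rateE.
  apply: (le_trans _ (expected_Zfun_ge hX halpha0 hT eps0 eps1 mU bn hfin hU)).
  apply: (@le_trans _ _ ((c * eps `^ (2 * H - 1))%:E * (k * u1 `^ g)%:E)%E); last first.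
    by apply: lee_wpmul2l; [rewrite lee_fin|exact: Hk].
  rewrite -EFinM lee_fin le_eqVlt; apply/orP; left; apply/eqP.
  have -> : u1 `^ g = (d%:R * q `^ (2 * H)) `^ g * eps `^ (2 * H * g).
    rewrite /u1 (powRM (2 * H) (ltW q0) (ltW eps0)) mulrA powRM ?powR_ge0//.
      by rewrite -powRrM.
    by rewrite mulr_ge0 ?powR_ge0// ltW.
  rewrite /C /kappa opprK (@powRD _ eps (2 * H - 1) (2 * H * g)) ?(gt_eqF eps0) ?implybT//; ring.
apply: limf_einf_pinfty => A.
pose B := C / (`|A| + 1).
have A1 : 0 < `|A| + 1 by rewrite ltr_wpDl.
have B0 : 0 < B by rewrite divr_gt0.
(* eps^kappa <= B gives C eps^(- kappa) >= |A| + 1 *)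
exists (Num.min e1 (B `^ kappa^-1)); first by rewrite lt_min e10 powR_gt0.
move=> eps; rewrite lt_min => /andP[eps0 /andP[epse1 epsB]].
apply: le_trans (key eps _); last by rewrite eps0.
rewrite lee_fin powRN.
have : eps `^ kappa <= B.
  rewrite -[leRHS]powRr1 ?(ltW B0)// -[X in _ <= _ `^ X](mulVf (lt0r_neq0 kappa0)) powRrM.
  by rewrite ge0_ler_powR ?nnegrE ?(ltW kappa0) ?powR_ge0 ?(ltW eps0) ?(ltW epsB).
have ek : 0 < eps `^ kappa by exact: powR_gt0.
rewrite /B ler_pdivlMr// => h.
rewrite ler_pdivlMr//.
apply: le_trans h; rewrite mulrC ler_wpM2l ?(ltW ek)//.
by rewrite (le_trans (ler_norm A))// lerDl.
Qed.
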